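(* For any $\mathbb Q$SK-pair $(M,K)$ with Blanchfield module $(\mathfrak A,\mathfrak b)$ and annihilator $\delta$ of $\mathfrak A$, one has $Z^{\rm Kri}(M,K)=\psi\big(\widetilde Z(M,K)\big)$ in $\mathcal A(\delta)$, where $Z^{\rm Kri}$ is the Kricker invariant, $\widetilde Z(M,K)\in\mathcal A(\mathfrak A,\mathfrak b)$ and $\psi:\mathcal A(\mathfrak A,\mathfrak b)\to\mathcal A(\delta)$ is the closing map.
   Context: **Pairs and Blanchfield modules.** A $\mathbb Q$-sphere is a closed oriented 3-manifold with the rational homology of $S^3$. A $\mathbb Q$SK-pair $(M,K)$ is a $\mathbb Q$-sphere $M$ with an oriented knot $K\subset M$ trivial in $H_1(M;\mathbb Z)$, up to orientation-preserving homeomorphism of pairs. Let $X$ be the exterior of $K$, $\tilde X$ its infinite cyclic covering (kernel of $\pi_1(X)\to\mathbb Z=\langle t\rangle$ sending the positive meridian to $t$), $\tau$ the deck transformation given by the positive meridian. The Alexander module is $\mathfrak A(M,K)=H_1(\tilde X;\mathbb Q)$ with $t$ acting by $\tau$, a finitely generated torsion $\mathbb Q[t^{\pm1}]$-module with annihilator $\delta$. For knots $J_1,J_2\subset\tilde X$ ($J_1$ disjoint from the translates of $J_2$), $\mathrm{lk}_e(J_1,J_2)=\frac1{\delta(t)}\sum_{k}\langle S,\tau^k(J_2)\rangle t^k$ where $S$ is a rational 2-chain with $\partial S=\delta(\tau)J_1$. The Blanchfield form is $\mathfrak b([J_1],[J_2])=\mathrm{lk}_e(J_1,J_2)\bmod\mathbb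 Q[t^{\pm1}]$. The Blanchfield module is $(\mathfrak A,\mathfrak b)$. **Diagram spaces.** An $(\mathfrak A,\mathfrak b)$-colored diagram is a unitrivalent graph without isolated edge, with oriented trivalent vertices (cyclic order of half-edges), edges oriented and labeled in $\mathbb Q[t^{\pm1}]$, univalent vertices labeled in $\mathfrak A$, and for distinct univalent vertices $v,v'$ labeled $\gamma,\gamma'$ a linking $f_{vv'}\in\frac1\delta\mathbb Q[t^{\pm1}]$ with $f_{vv'}\bmod\mathbb Q[t^{\pm1}]=\mathfrak b(\gamma,\gamma')$ and $f_{v'v}(t)=f_{vv'}(t^{-1})$. Degree = number of trivalent vertices. Relations: AS (reversing one vertex orientation gives a sign $-1$); IHX (I$-$H$+$X$=0$, edges labeled 1); LE (linearity in each edge label); OR (reverse an edge and replace $P(t)$ by $P(t^{-1})$); Hol (multiply by $t$ the labels of the three edges at a trivalent vertex, oriented outward; a loop at the vertex keeps its label); LV ($xD_1+yD_2=D$ if the diagrams differ only at one vertex $v$, labeled $\gamma_1,\gamma_2,x\gamma_1+y\gamma_2$, and $f^D_{vv'}=xf^{D_1}_{vv'}+yf^{D_2}_{vv'}$ for all $v'\ne v$, $x,y\in\mathbb Q$); EV (if the edge at $v$, oriented towards $v$, is labeled $PQ$ and $v$ is labeled $\gamma$, one may replace these by $P$ and $Q\gamma$, and $f_{vv'}$ by $Qf_{vv'}$ for all $v'$); LD (if $v_1,v_2$ have adjacent edges labeled 1 and $f^D_{v_1v_2}=f^{D'}_{v_1v_2}+P$, $P\in\mathbb Q[t^{\pm1}]$,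 all else equal, then $D=D'+D''$ with $D''$ obtained by gluing $v_1$ to $v_2$ into an edge oriented from $v_1$ to $v_2$ labeled $P$); Aut (acting on all univalent labels by an automorphism of $(\mathfrak A,\mathfrak b)$). $\mathcal A_n(\mathfrak A,\mathfrak b)$ is the $\mathbb Q$-space of degree-$n$ diagrams modulo these relations, $\mathcal A=\prod_n\mathcal A_n$. By Aut these spaces depend only on the isomorphism class of $(\mathfrak A,\mathfrak b)$. A $\delta$-colored diagram is a trivalent graph with oriented vertices and edges oriented and labeled in $\frac1{\delta}\mathbb Q[t^{\pm1}]$, degree = number of vertices; $\mathcal A_n(\delta)$ is the $\mathbb Q$-space of those of degree $n$ modulo AS, IHX, LE, OR, Hol (with labels in $\frac1\delta\mathbb Q[t^{\pm1}]$), $\mathcal A(\delta)=\prod_n\mathcal A_n(\delta)$. The map $\psi$ sends an $(\mathfrak A,\mathfrak b)$-colored diagram to the sum over all perfect pairings of its univalent vertices of the diagram obtained by gluing each pair $v,v'$ (with adjacent edges oriented towards $v,v'$ and labeled $P,Q$) into an edge oriented from $v$ to $v'$ labeled $P(t)Q(t^{-1})f_{vv'}(t)$. **Beaded Jacobi diagrams.** For a finite set $C$, $\widetilde{\mathcal A}( *_C)$ is the $\mathbb Q$-space of unitrivalent graphs with oriented trivalent vertices, edges oriented and labeled (beaded) in $\mathbb Q[t^{\pm1}]$, univalent vertices labeled in $C$, modulo AS, IHX, LE, OR, Hol, completed with respect to the number of vertices. For a compact oriented 1-manifold $X$ (skeleton), $\widetilde{\mathcal A}(X)$ is defined likewise with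 univalent vertices embedded in the interior of $X$ and with the additional relation STU (if an edge labeled 1 joins the skeleton to a trivalent vertex with cyclic order (that edge, $b$, $a$), the diagram equals the one where $b$ then $a$ are attached successively along $X$ minus the one where $a$ then $b$ are). $\widetilde{\mathcal A}_{\rm w}(X)$: moreover the skeleton arcs between vertices carry powers of $t$, with product 1 on each component, modulo also Hol$_{\rm w}$ (a skeleton vertex with bead $t^j$ just before, $t^i$ just after, and outgoing edge labeled $P$ may be replaced by $t^{j-1}$, $t^{i+1}$, $tP$). Pushing beads off intervals gives $\widetilde{\mathcal A}_{\rm w}(\uparrow_C)\cong\widetilde{\mathcal A}(\uparrow_C)$, where $\uparrow_C$ is a union of intervals indexed by $C$. The isomorphism $\chi:\widetilde{\mathcal A}( *_C)\to\widetilde{\mathcal A}(\uparrow_C)$ averages all ways of attaching the $c$-labeled vertices to the interval $c$, for each $c$. A strut is an isolated edge; substantial means without strut. Group-like means $\Delta(G)=G\otimes G$ ($G\neq0$), $\Delta$ distributing the connected components in all ways. A matrix $W$ is identified with the sum over $i,j$ of struts from $i$ to $j$ labeled $W_{ij}$. A group-like $G\in\widetilde{\mathcal A}( *_{\{1,\dots,s\}})$ is uniquely $\exp_\sqcup(\frac12W)\sqcup H$ with $W$ hermitian (${}^tW(t)=W(t^{-1})$) and $H$ group-like substantial; $\exp_\sqcup$ is the exponential for disjoint union. If $\det W\neq0$, let $\mathfrak A_W$ be generated by $x_1,\dots,x_s$ with relations $\sum_jW_{ij}x_j=0$, $\mathfrak b_W(x_i,x_j)=-(W^{-1})_{ij}\bmod\mathbb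 Q[t^{\pm1}]$; $\omega(G)=\omega_W(H)\in\mathcal A(\mathfrak A_W,\mathfrak b_W)$ is obtained from $H$ by replacing each label $i$ by $x_i$ and setting $f_{vv'}=-(W^{-1})_{ij}$ when $v,v'$ are labeled $i,j$. **The invariant $\widetilde Z$.** Fix an oriented unknot $\mathcal O\subset S^3$ bounding a disk $\mathcal D$. A surgery presentation of $(M,K)$ is an oriented framed link $L=\sqcup L_i\subset S^3\setminus\mathcal O$ with $\mathrm{lk}(L_i,\mathcal O)=0$ such that surgery on $L$ turns $(S^3,\mathcal O)$ into $(M,K)$; it always exists. Take an admissible diagram of $L$ (projection to $[-1,1]^2$, blackboard framing, $\mathcal D$ projecting to the segment from $(0,0)$ to $(1,0)$, double points of $L$ transverse and off this segment, the points of $L$ over the segment being $L\cap\mathcal D$; upward crossings of $\mathcal D$ count $+1$). Cut along $[-1,1]\times\{0\}$ into $q$-tangles $\gamma_t$ (top) and $\gamma_b$ (bottom), with middle word $(v)(w)$, $w$ corresponding to strands meeting $\mathcal D$ (letter $+$ for downward, $-$ for upward strands). Let $Z$ be the Le–Murakami functor on framed $q$-tangles (Kontsevich integral) in the Cheptea–Habiro–Massuyeau normalization: $\exp(\pm\frac12\,\text{chord})$ on a $\pm$ crossing of two downward strands, $\nu$ (the Kontsevich integral of the 0-framed unknot) on a local maximum, trivial on a local minimum, and cablings of a fixed rational Drinfeld associator on reparenthesizings. $Z^\bullet(L)$ is obtained by stacking $Z(\gamma_b)$, beads $t$ (resp. $t^{-1}$) on the strands of $w$ with sign $-$ (resp.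 $+$), and $Z(\gamma_t)$. Choosing a base point on each $L_i$ off crossings and $\mathcal D$ to cut the skeleton circles into intervals, set $\overline{Z^\circ(L)}=\chi^{-1}\big(\nu^{\otimes\pi_0(L)}\sharp Z^\bullet(L)\big)\in\widetilde{\mathcal A}( *_{\pi_0(L)})$ (a copy of $\nu$ summed to each component). It is group-like, its matrix $W$ satisfies $\det W(1)\ne0$, and $(\mathfrak A_W,\mathfrak b_W)$ is isomorphic to the Blanchfield module of $(M,K)$; $\omega(Z^\circ(L)):=\omega(\overline{Z^\circ(L)})$ does not depend on the base points. With $U_\pm$ a $\pm1$-framed unknot unlinked from $\mathcal O$ and $\sigma_\pm(L)$ the number of positive/negative eigenvalues of the linking matrix of $L$, $\widetilde Z(M,K)=\omega(Z^\circ(U_+))^{-\sigma_+(L)}\sqcup\omega(Z^\circ(U_-))^{-\sigma_-(L)}\sqcup\omega(Z^\circ(L))\in\mathcal A(\mathfrak A,\mathfrak b)$, an invariant of $(M,K)$ (disjoint unions have zero mutual linkings; $\omega(Z^\circ(U_\pm))$ has constant term $\emptyset$ and is inverted for $\sqcup$). **The Kricker invariant.** $Z^{\rm Kri}(M,K)\in\mathcal A(\delta)$ is defined by the same construction, with $\omega$ replaced at the last step by formal Gaussian integration: for $G=\exp_\sqcup(\frac12W)\sqcup H$, $\int G$ is the sum of all ways of gluing all univalent vertices of $\exp_\sqcup(-\frac12W^{-1})$ to all univalent vertices of $H$ with the same labels (beads multiply along glued edges), and $Z^{\rm Kri}(M,K)=\big(\int \overline{Z^\circ(U_+)}\big)^{-\sigma_+(L)}\sqcup\big(\int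 \overline{Z^\circ(U_-)}\big)^{-\sigma_-(L)}\sqcup\int\overline{Z^\circ(L)}$. *)

(* Defs.v *)
From Stdlib Require List.
From HB Require Import structures.
From mathcomp Require Import all_boot all_order all_algebra all_field.
From mathcomp Require Import all_classical all_reals all_analysis.
Set Implicit Arguments.
Unset Strict Implicit.
Unset Printing Implicit Defensive.
Import Order.TTheory GRing.Theory Num.Theory.
Import numFieldNormedType.Exports.
Local Open Scope classical_set_scope.
Local Open Scope ring_scope.

(** Every bead, linking and matrix entry is an element of Q(t); membership in
Q[t,t^-1] or in (1/delta) Q[t,t^-1] is imposed separately. *)

Definition Qt : fieldType := {fraction {poly rat}}.
Definition tofracQ (p : {poly rat}) : Qt := FracField.tofrac p.
Definition tt_ : Qt := tofracQ 'X.
Definition qc (a : rat) : Qt := tofracQ a%:P.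

(** The involution t |-> t^-1 of Q(t), by substitution in numerator and
denominator. *)
Definition subst_inv (p : {poly rat}) : Qt :=
  \sum_(i < size p) qc p`_i * tt_ ^- i.
Definition bar (x : Qt) : Qt :=
  let r : {ratio {poly rat}} := repr (x : {fraction {poly rat}}) in
  subst_inv (frac r).1 / subst_inv (frac r).2.

Definition laurent : {pred Qt} :=
  fun x => `[< exists (p : {poly rat}) (n : nat), x * tt_ ^+ n = tofracQ p >].

Lemma laurentP x : reflect
  (exists (p : {poly rat}) (n : nat), x * tt_ ^+ n = tofracQ p)
  (x \in laurent).
Proof. exact: asboolP. Qed.

Lemma tofracQM p q : tofracQ (p * q) = tofracQ p * tofracQ q.
Proof. exact: rmorphM. Qed.
Lemma tofracQB p q : tofracQ (p - q) = tofracQ p - tofracQ q.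
Proof. exact: rmorphB. Qed.
Lemma tofracQX p n : tofracQ (p ^+ n) = tofracQ p ^+ n.
Proof. exact: rmorphXn. Qed.

Fact laurent_subring : subring_closed laurent.
Proof.
split.
- by apply/laurentP; exists 1, 0%N; rewrite expr0 mulr1 /tofracQ rmorph1.
- move=> x y /laurentP[p [m hp]] /laurentP[q [n hq]]; apply/laurentP.
  exists (p * 'X ^+ n - q * 'X ^+ m), (m + n)%N.
  rewrite tofracQB !tofracQM !tofracQX -hp -hq -/tt_ mulrBl exprD mulrA.
  by rewrite -[y * _ * _]mulrA (mulrC (tt_ ^+ m)).
- move=> x y /laurentP[p [m hp]] /laurentP[q [n hq]]; apply/laurentP.
  by exists (p * q), (m + n)%N; rewrite tofracQM -hp -hq exprD mulrACA.
Qed.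
HB.instance Definition _ := GRing.isSubringClosed.Build Qt laurent
  laurent_subring.

Record LP := MkLP { lpval :> Qt; lpvalP : lpval \in laurent }.
HB.instance Definition _ := [isSub for lpval].
HB.instance Definition _ := [Choice of LP by <:].
HB.instance Definition _ := [SubChoice_isSubComNzRing of LP by <:].

(** A vector space presented by generators and relations is handled through
finite formal combinations of generators, two of them being equal in the
quotient when their difference is a combination of relators. *)

Definition lc (k D : Type) : Type := seq (k * D).

Section LinearCombinations.
Context {k : pzRingType}.

Definition lcoef (D : Type) (x : lc k D) (d : D) : k :=
  \sum_(p <- x | `[< p.2 = d >]) p.1.
Definition lceq (D : Type) (x y : lc k D) : Prop :=
  forall d, lcoef x d = lcoef y d.
Definition lscale (D : Type) (a : k) (x : lc k D) : lc k D :=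
  [seq (a * p.1, p.2) | p <- x].
Definition lmap (D E : Type) (f : D -> E) (x : lc k D) : lc k E :=
  [seq (p.1, f p.2) | p <- x].
Definition lbind (D E : Type) (x : lc k D) (f : D -> lc k E) : lc k E :=
  flatten [seq lscale p.1 (f p.2) | p <- x].
Definition lmul (D E F : Type) (op : D -> E -> F) (x : lc k D) (y : lc k E) :
    lc k F :=
  flatten [seq [seq (p.1 * q.1, op p.2 q.2) | q <- y] | p <- x].
Definition lall (D : Type) (P : D -> Prop) (x : lc k D) : Prop :=
  forall p, List.In p x -> P p.2.

Definition eqmod (D : Type) (Rel : lc k D -> Prop) (x y : lc k D) : Prop :=
  exists rs : seq (k * lc k D),
    (forall r, List.In r rs -> Rel r.2) /\
    forall d, lcoef x d - lcoef y d = \sum_(r <- rs) r.1 * lcoef r.2 d.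

End LinearCombinations.

(** [gs D]: elements of a completed graded space, by homogeneous parts. *)
Definition gs (D : Type) : Type := nat -> lc rat D.

Definition geqmod (D : Type) (Rel : lc rat D -> Prop) (x y : gs D) : Prop :=
  forall n, eqmod Rel (x n) (y n).
Definition gone (D : Type) (d : D) : gs D :=
  fun n => if n == 0%N then [:: (1, d)] else [::].
(** The product [op] may depend on the degrees of its two arguments. *)
Definition gmul (D : Type) (op : nat -> nat -> D -> D -> D) (x y : gs D) :
    gs D :=
  fun n => flatten
    [seq lmul (op k (n - k)%N) (x k) (y (n - k)%N) | k <- iota 0 n.+1].
Definition gpow (D : Type) op (d : D) (x : gs D) (k : nat) : gs D :=
  iter k (gmul op x) (gone d).
(** Inverse of a series with constant term [d]: the geometric series. *)
Definition ginv (D : Type) op (d : D) (x : gs D) : gs D :=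
  let y : gs D := fun n => if n == 0%N then [::] else lscale (-1) (x n) in
  fun n => flatten [seq gpow op d y k n | k <- iota 0 n.+1].
(** Exponential of a series without constant term. *)
Definition gexp (D : Type) op (d : D) (x : gs D) : gs D :=
  fun n => flatten
    [seq lscale (k`!%:R)^-1 (gpow op d x k n) | k <- iota 0 n.+1].

(** A graph is given on its set [H] of half-edges: [edg] exchanges the two halves
of an edge, the orbits of [vtx] are the vertices with their cyclic orders, and
the fixed points of [vtx] are the univalent vertices.  [ori h] holds when the
edge of [h] is oriented away from [h]; [lab h] is the label of that edge. *)
Record graph (H : Type) := Graph {
  vtx : H -> H; edg : H -> H; ori : H -> bool; lab : H -> Qt }.

(** Label of the edge of [h] once it is oriented away from [h]. *)
Definition bead (H : Type) (g : graph H) (h : H) : Qt :=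
  if ori g h then lab g h else bar (lab g h).

Definition ok_graph (H : Type) (S : Qt -> Prop) (g : graph H) : Prop :=
  [/\ forall h, vtx g (vtx g (vtx g h)) = h,
      forall h, edg g (edg g h) = h /\ edg g h <> h,
      forall h, ori g (edg g h) = ~~ ori g h,
      forall h, lab g (edg g h) = lab g h
    & forall h, S (lab g h)].

Section FiniteGraphs.
Context {H : finType}.
Implicit Type g : graph H.

Definition univ g : pred H := fun h => vtx g h == h.
Definition same_vtx g (h : H) : pred H :=
  fun x => x \in [:: h; vtx g h; vtx g (vtx g h)].
Definition same_edge g (h : H) : pred H := fun x => x \in [:: h; edg g h].
Definition ntri g : nat := (#|[pred h | ~~ univ g h]| %/ 3)%N.
Definition nuni g : nat := #|[pred h | univ g h]|.
Definition nvert g : nat := (ntri g + nuni g)%N.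
Definition no_strut g : Prop := forall h, univ g h -> ~~ univ g (edg g h).

Definition pack g : graph 'I_#|H| :=
  Graph (fun i => enum_rank (vtx g (enum_val i)))
        (fun i => enum_rank (edg g (enum_val i)))
        (fun i => ori g (enum_val i)) (fun i => lab g (enum_val i)).

Definition restrict g (A : {set H}) : graph {h : H | h \in A} :=
  Graph (fun h => insubd h (vtx g (val h))) (fun h => insubd h (edg g (val h)))
        (fun h => ori g (val h)) (fun h => lab g (val h)).

(** Gluing.  The half-edges of [G] are univalent vertices, [pi] pairs them,
and [F u v] is the label put on the passage from [u] to [v = pi u].
[gpath n h a] follows the glued path that leaves [h], and returns its other
end together with its label, oriented away from [h]. *)
Fixpoint gpath g (pi : H -> H) (G : pred H) (F : H -> H -> Qt) (n : nat)
    (h : H) (a : Qt) : H * Qt :=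
  let u := edg g h in
  match n with
  | n'.+1 => if G u then gpath g pi G F n' (pi u) (a * bead g h * F u (pi u))
             else (u, a * bead g h)
  | 0%N => (u, a * bead g h)
  end.

(** A new edge is oriented, arbitrarily, by the enumeration of [H]. *)
Definition glue g (pi : H -> H) (G : pred H) (F : H -> H -> Qt) :
    graph {h : H | ~~ G h} :=
  let path h := gpath g pi G F #|H| h 1 in
  let o h := if G (edg g h) then (enum_rank h < enum_rank (path h).1)%N
             else ori g h in
  Graph (fun h => insubd h (vtx g (val h)))
        (fun h => insubd h (path (val h)).1)
        (fun h => o (val h))
        (fun h => if o (val h) then (path (val h)).2
                  else (path (path (val h)).1).2).

(** Perfect pairings of [U], extended by the identity. *)
Definition pairings (U : pred H) : seq {ffun H -> H} :=
  [seq pi : {ffun H -> H} <- enum {: {ffun H -> H}} |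
    [forall h, (pi (pi h) == h) &&
       (if U h then (pi h != h) && U (pi h) else pi h == h)]].

End FiniteGraphs.

Definition gunion (H1 H2 : Type) (g1 : graph H1) (g2 : graph H2) :
    graph (H1 + H2)%type :=
  Graph (fun h => match h with inl x => inl (vtx g1 x)
                             | inr x => inr (vtx g2 x) end)
        (fun h => match h with inl x => inl (edg g1 x)
                             | inr x => inr (edg g2 x) end)
        (fun h => match h with inl x => ori g1 x | inr x => ori g2 x end)
        (fun h => match h with inl x => lab g1 x | inr x => lab g2 x end).

Definition gvoid : graph void :=
  Graph id id (fun=> true) (fun=> 1).

Record diag (Dec : Type -> Type) := Diag {
  dsz : nat; dgr : graph 'I_dsz; ddec : Dec 'I_dsz }.
Arguments Diag {Dec dsz}.

Section CommonRelations.
Context {Dec : Type -> Type}.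
(** [deq f g d d']: the bijection [f] carries the decoration [d] of the graph
[g] to the decoration [d']. *)
Variable deq : forall m n : nat,
  ('I_m -> 'I_n) -> graph 'I_m -> Dec 'I_m -> Dec 'I_n -> Prop.
Variable ok : diag Dec -> Prop.

Definition same_edges n (g g' : graph 'I_n) : Prop :=
  [/\ edg g =1 edg g', ori g =1 ori g' & lab g =1 lab g'].
Definition cyc3 n (g : graph 'I_n) (a b c : 'I_n) : Prop :=
  [/\ vtx g a = b, vtx g b = c & vtx g c = a].

Inductive common_rel : lc rat (diag Dec) -> Prop :=
| RelIso m n (f : 'I_m -> 'I_n) g g' d d' of
    bijective f &
    (forall h, vtx g' (f h) = f (vtx g h)) &
    (forall h, edg g' (f h) = f (edg g h)) &
    (forall h, ori g' (f h) = ori g h) &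
    (forall h, lab g' (f h) = lab g h) &
    deq f g d d' & ok (Diag g d) & ok (Diag g' d') :
    common_rel [:: (1, Diag g d); (-1, Diag g' d')]
| RelAS n (g g' : graph 'I_n) d h of
    ~~ univ g h & same_edges g g' &
    (forall x, vtx g' x = if same_vtx g h x then vtx g (vtx g x)
                          else vtx g x) &
    ok (Diag g d) & ok (Diag g' d) :
    common_rel [:: (1, Diag g d); (1, Diag g' d)]
(* [h, h'] is the inner edge and [a, b, c, d0] are the four outer half-edges:
   I, -H, X are the three cyclic permutations of [a, b, c]. *)
| RelIHX n (g1 g2 g3 : graph 'I_n) d h h' a b c d0 of
    uniq [:: h; h'; a; b; c; d0] & edg g1 h = h' & lab g1 h = 1 &
    same_edges g1 g2 & same_edges g1 g3 &
    (forall x, x \notin [:: h; h'; a; b; c; d0] ->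
       vtx g2 x = vtx g1 x /\ vtx g3 x = vtx g1 x) &
    cyc3 g1 h a b /\ cyc3 g1 h' c d0 &
    cyc3 g2 h b c /\ cyc3 g2 h' a d0 &
    cyc3 g3 h c a /\ cyc3 g3 h' b d0 &
    ok (Diag g1 d) & ok (Diag g2 d) & ok (Diag g3 d) :
    common_rel [:: (1, Diag g1 d); (1, Diag g2 d); (1, Diag g3 d)]
| RelLE n (g g1 g2 : graph 'I_n) d h (x y : rat) of
    vtx g =1 vtx g1 & vtx g =1 vtx g2 &
    edg g =1 edg g1 & edg g =1 edg g2 &
    ori g =1 ori g1 & ori g =1 ori g2 &
    (forall z, ~~ same_edge g h z -> lab g1 z = lab g z /\ lab g2 z = lab g z) &
    lab g h = qc x * lab g1 h + qc y * lab g2 h &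
    ok (Diag g d) & ok (Diag g1 d) & ok (Diag g2 d) :
    common_rel [:: (1, Diag g d); (- x, Diag g1 d); (- y, Diag g2 d)]
| RelOR n (g g' : graph 'I_n) d h of
    vtx g =1 vtx g' & edg g =1 edg g' &
    (forall z, ori g' z = if same_edge g h z then ~~ ori g z else ori g z) &
    (forall z, lab g' z = if same_edge g h z then bar (lab g z)
                          else lab g z) &
    ok (Diag g d) & ok (Diag g' d) :
    common_rel [:: (1, Diag g d); (-1, Diag g' d)]
(* an edge with its tail (resp. head) at the vertex of [h] gets a factor [t]
   (resp. [t^-1]) *)
| RelHol n (g g' : graph 'I_n) d h of
    ~~ univ g h &
    vtx g =1 vtx g' & edg g =1 edg g' & ori g =1 ori g' &
    (forall z, ori g z ->
       lab g' z = lab g z * (if same_vtx g h z then tt_ else 1)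
                          * (if same_vtx g h (edg g z) then tt_^-1 else 1)) &
    ok (Diag g d) & ok (Diag g' d) :
    common_rel [:: (1, Diag g d); (-1, Diag g' d)].

End CommonRelations.

Definition ddiag : Type := diag (fun=> unit).
Definition deltalab (delta : Qt) : Qt -> Prop :=
  fun x => x * delta \in laurent.
Definition okd (delta : Qt) (D : ddiag) : Prop :=
  ok_graph (deltalab delta) (dgr D) /\ forall h, ~~ univ (dgr D) h.
Definition drel (delta : Qt) : lc rat ddiag -> Prop :=
  common_rel (fun _ _ _ _ _ _ => True) (okd delta).

Definition dmk (H : finType) (g : graph H) : ddiag :=
  @Diag (fun=> unit) _ (pack g) tt.
Definition dunion (D1 D2 : ddiag) : ddiag := dmk (gunion (dgr D1) (dgr D2)).
Definition dempty : ddiag := dmk gvoid.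

(** The form [b], with values in Q(t)/Q[t,t^-1], is given by representatives
in Q(t).  The decoration consists of the labels of the univalent vertices and
of their mutual linkings; its values elsewhere are irrelevant. *)
Section Colored.
Variables (A : lmodType LP) (b : A -> A -> Qt) (delta : Qt).

Definition cdec (H : Type) : Type := (H -> A) * (H -> H -> Qt).
Definition cdiag : Type := diag cdec.
Definition colr (D : cdiag) : 'I_(dsz D) -> A := (ddec D).1.
Definition lnk (D : cdiag) : 'I_(dsz D) -> 'I_(dsz D) -> Qt := (ddec D).2.

Definition okc (D : cdiag) : Prop :=
  let g := dgr D in
  [/\ ok_graph (fun x => x \in laurent) g, no_strut g &
      forall v v', univ g v -> univ g v' -> v <> v' ->
        [/\ deltalab delta (lnk v v'),
            lnk v v' - b (colr v) (colr v') \in laurent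
          & lnk v' v = bar (lnk v v')]].

Definition cdeq (m n : nat) (f : 'I_m -> 'I_n) (g : graph 'I_m)
    (d : cdec 'I_m) (d' : cdec 'I_n) : Prop :=
  (forall h, univ g h -> d'.1 (f h) = d.1 h) /\
  (forall h h', univ g h -> univ g h' -> h <> h' ->
     d'.2 (f h) (f h') = d.2 h h').

Definition cglue (H : finType) (g : graph H) (d : cdec H) (pi : H -> H)
    (G : pred H) (F : H -> H -> Qt) : cdiag :=
  @Diag cdec _ (pack (glue g pi G F))
    (fun i => d.1 (val (enum_val i)),
     fun i j => d.2 (val (enum_val i)) (val (enum_val j))).

Definition is_aut (s : A -> A) : Prop :=
  [/\ bijective s, forall x y, s (x + y) = s x + s y,
      forall (q : LP) x, s (q *: x) = q *: s x
    & forall x y, b (s x) (s y) - b x y \in laurent].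

Fact qc_laurent (a : rat) : qc a \in laurent.
Proof. by apply/laurentP; exists a%:P, 0%N; rewrite expr0 mulr1. Qed.
Definition lqc (a : rat) : LP := MkLP (qc_laurent a).

Inductive crel : lc rat cdiag -> Prop :=
| RelCommon r of common_rel cdeq okc r : crel r
| RelLV n (g : graph 'I_n) (c c1 c2 : 'I_n -> A) (f f1 f2 : 'I_n -> 'I_n -> Qt)
    v (x y : rat) of
    univ g v & c v = lqc x *: c1 v + lqc y *: c2 v &
    (forall u, u <> v -> c1 u = c u /\ c2 u = c u) &
    (forall u, univ g u -> u <> v ->
       f v u = qc x * f1 v u + qc y * f2 v u) &
    (forall u u', u <> v -> u' <> v -> f1 u u' = f u u' /\ f2 u u' = f u u') &
    okc (@Diag cdec _ g (c, f)) & okc (@Diag cdec _ g (c1, f1)) &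
    okc (@Diag cdec _ g (c2, f2)) :
    crel [:: (1, @Diag cdec _ g (c, f)); (- x, @Diag cdec _ g (c1, f1));
             (- y, @Diag cdec _ g (c2, f2))]
| RelEV n (g g' : graph 'I_n) (c c' : 'I_n -> A) (f f' : 'I_n -> 'I_n -> Qt)
    v (P Q : LP) of
    univ g v & vtx g =1 vtx g' & edg g =1 edg g' & ori g =1 ori g' &
    ori g v = false &
    lab g v = lpval P * lpval Q & lab g' v = lpval P &
    (forall z, ~~ same_edge g v z -> lab g' z = lab g z) &
    c' v = Q *: c v & (forall u, u <> v -> c' u = c u) &
    (forall u, univ g u -> u <> v -> f' v u = lpval Q * f v u) &
    (forall u u', u <> v -> u' <> v -> f' u u' = f u u') &
    okc (@Diag cdec _ g (c, f)) & okc (@Diag cdec _ g' (c', f')) :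
    crel [:: (1, @Diag cdec _ g (c, f)); (-1, @Diag cdec _ g' (c', f'))]
| RelLD n (g : graph 'I_n) (c : 'I_n -> A) (f f' : 'I_n -> 'I_n -> Qt)
    v1 v2 (P : LP) of
    univ g v1 & univ g v2 & v1 <> v2 & lab g v1 = 1 & lab g v2 = 1 &
    f v1 v2 = f' v1 v2 + lpval P &
    (forall u u', ~ (u = v1 /\ u' = v2) -> ~ (u = v2 /\ u' = v1) ->
       f u u' = f' u u') &
    okc (@Diag cdec _ g (c, f)) & okc (@Diag cdec _ g (c, f')) :
    crel [:: (1, @Diag cdec _ g (c, f)); (-1, @Diag cdec _ g (c, f'));
             (-1, cglue g (c, f)
                (fun u => if u == v1 then v2 else if u == v2 then v1 else u)
                (fun u => u \in [:: v1; v2])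
                (fun u _ => if u == v1 then lpval P else bar (lpval P)))]
| RelAut n (g : graph 'I_n) (c : 'I_n -> A) (f : 'I_n -> 'I_n -> Qt)
    (s : A -> A) of
    is_aut s & okc (@Diag cdec _ g (c, f)) &
    okc (@Diag cdec _ g (s \o c, f)) :
    crel [:: (1, @Diag cdec _ g (c, f)); (-1, @Diag cdec _ g (s \o c, f))].

Definition cunion (D1 D2 : cdiag) : cdiag :=
  let H := ('I_(dsz D1) + 'I_(dsz D2))%type in
  let c (h : H) := match h with inl x => colr x | inr x => colr x end in
  let f (h h' : H) := match h, h' with
    | inl x, inl y => lnk x y | inr x, inr y => lnk x y | _, _ => 0 end in
  @Diag cdec _ (pack (gunion (dgr D1) (dgr D2)))
    (fun i => c (enum_val i), fun i j => f (enum_val i) (enum_val j)).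
Definition cempty : cdiag :=
  @Diag cdec _ (pack gvoid) (fun=> 0, fun _ _ => 0).

(** The edges at [v] and [v'] are read towards [v] and [v'], as P and Q; the
glued edge, from [v] to [v'], gets P(t) Q(t^-1) f_(vv')(t). *)
Definition psi1 (D : cdiag) : lc rat ddiag :=
  [seq (1, dmk (glue (dgr D) pi (univ (dgr D)) (@lnk D)))
    | pi : {ffun 'I_(dsz D) -> 'I_(dsz D)} <- pairings (univ (dgr D))].
Definition psi (x : gs cdiag) : gs ddiag := fun n => lbind (x n) psi1.

End Colored.

Section Symmetric.
Variable s : nat.

Definition sdiag : Type := diag (fun H => H -> 'I_s).
Definition scol (D : sdiag) : 'I_(dsz D) -> 'I_s := ddec D.
Definition oks (D : sdiag) : Prop := ok_graph (fun x => x \in laurent) (dgr D).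
Definition srel : lc rat sdiag -> Prop :=
  common_rel (Dec := fun H => H -> 'I_s)
    (fun m n (f : 'I_m -> 'I_n) g c c' => forall h, univ g h -> c' (f h) = c h)
    oks.

(** Degree = number of vertices. *)
Definition swf (x : gs sdiag) : Prop :=
  forall n, lall (fun D => oks D /\ nvert (dgr D) = n) (x n).

Definition smk (H : finType) (g : graph H) (c : H -> 'I_s) : sdiag :=
  @Diag (fun H => H -> 'I_s) _ (pack g) (fun i => c (enum_val i)).
Definition sunion (D1 D2 : sdiag) : sdiag :=
  smk (gunion (dgr D1) (dgr D2))
      (fun h => match h with inl x => scol x | inr x => scol x end).
Definition sempty : sdiag := smk gvoid (fun x : void => match x with end).

(** The strut oriented from [i] to [j] and labeled [P]. *)
Definition strut (i j : 'I_s) (P : Qt) : sdiag :=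
  smk (Graph (fun h : bool => h) negb negb (fun=> P))
      (fun h => if h then j else i).
Definition struts (a : rat) (W : 'M[Qt]_s) : gs sdiag :=
  fun n => if n == 2%N
           then [seq (a, strut i j (W i j)) | i <- enum 'I_s, j <- enum 'I_s]
           else [::].
Definition exp_struts (a : rat) (W : 'M[Qt]_s) : gs sdiag :=
  gexp (fun _ _ => sunion) sempty (struts a W).

Definition hermitian (W : 'M[Qt]_s) : Prop :=
  forall i j, W i j \in laurent /\ W j i = bar (W i j).
Definition substantial (x : gs sdiag) : Prop :=
  forall n, lall (fun D => no_strut (dgr D)) (x n).

(** The coproduct distributes the connected components: the sum is over all
unions [B] of components.  [scoprod x m n] is the part of bidegree (m,n). *)
Definition scoprod1 (m : nat) (D : sdiag) : lc rat (sdiag * sdiag) :=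
  let g := dgr D in
  let part (B : {set 'I_(dsz D)}) :=
    smk (restrict g B) (fun h => scol (val h)) in
  [seq (1, (part B, part (finset.setC B)))
    | B : {set 'I_(dsz D)} <- enum {: {set 'I_(dsz D)}} &
      [forall h in B, (vtx g h \in B) && (edg g h \in B)] &&
      (nvert (restrict g B) == m)].
Definition scoprod (x : gs sdiag) (m n : nat) : lc rat (sdiag * sdiag) :=
  lbind (x (m + n)%N) (scoprod1 m).
Inductive srel2 : lc rat (sdiag * sdiag) -> Prop :=
| Srel2l r D of srel r & oks D : srel2 (lmap (fun E => (E, D)) r)
| Srel2r r D of srel r & oks D : srel2 (lmap (fun E => (D, E)) r).
Definition grouplike (x : gs sdiag) : Prop :=
  (forall m n, eqmod srel2 (scoprod x m n) (lmul pair (x m) (x n))) /\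
  ~ geqmod srel x (fun=> [::]).

(** All ways of gluing all the univalent vertices of [E] to all those of [D]
with the same labels. *)
Definition bracket (E D : sdiag) : lc rat ddiag :=
  let g := gunion (dgr E) (dgr D) in
  let c (h : 'I_(dsz E) + 'I_(dsz D)) :=
    match h with inl x => scol x | inr x => scol x end in
  let inE_ (h : 'I_(dsz E) + 'I_(dsz D)) := if h is inl _ then true else false in
  [seq (1, dmk (glue g pi (univ g) (fun _ _ => 1)))
    | pi : {ffun 'I_(dsz E) + 'I_(dsz D) -> 'I_(dsz E) + 'I_(dsz D)}
        <- pairings (univ g) &
      [forall h, univ g h ==> (inE_ (pi h) != inE_ h) && (c (pi h) == c h)]].

(** Formal Gaussian integral of exp(W/2) H.  A substantial diagram with [n]
trivalent vertices has at most [4 n] vertices. *)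
Definition gauss (W : 'M[Qt]_s) (h : gs sdiag) : gs ddiag :=
  fun n => flatten
    [seq lbind [seq p <- h m | ntri (dgr p.2) == n]
       (fun D => lbind (exp_struts (- 2^-1) (invmx W) (nuni (dgr D)))
                       (fun E => bracket E D))
      | m <- iota 0 (4 * n).+1].

(** The same, with the labels replaced by elements of a Blanchfield module. *)
Definition omega (A : lmodType LP) (x : 'I_s -> A) (W : 'M[Qt]_s)
    (h : gs sdiag) : gs (cdiag A) :=
  fun n => flatten
    [seq lmap (fun D : sdiag =>
            @Diag (cdec A) _ (dgr D)
              (fun v => x (scol v),
               fun v v' => - invmx W (scol v) (scol v')))
          [seq p <- h m | ntri (dgr p.2) == n]
      | m <- iota 0 (4 * n).+1].

(** [x] identifies the module generated by [x_1, ..., x_s] with relation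
matrix [W], together with the form -W^-1, with (A,b). *)
Definition presents (W : 'M[Qt]_s) (A : lmodType LP) (b : A -> A -> Qt)
    (x : 'I_s -> A) : Prop :=
  [/\ W \in unitmx,
      forall a, exists u : 'I_s -> LP, a = \sum_j u j *: x j,
      forall u : 'I_s -> LP, \sum_j u j *: x j = 0 <->
        exists v : 'I_s -> LP,
          forall j, lpval (u j) = \sum_i lpval (v i) * W i j
    & forall i j, b (x i) (x j) + invmx W i j \in laurent].

End Symmetric.

Section Intervals.
Variable s : nat.

(** The decoration lists the univalent vertices met along each interval. *)
Definition udec (H : Type) : Type := 'I_s -> seq H.
Definition udiag : Type := diag udec.
Definition legs (D : udiag) : 'I_s -> seq 'I_(dsz D) := ddec D.
Definition oku (D : udiag) : Prop :=
  ok_graph (fun x => x \in laurent) (dgr D) /\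
  forall h, count_mem h (flatten [seq @legs D c | c <- enum 'I_s])
            = (univ (dgr D) h : nat).

(** [u] is the vertex on the skeleton, [w = edg u] its trivalent neighbour, with
cyclic order [w, y, x]; [i] is the inclusion of the half-edges that remain. *)
Inductive urel : lc rat udiag -> Prop :=
| RelU r of common_rel
    (Dec := udec)
    (fun m n (f : 'I_m -> 'I_n) _ l l' => forall c, l' c = map f (l c))
    oku r : urel r
| RelSTU n n' (g : graph 'I_n) (g' : graph 'I_n') (l : udec 'I_n)
    (l1 l2 : udec 'I_n') (i : 'I_n' -> 'I_n) (u w : 'I_n) (x y : 'I_n')
    (c0 : 'I_s) (p q : seq 'I_n') of
    univ g u & w = edg g u & lab g u = 1 &
    [/\ vtx g w = i y, vtx g (i y) = i x & vtx g (i x) = w] &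
    injective i & (forall h, (exists h', h = i h') <-> h <> u /\ h <> w) &
    (forall h, i (vtx g' h) = if h \in [:: x; y] then i h else vtx g (i h)) &
    (forall h, i (edg g' h) = edg g (i h)) &
    (forall h, ori g' h = ori g (i h)) & (forall h, lab g' h = lab g (i h)) &
    (forall c, c <> c0 -> l c = map i (l1 c) /\ l2 c = l1 c) &
    l c0 = map i p ++ u :: map i q &
    l1 c0 = p ++ [:: y; x] ++ q & l2 c0 = p ++ [:: x; y] ++ q &
    oku (@Diag udec _ g l) & oku (@Diag udec _ g' l1) &
    oku (@Diag udec _ g' l2) :
    urel [:: (1, @Diag udec _ g l); (-1, @Diag udec _ g' l1);
             (1, @Diag udec _ g' l2)].

(** The average of all ways of attaching the univalent vertices, obtained from
the orderings of all the univalent vertices. *)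
Definition chi1 (D : sdiag s) : lc rat udiag :=
  [seq (((nuni (dgr D))`!%:R)^-1,
        @Diag udec _ (dgr D) (fun c => [seq h <- l | scol h == c]))
    | l <- permutations (enum [pred h | univ (dgr D) h])].
Definition chi (x : gs (sdiag s)) : gs udiag := fun n => lbind (x n) chi1.

(** Chord diagrams with winding skeleton.  Each interval carries a word in the
feet [inl i] of the chords, two for each chord [i], and in the beads [inr k],
standing for [t^k].  Pushing the beads to the end of the interval by Hol_w
multiplies by [t^j] the label, oriented outward, of a foot preceded by beads of
total exponent [j]. *)
Fixpoint feet (j : int) (w : seq (nat + int)) : seq (nat * int) :=
  match w with
  | [::] => [::]
  | inl i :: w' => (i, j) :: feet j w'
  | inr k :: w' => feet (j + k) w'
  end.

Definition push_beads (w : 'I_s -> seq (nat + int)) : udiag :=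
  let L := flatten [seq [seq (c, f) | f <- feet 0 (w c)] | c <- enum 'I_s] in
  let chord (h : 'I_(size L)) := (tnth (in_tuple L) h).2.1 in
  let wind (h : 'I_(size L)) := (tnth (in_tuple L) h).2.2 in
  let mate (h : 'I_(size L)) :=
    odflt h [pick h' | (h' != h) && (chord h' == chord h)] in
  @Diag udec _
    (Graph id mate (fun h => (h < mate h)%N)
       (fun h => if (h < mate h)%N then tt_ ^ (wind h - wind (mate h))
                 else tt_ ^ (wind (mate h) - wind h)))
    (fun c => [seq h <- enum 'I_(size L) | (tnth (in_tuple L) h).1 == c]).

(** A diagram with [n] chords has [2 n] vertices. *)
Definition chords_to_u (x : gs ('I_s -> seq (nat + int))) : gs udiag :=
  fun n => if odd n then [::] else lmap push_beads (x n./2).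

End Intervals.

(** [(p, f) \in m]: a foot of a chord, or a bead, at the point [p] of the
skeleton; the marks are listed from top to bottom. *)
Definition marks (P : Type) : Type := seq (P * (nat + int)).

(** Juxtaposition renumbers the chords of the second factor. *)
Definition shift (a : nat) (f : nat + int) : nat + int :=
  match f with inl i => inl (a + i)%N | inr k => inr k end.
Definition mark_mul (P : Type) (a b : nat) (x y : marks P) : marks P :=
  x ++ [seq (p.1, shift a p.2) | p <- y].

(** Horizontal chords, from top to bottom. *)
Definition horiz_marks (P : Type) (w : seq (P * P)) : marks P :=
  flatten [seq [:: (p.2.1, inl p.1); (p.2.2, inl p.1)]
          | p <- zip (iota 0 (size w)) w].

Fixpoint bwords (n : nat) : seq (seq bool) :=
  if n is n'.+1
  then [seq false :: m | m <- bwords n'] ++ [seq true :: m | m <- bwords n']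
  else [:: [::]].

Section HorizontalSeries.
Context {P : Type}.
Implicit Types X Y : lc rat (P * P).

Definition hexpand X Y (m : seq bool) : lc rat (seq (P * P)) :=
  foldr (fun (l : bool) acc => lmul cons (if l then Y else X) acc)
        [:: (1, [::])] m.
(** The value phi(X,Y) of a noncommutative series, its first variable being
[false], and exp(a X). *)
Definition hsubst (phi : seq bool -> rat) X Y : gs (seq (P * P)) :=
  fun n => flatten [seq lscale (phi m) (hexpand X Y m) | m <- bwords n].
Definition hexp (a : rat) X : gs (seq (P * P)) :=
  fun n => lscale (a ^+ n / n`!%:R) (hexpand X X (nseq n false)).
Definition hmul : gs (seq (P * P)) -> gs (seq (P * P)) -> gs (seq (P * P)) :=
  gmul (fun _ _ => cat).
End HorizontalSeries.

Definition strands (s : nat) (x : gs (seq (nat * nat))) : gs (udiag s) :=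
  chords_to_u (fun n => lmap (fun w (c : 'I_s) =>
     [seq p.2 | p <- horiz_marks w & p.1 == nat_of_ord c]) (x n)).

Fixpoint shuffle (u : seq bool) : seq bool -> seq (seq bool) :=
  if u is a :: u' then
    fix sh (v : seq bool) : seq (seq bool) :=
      if v is c :: v'
      then [seq a :: m | m <- shuffle u' v] ++ [seq c :: m | m <- sh v']
      else [:: u]
  else fun v => [:: v].

(** Inverse of a group-like series (antipode). *)
Definition phi_inv (phi : seq bool -> rat) : seq bool -> rat :=
  fun m => (-1) ^+ size m * phi (rev m).

Definition chord (i j : nat) : lc rat (nat * nat) := [:: (1, (i, j))].

(** Rational Drinfeld associators: group-like, pentagon and hexagons. *)
Definition associator (phi : seq bool -> rat) : Prop :=
  [/\ phi [::] = 1,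
      forall u v, phi u * phi v = \sum_(m <- shuffle u v) phi m,
      geqmod (@urel 4)
        (strands 4 (hmul (hsubst phi (chord 0 2 ++ chord 1 2) (chord 2 3))
                         (hsubst phi (chord 0 1) (chord 1 2 ++ chord 1 3))))
        (strands 4 (hmul (hsubst phi (chord 0 1) (chord 1 2))
                   (hmul (hsubst phi (chord 0 1 ++ chord 0 2)
                                     (chord 1 3 ++ chord 2 3))
                         (hsubst phi (chord 1 2) (chord 2 3)))))
    & forall a : rat, a = 2^-1 \/ a = - 2^-1 ->
      geqmod (@urel 3)
        (strands 3 (hmul (hsubst phi (chord 0 1) (chord 1 2))
                   (hmul (hexp a (chord 1 2))
                   (hmul (hsubst (phi_inv phi) (chord 0 2) (chord 1 2))
                   (hmul (hexp a (chord 0 2))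
                         (hsubst phi (chord 0 2) (chord 0 1)))))))
        (strands 3 (hexp a (chord 0 2 ++ chord 1 2)))].

(** The Kontsevich integral nu of the 0-framed unknot, as a series of words in
chord feet.  Straightening the zigzag +(-+) -> (+-)+ shows that it is the
inverse of the associator closed along the zigzag, in which the middle strand
is ascending: it is read upwards, with a sign for each of its feet. *)
Definition zigzag (phi : seq bool -> rat) : gs (seq nat) :=
  fun n => [seq ((-1) ^+ n * phi_inv phi m,
                 [seq i <- iota 0 n | ~~ nth false m i] ++ rev (iota 0 n) ++
                 [seq i <- iota 0 n | nth false m i])
           | m <- bwords n].
Definition word_mul (a b : nat) (x y : seq nat) : seq nat :=
  x ++ [seq (a + i)%N | i <- y].
Definition nu (phi : seq bool -> rat) : gs (seq nat) :=
  ginv word_mul [::] (zigzag phi).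

(** Non-associative words; [true] is the letter + (descending strand). *)
Inductive nword := Emp | Lf of bool | Nd of nword & nword.
Fixpoint leaves (u : nword) : seq bool :=
  match u with
  | Emp => [::] | Lf a => [:: a] | Nd u v => leaves u ++ leaves v end.
Definition width (u : nword) : nat := size (leaves u).

(** Elementary q-tangles, read from top to bottom.  [Cross over a b]: a
crossing, the strand from top right to bottom left being the upper one when
[over]; it is positive if both strands descend.  [Disk v w]: the
vertical strands of the word (v)(w), those of [w] crossing the disk. *)
Inductive move :=
| Cross of bool & bool & bool
| Assoc of nword & nword & nword
| AssocV of nword & nword & nword
| Max of bool
| Min of bool
| Unit of bool & nword
| UnitV of bool & nword
| Disk of nword & nword.

Definition mdom (m : move) : nword :=
  match m with
  | Cross _ a b => Nd (Lf a) (Lf b)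
  | Assoc u v w => Nd (Nd u v) w
  | AssocV u v w => Nd u (Nd v w)
  | Max _ => Emp
  | Min a => Nd (Lf a) (Lf (~~ a))
  | Unit lft u => if lft then Nd Emp u else Nd u Emp
  | UnitV _ u => u
  | Disk v w => Nd v w
  end.
Definition mcod (m : move) : nword :=
  match m with
  | Cross _ a b => Nd (Lf b) (Lf a)
  | Assoc u v w => Nd u (Nd v w)
  | AssocV u v w => Nd (Nd u v) w
  | Max a => Nd (Lf a) (Lf (~~ a))
  | Min _ => Emp
  | Unit _ u => u
  | UnitV lft u => if lft then Nd Emp u else Nd u Emp
  | Disk v w => Nd v w
  end.

(** A slice is an elementary q-tangle inside a word: the path to its place
lists the sibling words, with [true] for a sibling on the right. *)
Definition slice : Type := seq (bool * nword) * move.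
Definition plug (ctx : seq (bool * nword)) (u : nword) : nword :=
  foldr (fun c x => if c.1 then Nd x c.2 else Nd c.2 x) u ctx.
Definition offset (sl : slice) : nat :=
  sumn [seq if c.1 then 0%N else width c.2 | c <- sl.1].
Definition sdom (sl : slice) : nword := plug sl.1 (mdom sl.2).
Definition scod (sl : slice) : nword := plug sl.1 (mcod sl.2).

(** Connection of the end points of the strands of a slice, [(false, i)] on top
and [(true, i)] at the bottom. *)
Definition conn (sl : slice) (e : bool * nat) : bool * nat :=
  let q := offset sl in let i := e.2 in
  match sl.2 with
  | Cross _ _ _ => (~~ e.1, if i == q then q.+1 else if i == q.+1 then q else i)
  | Max _ => if e.1 then
               if i == q then (true, q.+1) else if i == q.+1 then (true, q)
               else (false, if (i < q)%N then i else i.-2)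
             else (true, if (i < q)%N then i else i.+2)
  | Min _ => if e.1 then (false, if (i < q)%N then i else i.+2)
             else if i == q then (false, q.+1) else if i == q.+1 then (false, q)
             else (true, if (i < q)%N then i else i.-2)
  | _ => (~~ e.1, i)
  end.

(** An admissible diagram of a link in the complement of O, cut into the
q-tangles [ttop] and [tbot] with middle word (tv)(tw).  The point [(k, i)] is
the [i]-th point at the top of the [k]-th slice.  [tcomp] lists, for each
component, its points, following the orientation from the base point, which is
located just before the first of them. *)
Record tangle := Tangle {
  ttop : seq slice; tv : nword; tw : nword; tbot : seq slice;
  tcomp : seq (seq (nat * nat)) }.

Section Tangles.
Variable T : tangle.

Definition slices : seq slice := ttop T ++ ([::], Disk (tv T) (tw T)) :: tbot T.
Definition sl_ (k : nat) : slice := nth ([::], Max true) slices k.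
Definition word (k : nat) : nword :=
  if (k < size slices)%N then sdom (sl_ k) else Emp.
Definition letter (p : nat * nat) : bool := nth true (leaves (word p.1)) p.2.
Definition tnext (p : nat * nat) : nat * nat :=
  if letter p
  then let e := conn (sl_ p.1) (false, p.2) in ((p.1 + e.1)%N, e.2)
  else let e := conn (sl_ p.1.-1) (true, p.2) in ((p.1.-1 + e.1)%N, e.2).
Definition points : seq (nat * nat) :=
  flatten [seq [seq (k, i) | i <- iota 0 (width (word k))]
          | k <- iota 0 (size slices).+1].
Definition ncomp : nat := size (tcomp T).
Definition cpts (c : nat) : seq (nat * nat) := nth [::] (tcomp T) c.
Definition not_disk (sl : slice) : bool := if sl.2 is Disk _ _ then false else true.

Definition sgn (a : bool) : rat := if a then 1 else -1.

Definition ok_tangle : Prop :=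
  [/\ word 0 = Emp,
      forall k, (k < size slices)%N -> scod (sl_ k) = word k.+1,
      all not_disk (ttop T) && all not_disk (tbot T),
      all (fun c => (c != [::]) && fcycle tnext c) (tcomp T) &&
      perm_eq (flatten (tcomp T)) points
    & forall c : 'I_ncomp,
        \sum_(p <- cpts c | (p.1 == size (ttop T)) && (width (tv T) <= p.2)%N)
          sgn (letter p) = 0].

Definition linking : 'M[rat]_ncomp :=
  \matrix_(c, d) \sum_(k < size slices)
    match (sl_ k).2 with
    | Cross over a b =>
      let p := (k : nat, offset (sl_ k)) in
      let p' := (k : nat, (offset (sl_ k)).+1) in
      sgn over * sgn a * sgn b / 2 *
      (((p \in cpts c) && (p' \in cpts d))%:R +
       ((p \in cpts d) && (p' \in cpts c))%:R)
    | _ => 0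
    end.
Definition eigenvalues : seq algC :=
  sval (closed_field_poly_normal (char_poly (map_mx ratr linking))).
Definition sigma_pos : nat := count (fun z => 0 < z) eigenvalues.
Definition sigma_neg : nat := count (fun z => z < 0) eigenvalues.

Section Kontsevich.
Variable phi : seq bool -> rat.

(** Chords joining the strands of two consecutive blocks of points at level
[k], with a sign for each foot on an ascending strand (cabling). *)
Definition cable (k a m b n : nat) :
    lc rat ((nat * nat) * (nat * nat)) :=
  [seq (sgn (letter (k, i)) * sgn (letter (k, j)), ((k, i), (k, j)))
    | i <- iota a m, j <- iota b n].

(** The contribution of the [k]-th slice.  The marks of [Max] are put on its left
foot, in the order in which its orientation will read them. *)
Definition slice_val (k : nat) : gs (marks (nat * nat)) :=
  let q := offset (sl_ k) in
  let assoc f u v w : gs (marks (nat * nat)) := fun n =>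
    lmap (@horiz_marks _)
      (hsubst f (cable k q (width u) (q + width u) (width v))
                (cable k (q + width u) (width v)
                         (q + width u + width v) (width w)) n) in
  match (sl_ k).2 with
  | Cross over a b => fun n =>
      lmap (@horiz_marks _)
        (hexp (sgn over / 2)
              (lscale (sgn a * sgn b) [:: (1, ((k, q), (k, q.+1)))]) n)
  | Assoc u v w => assoc phi u v w
  | AssocV u v w => assoc (phi_inv phi) u v w
  | Max a => fun n =>
      lmap (fun w => let w' := if a then w else rev w in
                     [seq ((k.+1, q), inl i) | i <- w']) (nu phi n)
  | Disk v w =>
      gone [seq ((k, i), inr (if letter (k, i) then -1 else 1 : int))
           | i <- iota (width v) (width w)]
  | _ => gone [::]
  end.

Definition tangle_val : gs (marks (nat * nat)) :=
  foldr (fun k acc => gmul (@mark_mul _) (slice_val k) acc) (gone [::])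
        (iota 0 (size slices)).

Definition read (m : marks (nat * nat)) (c : 'I_ncomp) : seq (nat + int) :=
  flatten [seq (let l := [seq x.2 | x <- m & x.1 == p] in
                if letter p then l else rev l) | p <- cpts c].

Definition cwords : Type := 'I_ncomp -> seq (nat + int).
Definition cwords_mul (a b : nat) (x y : cwords) : cwords :=
  fun c => x c ++ map (shift a) (y c).
Definition nu_all : gs cwords :=
  foldr (fun (d : 'I_ncomp) acc =>
           gmul cwords_mul
             (fun n => lmap (fun w (c : 'I_ncomp) =>
                 if c == d then map inl w else [::]) (nu phi n)) acc)
        (gone (fun=> [::])) (enum 'I_ncomp).

(** nu # Z^bullet(L), cut at the base points. *)
Definition Zcirc : gs (udiag ncomp) :=
  chords_to_u (gmul cwords_mul nu_all (fun n => lmap read (tangle_val n))).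

(** The preimage by chi of the previous element, and its decomposition as
exp(W/2) times a group-like substantial element. *)
Record symm := Symm {
  sG : gs (sdiag ncomp);
  sW : 'M[Qt]_ncomp;
  sH : gs (sdiag ncomp);
  sG_wf : swf sG;
  sG_chi : geqmod (@urel ncomp) (chi sG) Zcirc;
  sW_herm : hermitian sW;
  sH_wf : swf sH;
  sH_subst : substantial sH;
  sH_group : grouplike sH;
  sG_dec : geqmod (@srel ncomp) sG
             (gmul (fun _ _ => @sunion ncomp) (exp_struts 2^-1 sW) sH) }.

End Kontsevich.
End Tangles.

(** The unknot with one crossing and framing +1 or -1, above the disk. *)
Definition Uknot (positive : bool) : tangle :=
  Tangle [:: ([::], Max true); ([::], Cross (~~ positive) true false);
             ([::], Min false); ([::], UnitV true Emp)]
         Emp Emp [:: ([::], Unit true Emp)]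
         [:: [:: (1, 0); (2, 1); (2, 0); (1, 1)]%N].

Section Topology.
Variable R : realType.
Notation R2 := (R * R)%type.
Notation R3 := 'rV[R]_3.

Definition p3 (x y z : R) : R3 := \row_(i < 3) nth 0 [:: x; y; z] i.

Definition Delta (n : nat) : set 'rV[R]_n.+1 :=
  [set x | (forall i, 0 <= x ord0 i) /\ \sum_i x ord0 i = 1].
Arguments Delta : clear implicits.
Definition simplex (n : nat) (X : Type) : Type := set_type (Delta n) -> X.

Definition face_row (n : nat) (i : 'I_n.+2) (x : 'rV[R]_n.+1) : 'rV[R]_n.+2 :=
  \row_j (if unlift i j is Some k then x ord0 k else 0).
Fact face_subproof n (i : 'I_n.+2) (x : set_type (Delta n)) :
  face_row i (val x) \in Delta n.+1.
Proof.
have [x_ge0 x1] : Delta n (val x) by exact: set_valP.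
apply/mem_set; split=> [j|].
  by rewrite mxE; case: unliftP => [k _|_]; [exact: x_ge0 | exact: lexx].
rewrite (bigD1_ord i) //= mxE unlift_none add0r -[RHS]x1.
by apply: eq_bigr => j _; rewrite mxE liftK.
Qed.
Definition face n (i : 'I_n.+2) (x : set_type (Delta n)) :
  set_type (Delta n.+1) := exist _ (face_row i (val x)) (face_subproof i x).

Section Chains.
Variables (k : pzRingType) (X : topologicalType).
Definition chain (n : nat) : Type := lc k (simplex n X).
Definition bd n (c : chain n.+1) : chain n :=
  flatten [seq [seq ((-1) ^+ i * p.1, p.2 \o @face n i) | i : 'I_n.+2 <- enum 'I_n.+2]
          | p : k * simplex n.+1 X <- c].
Definition chain_in n (B : set X) (c : chain n) : Prop :=
  lall (fun f : simplex n X => continuous f /\ forall x, B (f x)) c.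
Definition cycle_ n : chain n -> Prop :=
  match n with 0%N => fun=> True | n'.+1 => fun c => lceq (bd c) [::] end.
Definition zcycle n (c : chain n) : Prop := chain_in setT c /\ cycle_ c.
Definition homologous n (B : set X) (c c' : chain n) : Prop :=
  exists (e : chain n.+1) (d : chain n),
    [/\ chain_in setT e, chain_in B d & lceq c (c' ++ bd e ++ d)].
End Chains.

(** The singular 1-simplex of a path parametrized by [0,1]. *)
Definition path1 (X : Type) (c : R -> X) : simplex 1 X :=
  fun x => c ((val x) ord0 ord_max).
Definition affine n (v : 'I_n.+1 -> R3) : simplex n R3 :=
  fun x => \sum_i (val x) ord0 i *: v i.

Definition open_embedding (X Y : topologicalType) (f : X -> Y) : Prop :=
  [/\ continuous f, injective f & forall U, open U -> open (f @` U)].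

(** A positively oriented 3-simplex containing [x] in its interior. *)
Definition tetra (x : R3) : simplex 3 R3 :=
  affine (fun i : 'I_4 => x + nth 0 [:: p3 (-1) (-1) (-1); p3 1 0 0;
                                        p3 0 1 0; p3 0 0 1] i).

(** Positive charts, for the orientation given by a 3-chain [mu]. *)
Definition pos_chart (M : topologicalType) (mu : chain int M 3)
    (f : R3 -> M) : Prop :=
  open_embedding f /\
  homologous (~` [set f 0]) ([:: (1, f \o tetra 0)] : chain int M 3) mu.
Definition pos_chart3 (f : R3 -> R3) : Prop :=
  open_embedding f /\
  homologous (~` [set f 0]) ([:: (1, f \o tetra 0)] : chain int R3 3)
    [:: (1, tetra (f 0))].

(** [mu] is a fundamental cycle of the closed 3-manifold [M]. *)
Definition closed_oriented3 (M : topologicalType) (mu : chain int M 3) : Prop :=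
  [/\ hausdorff_space M, @second_countable M, compact [set: M],
      zcycle mu & forall x, exists2 f, pos_chart mu f & f 0 = x].

Definition rat_homology_sphere3 (M : topologicalType) : Prop :=
  forall n,
    if (n == 0%N) || (n == 3%N) then
      exists z : chain rat M n,
        [/\ zcycle z, ~ homologous set0 z [::] &
            forall c : chain rat M n, zcycle c ->
              exists a, homologous set0 c (lscale a z)]
    else forall c : chain rat M n, zcycle c -> homologous set0 c [::].

Section Knots.
Variables (X : topologicalType) (ch : (R3 -> X) -> Prop).

(** [f] straightens the curve [J] near [J u0]: inside the chart, [J] is the
third axis, directed upwards. *)
Definition axis_chart (f : R3 -> X) (J : R -> X) (u0 : R) : Prop :=
  [/\ ch f, f 0 = J u0,
      exists h : R -> R,
        [/\ {homo h : u v / u < v}, continuous h &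
            forall u, J (h u) = f (p3 0 0 u)]
    & forall y, range J (f y) -> exists u, y = p3 0 0 u].

(** Oriented (locally flat) knots, as curves of period 1. *)
Definition knot (J : R -> X) : Prop :=
  [/\ continuous J, forall u, J (u + 1) = J u,
      forall u v, J u = J v -> exists m : int, u - v = m%:~R
    & forall u, exists f, axis_chart f J u].

Definition disk_chain : simplex 2 R3 :=
  affine (fun i : 'I_3 => nth 0 [:: p3 1 0 0; p3 (-1) 1 0; p3 (-1) (-1) 0] i).

(** The algebraic intersection number of [S] with the knot [J] is [r]: in
H_2(X, X \ J; Q), generated by a positive transverse disk, [S] is [r] times the
generator. *)
Definition intersection (S : chain rat X 2) (J : R -> X) (r : rat) : Prop :=
  exists f u0, axis_chart f J u0 /\
    homologous (~` range J) S [:: (r, f \o disk_chain)].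
End Knots.

Definition circ (u : R) : R2 := (cos (2 * pi * u), sin (2 * pi * u)).
Definition S1 : set R2 := [set z | z.1 ^+ 2 + z.2 ^+ 2 = 1].
Definition D2 : set R2 := [set z | z.1 ^+ 2 + z.2 ^+ 2 <= 1].
Definition intD2 : set R2 := [set z | z.1 ^+ 2 + z.2 ^+ 2 < 1].

(** Embedded solid tori (S^1 x D^2), extended beyond their boundary. *)
Definition tube (X : topologicalType) (f : R2 * R2 -> X) : Prop :=
  {within S1 `*` setT, continuous f} /\ {in S1 `*` setT &, injective f}.

Record qsk_pair := QskPair {
  qM : topologicalType;
  qmu : chain int qM 3;
  qK : R -> qM;
  q_manifold : closed_oriented3 qmu;
  q_sphere : rat_homology_sphere3 qM;
  q_knot : knot (pos_chart qmu) qK;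
  q_null : homologous set0 ([:: (1, path1 qK)] : chain int qM 1) [::] }.

Definition zpow (X : Type) (f g : X -> X) (m : int) : X -> X :=
  match m with Posz n => iter n f | Negz n => iter n.+1 g end.

(** [p : Xt -> M] is the infinite cyclic covering of the exterior of [K], the
complement of the open solid torus [N (S^1 x int D^2)]; [tau] (with inverse
[taui]) is the deck transformation given by the positive meridian
[N (1, -)], of linking number 1 with [K]. *)
Definition cyclic_cover (P : qsk_pair) (N : R2 * R2 -> qM P)
    (Xt : topologicalType) (p : Xt -> qM P) (tau taui : Xt -> Xt) : Prop :=
  let ext := ~` (N @` (S1 `*` intD2)) in
  let mer u := N ((1, 0), circ u) in
  [/\ tube N,
      (N @` (S1 `*` [set (0, 0)]) = range (qK P)) /\
      (exists S : chain rat (qM P) 2,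
        [/\ chain_in setT S, lceq (bd S) [:: (1, path1 mer)] &
            intersection (pos_chart (qmu P)) S (qK P) 1]),
      [/\ continuous p, range p = ext, connected [set: Xt],
          continuous tau & continuous taui] /\
      (cancel tau taui /\ cancel taui tau),
      (forall y, p (tau y) = p y) /\
      (forall y y', p y = p y' -> exists! m, y' = zpow tau taui m y) /\
      (forall x, ext x -> exists (U : set (qM P)) (sec : qM P -> Xt),
         [/\ open U, U x, {within U `&` ext, continuous sec},
             forall x', (U `&` ext) x' -> p (sec x') = x'
           & open (sec @` (U `&` ext))])
    & forall c : R -> Xt, continuous c ->
        (forall u, p (c u) = mer u) -> c 1 = tau (c 0)].

(** Action of q / t^m. *)
Definition lp_chain (Xt : topologicalType) (tau taui : Xt -> Xt) n
    (q : {poly rat}) (m : nat) (c : chain rat Xt n) : chain rat Xt n :=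
  flatten [seq lscale q`_i
             (lmap (fun f => zpow tau taui (i%:Z - m%:Z) \o f) c)
          | i <- iota 0 (size q)].

(** [cls] identifies [A] with H_1(Xt; Q), on which [t] acts by [tau]. *)
Definition alexander_module (Xt : topologicalType) (tau taui : Xt -> Xt)
    (A : lmodType LP) (cls : chain rat Xt 1 -> A) : Prop :=
  [/\ forall a, exists2 c, zcycle c & cls c = a,
      forall c c', zcycle c -> zcycle c' ->
        (cls c = cls c' <-> homologous set0 c c'),
      forall c c', zcycle c -> zcycle c' -> cls (c ++ c') = cls c + cls c',
      forall (x : rat) c, zcycle c -> cls (lscale x c) = lqc x *: cls c
    & forall (q : LP) c, zcycle c -> lpval q = tt_ ->
        cls (lmap (fun f => tau \o f) c) = q *: cls c].

Definition annihilator (A : lmodType LP) (delta : LP) : Prop :=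
  forall q : LP, (forall a : A, q *: a = 0) <-> exists r : LP, q = r * delta.

Definition blanchfield_form (P : qsk_pair) (Xt : topologicalType)
    (p : Xt -> qM P) (tau taui : Xt -> Xt) (A : lmodType LP)
    (cls : chain rat Xt 1 -> A) (delta : LP) (b : A -> A -> Qt) : Prop :=
  let ch (f : R3 -> Xt) := open_embedding f /\ pos_chart (qmu P) (p \o f) in
  [/\ forall x x' y, b (x + x') y - (b x y + b x' y) \in laurent,
      forall x y y', b x (y + y') - (b x y + b x y') \in laurent,
      forall (a : rat) x y,
        (b (lqc a *: x) y - qc a * b x y \in laurent) /\
        (b x (lqc a *: y) - qc a * b x y \in laurent)
    & forall (J1 J2 : R -> Xt) (S : chain rat Xt 2) (q : {poly rat}) (m : nat)
        (r : int -> rat) (ks : seq int),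
        knot ch J1 -> knot ch J2 ->
        (forall k, range J1 `&` range (zpow tau taui k \o J2) = set0) ->
        lpval delta * tt_ ^+ m = tofracQ q ->
        chain_in setT S ->
        lceq (bd S) (lp_chain tau taui q m [:: (1, path1 J1)]) ->
        (forall k, intersection ch S (zpow tau taui k \o J2) (r k)) ->
        uniq ks -> (forall k, k \notin ks -> r k = 0) ->
        b (cls [:: (1, path1 J1)]) (cls [:: (1, path1 J2)])
          - (lpval delta)^-1 * \sum_(k <- ks) qc (r k) * tt_ ^ k \in laurent].

Definition blanchfield (P : qsk_pair) (A : lmodType LP) (b : A -> A -> Qt)
    (delta : LP) : Prop :=
  annihilator A delta /\
  exists (N : R2 * R2 -> qM P) (Xt : topologicalType) (p : Xt -> qM P)
         (tau taui : Xt -> Xt) (cls : chain rat Xt 1 -> A),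
    [/\ cyclic_cover N p tau taui, alexander_module tau taui cls
      & blanchfield_form p tau taui cls delta b].

(** The point [(k, i)] of the diagram is placed in the plane of the projection;
the slice containing the disk D is the one between the heights 1/2 and -1/2,
where the strands of [tv] (resp. [tw]) have negative abscissa (resp. abscissa
in ]0,1[). *)
Section Model.
Variable T : tangle.

Definition pos (p : nat * nat) : R3 :=
  let n := \sum_(k < (size (slices T)).+1) width (word T k) in
  p3 ((p.2%:R - (width (tv T))%:R + 2^-1) / n.+1%:R)
     ((size (ttop T))%:R + 2^-1 - p.1%:R) 0.
(** Displacement of the middle of the arc from [p] to [tnext T p]: local
extrema are bent, and the upper strand of a crossing is lifted. *)
Definition bump (p : nat * nat) : R3 :=
  let p' := tnext T p in
  if p'.1 == p.1 then p3 0 (if letter T p then - 2^-1 else 2^-1) 0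
  else
    let tp := if letter T p then p else p' in
    let q := offset (sl_ T tp.1) in
    match (sl_ T tp.1).2 with
    | Cross over _ _ =>
        if tp.2 == (if over then q.+1 else q) then p3 0 0 1 else 0
    | _ => 0
    end.
Definition segment (x y : R3) : set R3 :=
  [set z | exists2 u : R, 0 <= u <= 1 & z = (1 - u) *: x + u *: y].
Definition arc (p : nat * nat) : set R3 :=
  let m := 2^-1 *: (pos p + pos (tnext T p)) + bump p in
  segment (pos p) m `|` segment m (pos (tnext T p)).
Definition link_component (c : nat) : set R3 :=
  [set x | exists2 p, p \in cpts T c & arc p x].

(** The oriented unknot O, boundary of a horizontal disk, oriented so that an
upward crossing of the disk counts +1. *)
Definition unknotO (u : R) : R3 :=
  p3 (2^-1 + 2^-1 * sin (2 * pi * u)) 0 (2^-1 * cos (2 * pi * u)).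

Definition S3 : topologicalType := one_point_compactification R3.
Definition toS3 (x : R3) : S3 := Some x.

(** Surgery on the framed link turns (S^3, O) into [P]: [F c] parametrizes a
tubular neighborhood of the [c]-th component, with framing curve
[F c (-, 1)]; [e] embeds the exterior of the link in [qM P], and [V c] are the
solid tori that fill the remainder, their meridians being glued to the
framing curves. *)
Definition surgery (P : qsk_pair) : Prop :=
  exists (F : 'I_(ncomp T) -> R2 * R2 -> R3) (e : S3 -> qM P)
         (V : 'I_(ncomp T) -> R2 * R2 -> qM P),
  let solid := fun c => F c @` (S1 `*` D2) in
  let ext : set S3 :=
    [set x | forall c, ~ (toS3 @` (F c @` (S1 `*` intD2))) x] in
  [/\ (forall c,
        [/\ tube (F c),
            F c @` (S1 `*` [set (0, 0)]) = link_component c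
          & exists S : chain rat R3 2,
              [/\ chain_in setT S,
                  lceq (bd S) [:: (1, path1 (fun u => F c (circ u, (1, 0))))]
                & intersection pos_chart3 S (fun u => F c (circ u, (0, 0)))
                    (linking T c c)]]),
      (forall c c', c <> c' -> solid c `&` solid c' = set0) /\
      (forall c, solid c `&` range unknotO = set0),
      {within ext, continuous e} /\ {in ext &, injective e},
      (forall c,
        [/\ {within S1 `*` D2, continuous (V c)},
            {in S1 `*` D2 &, injective (V c)} &
            forall z w, S1 z -> S1 w -> V c (z, w) = e (toS3 (F c (w, z)))]) /\
      ([/\ forall x, (e @` ext) x \/ exists c, (V c @` (S1 `*` D2)) x,
           forall c, (e @` ext) `&` (V c @` (S1 `*` intD2)) = set0 &
           forall c c', c <> c' ->
             (V c @` (S1 `*` D2)) `&` (V c' @` (S1 `*` D2)) = set0])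
    & (forall f, pos_chart3 f -> range (toS3 \o f) `<=` ext ->
         pos_chart (qmu P) (e \o toS3 \o f)) /\
      (exists k : R -> R, [/\ continuous k, {homo k : u v / u < v},
         forall u, k (u + 1) = k u + 1 &
         forall u, e (toS3 (unknotO u)) = qK P (k u)])].

Definition surgery_presentation (P : qsk_pair) : Prop :=
  ok_tangle T /\ surgery P.

End Model.
End Topology.

(** All the choices made in the construction of the invariants of [P]: a surgery
presentation with an admissible diagram and base points, representatives for
chi^-1 (nu # Z^bullet) and their decompositions for [L] and for the two unknots
U_+ and U_-, and the identification of the Blanchfield modules (that of the
unknots is trivial). *)
Record computation (R : realType) (phi : seq bool -> rat) (P : qsk_pair R)
    (A : lmodType LP) (b : A -> A -> Qt) := Computation {
  cT : tangle;
  cL : symm cT phi;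
  cU : forall e : bool, symm (Uknot e) phi;
  cx : 'I_(ncomp cT) -> A;
  c_surg : surgery_presentation cT P;
  c_pres : presents (sW cL) b cx;
  c_presU : forall e, presents (sW (cU e))
              (fun _ _ : 'rV[LP]_0 => 0) (fun=> 0) }.

Arguments cx {R phi P A b} c.

Section Invariants.
Variables (R : realType) (phi : seq bool -> rat) (P : qsk_pair R)
  (A : lmodType LP) (b : A -> A -> Qt) (C : computation phi P b).

(** The univalent vertices coming from U_+ and U_- carry the
label 0, image of the trivial Blanchfield module. *)
Definition Ztilde : gs (cdiag A) :=
  let mul := gmul (fun _ _ => @cunion A) in
  let pow := gpow (fun _ _ => @cunion A) (cempty A) in
  let inv := ginv (fun _ _ => @cunion A) (cempty A) in
  let U e := omega (fun=> 0 : A) (sW (cU C e)) (sH (cU C e)) in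
  mul (mul (pow (inv (U true)) (sigma_pos (cT C)))
           (pow (inv (U false)) (sigma_neg (cT C))))
      (omega (cx C) (sW (cL C)) (sH (cL C))).

Definition ZKri : gs ddiag :=
  let mul := gmul (fun _ _ => dunion) in
  let pow := gpow (fun _ _ => dunion) dempty in
  let inv := ginv (fun _ _ => dunion) dempty in
  let U e := gauss (sW (cU C e)) (sH (cU C e)) in
  mul (mul (pow (inv (U true)) (sigma_pos (cT C)))
           (pow (inv (U false)) (sigma_neg (cT C))))
      (gauss (sW (cL C)) (sH (cL C))).

End Invariants.

(* Main.v *)
(** Both sides glue in pairs the univalent vertices of the same diagrams [H], the
glued edges carrying the entries of [- W^-1].  The map psi does so by a sum over
pairings.  In the Gaussian integral, [2 k] univalent vertices are paired by [k]
struts, which come with the coefficient [(-1/2)^k / k!] and the labels [W^-1]; a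
given pairing arises from [2^k k!] matchings of the ends of the struts, and the
remaining sign [(-1)^k] is absorbed by the labels.

The map psi respects the relations termwise, except for LD, where the pairings
of [v1] with [v2] account for the glued diagram.  It is multiplicative because a
pair joining two components with linking [0] makes a diagram with an edge
labeled [0].  The normalization factors then only require that disjoint union
respect the relations used so far, isomorphism, OR and LE, which only involve
the beads, i.e. the labels of the edges oriented away from a half-edge. *)

From HB Require Import structures.
Require Import Defs.
From mathcomp Require Import all_boot all_order all_algebra.
From mathcomp Require Import ring.
From mathcomp Require Import all_classical all_reals all_analysis.
Set Implicit Arguments.
Unset Strict Implicit.
Unset Printing Implicit Defensive.
Import Defs Order.TTheory GRing.Theory Num.Theory.
Local Open Scope ring_scope.

(** * The involution of Q(t) *)

(** Working with formal combinations modulo relators is awkward, so the quotient is built as an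
    actual vector space, with a universal functional [relgen]. Well-definedness of the closing map
    becomes the vanishing of a functional on relators. Products and inverses of series are instead
    compared under every functional satisfying isomorphism, OR and LE. This class is stable under
    adding a fixed component, and it contains [relgen].

    The definition of [glue] follows paths with a fuel and orients new edges arbitrarily.
    [glue_spec] reduces it to two maps, the end and the label of each path. Without struts a path
    crosses one pair at most; in the Gaussian integral it crosses a strut, hence two pairs, and has
    the same end and label.

    Denominators need care: [bar] need not preserve the fractions with denominator [delta]. The
    labels that occur are nevertheless stable, because linkings are Hermitian, whence [deltasym].
    That [delta] clears the denominators of the inverse matrix comes from the presentation: [delta]
    kills each generator, which is a relation, hence a Laurent combination of the rows of [W]. *)

Lemma tt_neq0 : tt_ != 0.
Proof. by rewrite /tt_ /tofracQ tofrac_eq0 polyX_eq0. Qed.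

Lemma tofrac_mul (p q : {poly rat}) : tofracQ p * tofracQ q = tofracQ (p * q).
Proof. by rewrite tofracQM. Qed.

Lemma tofrac_sub (p q : {poly rat}) : tofracQ p - tofracQ q = tofracQ (p - q).
Proof. by rewrite tofracQB. Qed.

Lemma tofracQ_sum (p : {poly rat}) :
  tofracQ p = \sum_(i < size p) qc p`_i * tt_ ^+ i.
Proof.
rewrite -{1}[p]coefK poly_def /tofracQ rmorph_sum; apply: eq_bigr => i _.
by rewrite -mul_polyC rmorphM rmorphXn.
Qed.

(** Evaluation at a point is a ring morphism, which gives the compatibility of the substitution with
    sums and products. *)
Lemma subst_inv_horner (p : {poly rat}) :
  subst_inv p = (map_poly (@FracField.tofrac {poly rat} \o polyC) p).[tt_^-1].
Proof.
rewrite horner_coef size_map_inj_poly ?rmorph0 //; last first.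
  by move=> x y /= /eqP; rewrite tofrac_eq => /eqP/polyC_inj.
by apply: eq_bigr => i _; rewrite coef_map exprVn.
Qed.

Lemma subst_invB p q : subst_inv (p - q) = subst_inv p - subst_inv q.
Proof. by rewrite !subst_inv_horner rmorphB hornerD hornerN. Qed.

Lemma subst_invM p q : subst_inv (p * q) = subst_inv p * subst_inv q.
Proof. by rewrite !subst_inv_horner rmorphM hornerM. Qed.

Lemma subst_invC a : subst_inv a%:P = qc a.
Proof. by rewrite subst_inv_horner map_polyC hornerC. Qed.

Lemma subst_invX : subst_inv 'X = tt_^-1.
Proof. by rewrite subst_inv_horner map_polyX hornerX. Qed.

Lemma subst_inv_rev (p : {poly rat}) :
  subst_inv p * tt_ ^+ size p
  = tofracQ (\sum_(i < size p) p`_i *: 'X^(size p - i)).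
Proof.
rewrite /subst_inv mulr_suml /tofracQ rmorph_sum; apply: eq_bigr => i _.
rewrite -mul_polyC rmorphM rmorphXn -mulrA; congr (_ * _).
by rewrite mulrC -expfB.
Qed.

(** Multiplying by a power of [t] turns p(1/t) into a polynomial with the coefficients of [p] in
    reverse order. Denominators therefore stay nonzero after substitution. *)
Lemma subst_inv_eq0 p : (subst_inv p == 0) = (p == 0).
Proof.
apply/idP/eqP => [/eqP p0|->]; last by rewrite /subst_inv size_poly0 big_ord0.
have := subst_inv_rev p; rewrite p0 mul0r => /esym/eqP; rewrite tofrac_eq0.
move=> /eqP q0; apply/polyP => i; rewrite coef0.
case: (ltnP i (size p)) => [lt_ip|le_pi]; last by rewrite nth_default.
have := congr1 (fun q : {poly rat} => q`_(size p - i)) q0.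
rewrite coef0 coef_sum (bigD1 (Ordinal lt_ip)) //= coefZ coefXn eqxx mulr1.
rewrite big1 ?addr0 // => j ne_ji; rewrite coefZ coefXn.
case: eqP => [e|]; last by rewrite mulr0.
case/negP: ne_ji; apply/eqP/val_inj => /=.
by rewrite -(subKn (ltnW lt_ip)) -(subKn (ltnW (ltn_ord j))) e.
Qed.

(** Gives access to [bar], which is defined on the representative chosen by [repr]. *)
Lemma frac_reprE (x : Qt) :
  let r : {ratio {poly rat}} := repr (x : {fraction {poly rat}}) in
  x = tofracQ (frac r).1 / tofracQ (frac r).2.
Proof.
move=> r; have d_neq0 : tofracQ (frac r).2 != 0.
  by rewrite tofrac_eq0 denom_ratioP.
apply: (mulIf d_neq0); rewrite divfK //.
rewrite -[x in LHS](reprK x) -/r /tofracQ; unlock FracField.tofrac.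
rewrite -[LHS]FracField.pi_mul /FracField.mulf; apply/eqmodP => /=.
rewrite FracField.equivfE.
rewrite !numden_Ratio ?(oner_neq0, mulr1, mulf_neq0, denom_ratioP) //.
by rewrite mulrC.
Qed.

(** Independence of the representative: the substitution is multiplicative, so it preserves the
    cross-multiplied equality of two fractions. *)
Lemma barE (p q : {poly rat}) :
  q != 0 -> bar (tofracQ p / tofracQ q) = subst_inv p / subst_inv q.
Proof.
move=> q_neq0; set x := tofracQ p / tofracQ q.
have := frac_reprE x; rewrite /bar.
move: (frac (repr (x : {fraction {poly rat}}))).1 (denom_ratioP
  (repr (x : {fraction {poly rat}}))).
move: (frac (repr (x : {fraction {poly rat}}))).2 => d n d_neq0 /eqP.
rewrite /x eqr_div ?tofrac_eq0 // !tofrac_mul tofrac_eq => /eqP pd.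
by apply/eqP; rewrite eqr_div ?subst_inv_eq0 // -!subst_invM pd mulrC.
Qed.

Lemma QtP (x : Qt) :
  exists p q : {poly rat}, q != 0 /\ x = tofracQ p / tofracQ q.
Proof. by do 2 eexists; split; last exact: frac_reprE; apply: denom_ratioP. Qed.

Lemma bar_tofrac p : bar (tofracQ p) = subst_inv p.
Proof.
have one1 : tofracQ 1 = 1 by rewrite /tofracQ rmorph1.
by rewrite -[tofracQ p]divr1 -{1}one1 barE ?oner_neq0 // subst_invC /qc one1 divr1.
Qed.

Fact bar_zmod_morphism : zmod_morphism bar.
Proof.
move=> x y; have [p [q [q0 ->]]] := QtP x; have [r [s [s0 ->]]] := QtP y.
rewrite -mulNr addf_div ?tofrac_eq0 // mulNr !tofrac_mul tofrac_sub.
rewrite !barE ?mulf_neq0 // subst_invB !subst_invM -[in RHS]mulNr.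
by rewrite addf_div ?subst_inv_eq0 // mulNr.
Qed.

Fact bar_monoid_morphism : monoid_morphism bar.
Proof.
split=> [|x y].
  by have := bar_tofrac 1; rewrite /tofracQ rmorph1 => ->;
    rewrite subst_invC /qc rmorph1.
have [p [q [q0 ->]]] := QtP x; have [r [s [s0 ->]]] := QtP y.
by rewrite mulf_div !tofrac_mul !barE ?mulf_neq0 // !subst_invM mulf_div.
Qed.

HB.instance Definition _ := GRing.isZmodMorphism.Build Qt Qt bar
  bar_zmod_morphism.
HB.instance Definition _ := GRing.isMonoidMorphism.Build Qt Qt bar
  bar_monoid_morphism.

Lemma bar_qc a : bar (qc a) = qc a.
Proof. by rewrite bar_tofrac subst_invC. Qed.

Lemma bar_tt : bar tt_ = tt_^-1.
Proof. by rewrite bar_tofrac subst_invX. Qed.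

Lemma barK : involutive bar.
Proof.
have bar_subst p : bar (subst_inv p) = tofracQ p.
  rewrite rmorph_sum tofracQ_sum; apply: eq_bigr => i _.
  by rewrite rmorphM /= fmorphV /= rmorphXn /= bar_tt exprVn invrK bar_qc.
move=> x; have [p [q [q0 ->]]] := QtP x.
by rewrite barE // fmorph_div /= !bar_subst.
Qed.

Lemma bar_laurent x : x \in laurent -> bar x \in laurent.
Proof.
have tt_laurent : tt_ \in laurent.
  by apply/laurentP; exists 'X, 0%N; rewrite expr0 mulr1.
have ttV_laurent : tt_^-1 \in laurent.
  by apply/laurentP; exists 1, 1%N; rewrite expr1 mulVf ?tt_neq0 // /tofracQ rmorph1.
case/laurentP => p [n /(congr1 bar)]; rewrite rmorphM /= rmorphXn /= bar_tt bar_tofrac.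
rewrite exprVn => xE; have -> : bar x = subst_inv p * tt_ ^+ n.
  by rewrite -xE mulfVK // expf_neq0 // tt_neq0.
rewrite rpredM ?rpredX // rpred_sum // => i _.
by rewrite rpredM ?qc_laurent // -exprVn rpredX.
Qed.

(** * Formal combinations and quotients *)

Section FormalSums.
Variables (D : Type) (V : lmodType rat).
Implicit Types (phi : D -> V) (x y : lc rat D).

Definition lsum phi x : V := \sum_(p <- x) p.1 *: phi p.2.

Lemma lsum_nil phi : lsum phi [::] = 0.
Proof. by rewrite /lsum big_nil. Qed.

Lemma lsum_cons phi a d x : lsum phi ((a, d) :: x) = a *: phi d + lsum phi x.
Proof. by rewrite /lsum big_cons. Qed.

Lemma lsum_cat phi x y : lsum phi (x ++ y) = lsum phi x + lsum phi y.
Proof. by rewrite /lsum big_cat. Qed.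

Lemma lsum_flatten phi (xs : seq (lc rat D)) :
  lsum phi (flatten xs) = \sum_(x <- xs) lsum phi x.
Proof.
by elim: xs => [|x xs ih];
  rewrite /= ?big_nil ?big_cons ?lsum_nil ?lsum_cat ?ih.
Qed.

Lemma lsum_scale phi a x : lsum phi (lscale a x) = a *: lsum phi x.
Proof.
rewrite /lsum /lscale big_map scaler_sumr.
by apply: eq_bigr => p _; rewrite scalerA.
Qed.

Lemma lall_cat (P : D -> Prop) x y : lall P x -> lall P y -> lall P (x ++ y).
Proof.
by move=> Px Py p pxy; have [/Px|/Py] := List.in_app_or _ _ _ pxy.
Qed.

Lemma lall_cons (P : D -> Prop) (p : rat * D) x :
  P p.2 -> lall P x -> lall P (p :: x).
Proof. by move=> Pp Px q /= [<-|/Px]. Qed.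

Lemma lall_flatten (P : D -> Prop) (I : eqType) (r : seq I) (F : I -> lc rat D) :
  (forall i, i \in r -> lall P (F i)) -> lall P (flatten [seq F i | i <- r]).
Proof.
elim: r => [|i r ih] hF //=; apply: lall_cat; first by apply: hF; rewrite mem_head.
by apply: ih => j jr; apply: hF; rewrite in_cons jr orbT.
Qed.

Lemma lall_scale (P : D -> Prop) a x : lall P x -> lall P (lscale a x).
Proof.
move=> Px; elim: x Px => [|p x ih] //= Px; apply: lall_cons.
  exact: (Px p (or_introl erefl)).
by apply: ih => q qx; apply: Px; right.
Qed.

Lemma eq_lsum phi psi x :
  lall (fun d => phi d = psi d) x -> lsum phi x = lsum psi x.
Proof.
elim: x => [|[a d] x ih] e; rewrite ?lsum_nil // !lsum_cons ih; last first.
  by move=> p px; apply: e; right.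
by congr (a *: _ + _); apply: (e (a, d)); left.
Qed.

Lemma lcoef_cons a d x e :
  lcoef ((a, d) :: x) e = (if `[< d = e >] then a else 0) + lcoef x e.
Proof. by rewrite /lcoef big_cons; case: ifP => //; rewrite add0r. Qed.

(** The terms whose generator is that of the head add up to a zero coefficient; erasing them leaves
    a shorter list with zero coefficients. The comparison of generators is classical, as [D] is an
    arbitrary type. *)
Lemma lsum_coef0 phi x : (forall d, lcoef x d = 0) -> lsum phi x = 0.
Proof.
have [n] := ubnP (size x); elim: n x => // n ih [|[a d] x] /=.
  by rewrite lsum_nil.
rewrite ltnS => lt_xn x0.
have split_sum : lsum phi ((a, d) :: x)
    = lcoef ((a, d) :: x) d *: phi d
      + lsum phi [seq p <- x | ~~ `[< p.2 = d >]].
  rewrite /lsum /lcoef scaler_suml big_filter (bigID (fun p => `[< p.2 = d >])) /=.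
  congr (_ + _); first by apply: eq_bigr => p /asboolP ->.
  by rewrite big_cons asboolT.
rewrite split_sum x0 scale0r add0r; apply: ih.
  by rewrite (leq_ltn_trans _ lt_xn) // size_filter count_size.
move=> e; rewrite /lcoef big_filter_cond.
have [ed|ne_ed] := pselect (e = d).
  rewrite big1 // => p /andP[/asboolPn nd /asboolP]; rewrite ed => pd.
  by case: nd.
have := x0 e; rewrite lcoef_cons asboolF ?add0r; last by move=> de; apply: ne_ed.
move=> xe; rewrite -[RHS]xe /lcoef; apply: eq_bigl => p.
apply/andP/idP => [[] //|/asboolP pe]; split; last exact/asboolP.
by apply/asboolPn => pd; apply: ne_ed; rewrite -pe.
Qed.

Lemma lcoef_cat x y d : lcoef (x ++ y) d = lcoef x d + lcoef y d.
Proof. by rewrite /lcoef big_cat. Qed.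

Lemma lcoef_scale a x d : lcoef (lscale a x) d = a * lcoef x d.
Proof. by rewrite /lcoef /lscale big_map mulr_sumr. Qed.

Lemma lcoef_flatten (xs : seq (lc rat D)) d :
  lcoef (flatten xs) d = \sum_(x <- xs) lcoef x d.
Proof.
elim: xs => [|x xs ih] /=; first by rewrite /lcoef !big_nil.
by rewrite lcoef_cat big_cons ih.
Qed.

Lemma lsum_eqmod (Rel : lc rat D -> Prop) phi x y :
  (forall r, Rel r -> lsum phi r = 0) -> eqmod Rel x y -> lsum phi x = lsum phi y.
Proof.
move=> phi0 [rs [rsP exy]]; apply/eqP; rewrite -subr_eq0; apply/eqP.
(* The difference of the two sides minus the combination of relators has zero coefficients, so every
   functional vanishes on it. *)
pose w := x ++ lscale (-1) y
  ++ lscale (-1) (flatten [seq lscale r.1 r.2 | r <- rs]).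
have : lsum phi w = 0.
  apply: lsum_coef0 => d; rewrite !lcoef_cat !lcoef_scale lcoef_flatten big_map.
  rewrite !mulN1r addrA exy; apply/eqP; rewrite subr_eq0; apply/eqP.
  by apply: eq_bigr => r _; rewrite lcoef_scale.
rewrite !lsum_cat !lsum_scale lsum_flatten big_map !scaleN1r.
suff -> : \sum_(r <- rs) lsum phi (lscale r.1 r.2) = 0 by rewrite oppr0 addr0.
elim: rs rsP {exy w} => [|r rs ih] rsP; rewrite ?big_nil // big_cons ih.
  by rewrite lsum_scale phi0 ?scaler0 ?add0r //; apply: rsP; left.
by move=> s srs; apply: rsP; right.
Qed.

End FormalSums.

Section FormalSumMaps.
Variables (D E F : Type) (V : lmodType rat).

Lemma lsum_map (phi : E -> V) (f : D -> E) x :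
  lsum phi (lmap f x) = lsum (phi \o f) x.
Proof. by rewrite /lsum big_map. Qed.

Lemma lsum_bind (phi : E -> V) (f : D -> lc rat E) x :
  lsum phi (lbind x f) = lsum (fun d => lsum phi (f d)) x.
Proof.
by rewrite lsum_flatten big_map; apply: eq_bigr => p _; rewrite lsum_scale.
Qed.

Lemma lsum_mul (phi : F -> V) (op : D -> E -> F) x y :
  lsum phi (lmul op x y) = lsum (fun d => lsum (fun e => phi (op d e)) y) x.
Proof.
rewrite lsum_flatten big_map; apply: eq_bigr => p _.
by rewrite /lsum big_map scaler_sumr; apply: eq_bigr => q _; rewrite scalerA.
Qed.

(** Lets either argument of a bilinear expression be the one to which an invariance is applied. *)
Lemma lsumC (phi : D -> E -> V) x y :
  lsum (fun d => lsum (phi d) y) x = lsum (fun e => lsum (phi ^~ e) x) y.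
Proof.
rewrite /lsum.
transitivity (\sum_(p <- x) \sum_(q <- y) (p.1 * q.1) *: phi p.2 q.2).
  by apply: eq_bigr => p _; rewrite scaler_sumr; apply: eq_bigr => q _; rewrite scalerA.
etransitivity; first exact: exchange_big.
apply: eq_bigr => q _ /=; rewrite scaler_sumr.
by apply: eq_bigr => p _; rewrite scalerA mulrC.
Qed.

Lemma lall_map (P : E -> Prop) (f : D -> E) (x : lc rat D) :
  lall (P \o f) x -> lall P (lmap f x).
Proof.
move=> Px q /List.in_map_iff[p [<- px]]; exact: (Px p px).
Qed.

Lemma lall_bind (P : E -> Prop) (f : D -> lc rat E) (x : lc rat D) :
  lall (fun d => lall P (f d)) x -> lall P (lbind x f).
Proof.
elim: x => [_ ? []|p x ih] /= Px; refine (lall_cat _ _).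
  exact (@lall_scale _ P _ _ (Px p (or_introl erefl))).
by apply: ih => q qx; apply: Px; right.
Qed.

Lemma lall_mul (P : D -> Prop) (Q : E -> Prop) (S : F -> Prop)
    (op : D -> E -> F) x y :
  (forall d e, P d -> Q e -> S (op d e)) ->
  lall P x -> lall Q y -> lall S (lmul (k := rat) op x y).
Proof.
move=> opP; elim: x => [_ _ ? []|p x ih] /= Px Qy; refine (lall_cat _ _); last first.
  by apply: ih => // q qx; apply: Px; right.
have {}Px := Px p (or_introl erefl).
elim: y Qy {ih} => [_ ? []|q y ih] /= Qy.
refine (@lall_cons _ S (p.1 * q.1, op p.2 q.2) _ _ _).
  by apply: opP => //; apply: (Qy q (or_introl erefl)).
by apply: ih => r ry; apply: Qy; right.
Qed.

End FormalSumMaps.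

(* The quotient makes equality modulo relations an equality of sums. *)
Section Quotient.
Variables (D : Type) (Rel : lc rat D -> Prop).
Implicit Types f g : D -> rat.

Definition relspan f : Prop := exists rs : seq (rat * lc rat D),
  (forall r, List.In r rs -> Rel r.2) /\
  forall d, f d = \sum_(r <- rs) r.1 * lcoef r.2 d.

Lemma relspan0 : relspan (fun=> 0).
Proof. by exists [::]; split=> // d; rewrite big_nil. Qed.

Lemma relspanD f g : relspan f -> relspan g -> relspan (fun d => f d + g d).
Proof.
move=> [rs [rsP fE]] [ss [ssP gE]]; exists (rs ++ ss); split=> [r rin|d].
  by have [/rsP|/ssP] := List.in_app_or _ _ _ rin.
by rewrite big_cat /= -fE -gE.
Qed.

Lemma relspanZ a f : relspan f -> relspan (fun d => a * f d).
Proof.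
move=> [rs [rsP fE]]; exists [seq (a * r.1, r.2) | r <- rs]; split=> [r|d].
  by case/List.in_map_iff => s [<- /rsP].
by rewrite big_map fE mulr_sumr; apply: eq_bigr => r _; rewrite mulrA.
Qed.

(** A chosen element of the coset of [f]. The choice depends on the coset as a set, so congruent
    functions get the same element; the coset contains [f], so the default is never resorted to. *)
Definition relcanon f : D -> rat :=
  xget (fun=> 0) [set g | relspan (fun d => f d - g d)]%classic.

Lemma relcanonP f : relspan (fun d => f d - relcanon f d).
Proof.
apply: (@xgetPex _ (fun=> 0) [set g | relspan (fun d => f d - g d)]%classic);
  exists f => /=.
rewrite (_ : (fun d => _) = fun=> 0); last by apply/funext => d; rewrite subrr.
exact: relspan0.
Qed.

Lemma eq_relcanon f g :
  relcanon f = relcanon g <-> relspan (fun d => f d - g d).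
Proof.
have relspanN h k : relspan (fun d => h d - k d) -> relspan (fun d => k d - h d).
  move/(relspanZ (-1)); congr relspan; apply/funext => d.
  by rewrite mulN1r opprB.
have relspanT h k l : relspan (fun d => h d - k d) ->
    relspan (fun d => k d - l d) -> relspan (fun d => h d - l d).
  move=> hk /(relspanD hk); congr relspan; apply/funext => d.
  by rewrite addrA subrK.
split=> [e|fg].
  by apply: relspanT (relcanonP f) _; rewrite e; apply/relspanN/relcanonP.
have set_eq : [set h | relspan (fun d => f d - h d)]%classic
            = [set h | relspan (fun d => g d - h d)]%classic.
  apply/seteqP; split=> h /=; first exact: relspanT (relspanN _ _ fg).
  exact: relspanT fg.
by rewrite /relcanon set_eq.
Qed.

(** One function per coset. The ambient space is that of all functions on [D], in which the
    coefficients of finite combinations are compared. *)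
Record relquot := RelQuot { relrep : D -> rat; _ : relcanon relrep = relrep }.

Lemma relcanon_idem f : relcanon (relcanon f) = relcanon f.
Proof. by apply/esym/eq_relcanon/relcanonP. Qed.

Definition relclass f : relquot := RelQuot (relcanon_idem f).

Lemma eq_relclass f g :
  relclass f = relclass g <-> relspan (fun d => f d - g d).
Proof.
rewrite -eq_relcanon; split=> [[]//|e]; rewrite /relclass.
by move: (relcanon_idem f) (relcanon_idem g); rewrite e => p q;
   rewrite (Prop_irrelevance p q).
Qed.

Lemma relclassK x : relclass (relrep x) = x.
Proof.
case: x => f e /=; rewrite /relclass; move: (relcanon_idem f); rewrite e => p.
by rewrite (Prop_irrelevance p e).
Qed.

HB.instance Definition _ := gen_eqMixin relquot.
HB.instance Definition _ := gen_choiceMixin relquot.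

Let add x y := relclass (fun d => relrep x d + relrep y d).
Let opp x := relclass (fun d => - relrep x d).
Let scale a x := relclass (fun d => a * relrep x d).

Let relrep_class f : relspan (fun d => relrep (relclass f) d - f d).
Proof. by apply/eq_relclass; rewrite relclassK. Qed.

Let addE f g : add (relclass f) (relclass g) = relclass (fun d => f d + g d).
Proof.
apply/eq_relclass; have := relspanD (relrep_class f) (relrep_class g).
by congr relspan; apply/funext => d; rewrite opprD addrACA.
Qed.

Let scaleE a f : scale a (relclass f) = relclass (fun d => a * f d).
Proof.
apply/eq_relclass; have := relspanZ a (relrep_class f).
by congr relspan; apply/funext => d; rewrite mulrBr.
Qed.

Let oppE f : opp (relclass f) = relclass (fun d => - f d).
Proof.
apply/eq_relclass; have := relspanZ (-1) (relrep_class f).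
by congr relspan; apply/funext => d; rewrite mulN1r opprB opprK addrC.
Qed.

Let addA : associative add.
Proof.
move=> x y z; rewrite -[x]relclassK -[y]relclassK -[z]relclassK !addE.
by congr relclass; apply/funext => d; rewrite addrA.
Qed.

Let addC : commutative add.
Proof. by move=> x y; congr relclass; apply/funext => d; rewrite addrC. Qed.

Let add0 : left_id (relclass (fun=> 0)) add.
Proof.
move=> x; rewrite -[x]relclassK addE.
by congr relclass; apply/funext => d; rewrite add0r.
Qed.

Let addN : left_inverse (relclass (fun=> 0)) opp add.
Proof.
move=> x; rewrite -[x]relclassK oppE addE.
by congr relclass; apply/funext => d; rewrite addNr.
Qed.

HB.instance Definition _ := GRing.isZmodule.Build relquot addA addC add0 addN.

Let addrE x y : x + y = add x y. Proof. by []. Qed.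

Let scaleA a b x : scale a (scale b x) = scale (a * b) x.
Proof.
rewrite -[x]relclassK !scaleE.
by congr relclass; apply/funext => d; rewrite mulrA.
Qed.

Let scale1 : left_id 1 scale.
Proof.
move=> x; rewrite -[x]relclassK scaleE.
by congr relclass; apply/funext => d; rewrite mul1r.
Qed.

Let scaleDr : right_distributive scale +%R.
Proof.
move=> a x y; rewrite -[x]relclassK -[y]relclassK; rewrite !addrE.
rewrite addE !scaleE addE.
by congr relclass; apply/funext => d; rewrite mulrDr.
Qed.

Let scaleDl x : {morph scale^~ x : a b / a + b}.
Proof.
move=> a b; rewrite -[x]relclassK; rewrite !addrE !scaleE addE.
by congr relclass; apply/funext => d; rewrite mulrDl.
Qed.

HB.instance Definition _ := GRing.Zmodule_isLmodule.Build rat relquot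
  scaleA scale1 scaleDr scaleDl.

Definition relgen (d : D) : relquot := relclass (lcoef [:: (1, d)]).

Lemma lsum_relgen x : lsum relgen x = relclass (lcoef x).
Proof.
elim: x => [|[a d] x ih].
  by rewrite lsum_nil; congr relclass; apply/funext => d; rewrite /lcoef big_nil.
rewrite lsum_cons ih addrE -[_ *: _]/(scale _ _) scaleE addE.
congr relclass; apply/funext => e; rewrite !lcoef_cons /lcoef big_nil addr0.
by case: ifP; rewrite ?mulr1 ?mulr0.
Qed.

Lemma lsum_relgen_eq0 x : Rel x -> lsum relgen x = 0.
Proof.
move=> Rx; rewrite lsum_relgen; apply/eq_relclass; exists [:: (1, x)].
by split=> [r [<-|[]]|d] //; rewrite big_seq1 mul1r subr0.
Qed.

(** [relgen] is the universal functional vanishing on the relators, and it detects the congruence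
    exactly. *)
Lemma eqmod_relgen x y : eqmod Rel x y <-> lsum relgen x = lsum relgen y.
Proof.
split; first exact/lsum_eqmod/lsum_relgen_eq0.
by rewrite !lsum_relgen => /eq_relclass.
Qed.

End Quotient.
Arguments relgen {D} Rel d.

(** * Relations in terms of beads *)

Lemma relgen_eq D (Rel : lc rat D -> Prop) d e :
  Rel [:: (1, d); (-1, e)] -> relgen Rel d = relgen Rel e.
Proof.
move/lsum_relgen_eq0; rewrite !lsum_cons lsum_nil scale1r scaleN1r addr0.
by move/eqP; rewrite subr_eq0 => /eqP.
Qed.

Section OkGraphs.
Variables (H : Type) (S : Qt -> Prop) (g : graph H).
Hypothesis g_ok : ok_graph S g.

Lemma ok_vtxK h : vtx g (vtx g (vtx g h)) = h.
Proof. by case: g_ok. Qed.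

Lemma ok_edgK h : edg g (edg g h) = h.
Proof. by case: g_ok => _ /(_ h)[]. Qed.

Lemma ok_edg_neq h : edg g h <> h.
Proof. by case: g_ok => _ /(_ h)[]. Qed.

Lemma ok_ori h : ori g (edg g h) = ~~ ori g h.
Proof. by case: g_ok. Qed.

Lemma ok_lab_edg h : lab g (edg g h) = lab g h.
Proof. by case: g_ok. Qed.

Lemma ok_lab h : S (lab g h).
Proof. by case: g_ok. Qed.

Lemma bead_edg h : bead g (edg g h) = bar (bead g h).
Proof. by rewrite /bead ok_ori ok_lab_edg; case: ori; rewrite //= barK. Qed.

Lemma ok_bead : (forall x, S x -> S (bar x)) -> forall h, S (bead g h).
Proof.
by move=> S_bar h; rewrite /bead; case: ori; [|apply: S_bar]; apply: ok_lab.
Qed.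

End OkGraphs.

Lemma ok_graphW H (S S' : Qt -> Prop) (g : graph H) :
  (forall x, S x -> S' x) -> ok_graph S g -> ok_graph S' g.
Proof. by move=> SS' [? ? ? ? gS]; split=> // h; apply/SS'/gS. Qed.

Section Pack.
Variables (H : finType) (g : graph H).

Lemma univ_pack i : univ (pack g) i = univ g (enum_val i).
Proof. by rewrite /univ /= (can2_eq enum_rankK enum_valK). Qed.

Lemma same_vtx_pack h i : same_vtx (pack g) (enum_rank h) i
  = same_vtx g h (enum_val i).
Proof.
rewrite /same_vtx /= !inE !enum_rankK.
by rewrite !(can2_eq enum_valK enum_rankK).
Qed.

Lemma same_edge_pack h i : same_edge (pack g) (enum_rank h) i
  = same_edge g h (enum_val i).
Proof.
rewrite /same_edge /= !inE !enum_rankK.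
by rewrite !(can2_eq enum_valK enum_rankK).
Qed.

Lemma ok_pack S : ok_graph S g -> ok_graph S (pack g).
Proof.
move=> [vK eK o l s]; split=> h /=; rewrite ?enum_rankK ?vK ?enum_valK //.
have [eh ne] := eK (enum_val h); rewrite eh enum_valK; split=> // e.
by apply: ne; rewrite -{2}e enum_rankK.
Qed.

End Pack.

Definition reorient (H : Type) (g : graph H) (o : H -> bool) : graph H :=
  Graph (vtx g) (edg g) o (fun h => if o h then bead g h else bar (bead g h)).

Lemma bead_reorient H (g : graph H) o h : bead (reorient g o) h = bead g h.
Proof. by rewrite {1}/bead /=; case: (o h); rewrite ?barK. Qed.

Section BeadRelations.
Variable delta : Qt.

(** Reversing an edge applies [bar] to its label, and [deltalab] need not be preserved. Asking for
    both conditions makes admissibility independent of the orientations. *)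
Definition deltasym (x : Qt) : Prop := deltalab delta x /\ deltalab delta (bar x).

Lemma deltasym_bar x : deltasym x -> deltasym (bar x).
Proof. by case=> ? ?; split; rewrite ?barK. Qed.

Lemma deltasymM x y : x \in laurent -> deltasym y -> deltasym (x * y).
Proof.
by move=> xl [dy dby]; split; rewrite /deltalab ?rmorphM /= -mulrA rpredM ?bar_laurent.
Qed.

Definition okb (H : finType) (g : graph H) : Prop :=
  ok_graph deltasym g /\ forall h, ~~ univ g h.

Lemma okb_okd (H : finType) (g : graph H) : okb g -> okd delta (dmk g).
Proof.
move=> [g_ok gU]; split; first by apply/ok_pack/(ok_graphW _ g_ok) => x [].
by move=> h; rewrite univ_pack.
Qed.

Lemma okb_pack (H : finType) (g : graph H) : okb g -> okb (pack g).
Proof. by case=> g_ok gU; split=> [|h]; rewrite ?univ_pack //; apply: ok_pack. Qed.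

Lemma okb_bead (H : finType) (g : graph H) h : okb g -> deltasym (bead g h).
Proof. by case=> g_ok _; apply: ok_bead g_ok deltasym_bar h. Qed.

Lemma okb_reorient (H : finType) (g : graph H) o :
  okb g -> (forall h, o (edg g h) = ~~ o h) -> okb (reorient g o).
Proof.
move=> g_okb o_edg; have [g_ok gU] := g_okb; split=> //; split=> h //=.
- exact: ok_vtxK g_ok h.
- by split; [apply: ok_edgK g_ok h | apply: ok_edg_neq g_ok h].
- by rewrite o_edg (bead_edg g_ok); case: (o h); rewrite //= barK.
- by case: (o h); [|apply: deltasym_bar]; apply: okb_bead.
Qed.

Local Notation gen := (relgen (drel delta)).

(* OR makes the orientations immaterial, hence only beads matter. *)
Lemma gen_eq_bead n (g g' : graph 'I_n) :
  vtx g =1 vtx g' -> edg g =1 edg g' -> bead g =1 bead g' -> okb g -> okb g' ->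
  gen (@Diag (fun=> unit) _ g tt) = gen (@Diag (fun=> unit) _ g' tt).
Proof.
(* Induction on the number of half-edges where the orientations differ. Reversing one such edge
   repairs both its halves, since each orientation changes along an edge. *)
have [m] := ubnP #|[pred h | ori g h != ori g' h]|.
elim: m g => // m ih g lt_m ev ee eb g_okb g'_okb.
have [g_ok gU] := g_okb; have [g'_ok _] := g'_okb.
case: (pickP [pred h | ori g h != ori g' h]) => [h /= neq_h|eq_ori]; last first.
  congr (gen (Diag _ _)); have eo h : ori g h = ori g' h.
    by apply/eqP; move: (eq_ori h) => /= /negbFE.
  have el h : lab g h = lab g' h.
    move: (eb h); rewrite /bead eo; case: ori => //.
    exact: (can_inj barK).
  by case: g g' ev ee eo el {ih lt_m eb g_okb g'_okb g_ok gU g'_ok eq_ori} =>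
    [? ? ? ?] [? ? ? ?] /= /funext-> /funext-> /funext-> /funext->.
pose o z := if same_edge g h z then ~~ ori g z else ori g z.
have same_edge_edg z : same_edge g h (edg g z) = same_edge g h z.
  rewrite /same_edge !inE orbC (can2_eq (ok_edgK g_ok) (ok_edgK g_ok)).
  by rewrite (can2_eq (ok_edgK g_ok) (ok_edgK g_ok)) (ok_edgK g_ok).
have o_edg z : o (edg g z) = ~~ o z.
  by rewrite /o same_edge_edg (ok_ori g_ok); case: ifP.
have g1_okb := okb_reorient g_okb o_edg.
transitivity (gen (@Diag (fun=> unit) _ (reorient g o) tt)).
  apply/relgen_eq/(@RelOR _ _ _ _ _ _ _ h) => //=.
  - rewrite /o /bead => z; case: (same_edge g h z); case: (ori g z) => //=.
    by rewrite barK.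
  - by have := okb_okd g_okb; case: g_okb => [[? ? ? ? l] ?] _; split=> //;
       split=> // z; case: (l z).
  - by case: g1_okb => [[? ? ? ? l] ?]; split=> //; split=> // z; case: (l z).
apply: ih => //; last by move=> z; rewrite bead_reorient.
rewrite -ltnS; apply: leq_trans lt_m; rewrite ltnS; apply: proper_card.
apply/properP; split.
  apply/fintype.subsetP => z; rewrite !inE /= /o /same_edge !inE.
  have [-> _ //|_] := eqVneq z h.
  have [->|//] := eqVneq z (edg g h); rewrite (ok_ori g_ok) => _.
  by rewrite ee (ok_ori g'_ok) (inj_eq (can_inj negbK)).
exists h; rewrite !inE //= /o /same_edge !inE eqxx /=.
by case: (ori g h) neq_h; case: (ori g' h).
Qed.

(** The orientation of [g] is carried over by [f], which makes the isomorphism relation applicable;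
    the discrepancy with the orientation of [g'] is then removed by OR. *)
Lemma gen_iso (H H' : finType) (g : graph H) (g' : graph H') (f : H -> H') :
  bijective f -> (forall h, vtx g' (f h) = f (vtx g h)) ->
  (forall h, edg g' (f h) = f (edg g h)) ->
  (forall h, bead g' (f h) = bead g h) -> okb g -> okb g' ->
  gen (dmk g) = gen (dmk g').
Proof.
move=> [f' fK f'K] ev ee eb g_okb g'_okb.
pose o h := ori g (f' h).
have o_edg h : o (edg g' h) = ~~ o h.
  by rewrite /o -{1}(f'K h) ee fK; apply: ok_ori g_okb.1 _.
have g1_okb := okb_reorient g'_okb o_edg.
transitivity (gen (dmk (reorient g' o))).
  apply/relgen_eq; apply: (@RelIso _ _ _ _ _
    (fun i => enum_rank (f (enum_val i)))) => //=.
  - exists (fun i => enum_rank (f' (enum_val i))) => i;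
      by rewrite enum_rankK ?fK ?f'K enum_valK.
  - by move=> i; rewrite !enum_rankK ev.
  - by move=> i; rewrite !enum_rankK ee.
  - by move=> i; rewrite enum_rankK /o fK.
  - by move=> i; rewrite enum_rankK /o fK eb /bead; case: ori => //; rewrite barK.
  - exact: okb_okd.
  - exact: okb_okd.
apply: gen_eq_bead => //; try exact: okb_pack.
by move=> i; rewrite -[LHS]/(bead (reorient g' o) (enum_val i)) bead_reorient.
Qed.

Section OneSet.
Variable H : finType.
Implicit Types g : graph H.

(** Gives all the diagrams of a relation the same orientation, as the constructors of [common_rel]
    demand. *)
Let gen_reorient g o : okb g -> (forall h, o (edg g h) = ~~ o h) ->
  gen (dmk g) = gen (dmk (reorient g o)).
Proof.
move=> g_okb o_edg; apply: (@gen_iso _ _ _ _ id) => //; first by exists id.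
  by move=> h; rewrite bead_reorient.
exact: okb_reorient.
Qed.

Lemma gen_LE g g1 g2 h (x y : rat) :
  vtx g1 =1 vtx g -> vtx g2 =1 vtx g -> edg g1 =1 edg g -> edg g2 =1 edg g ->
  (forall z, z <> h -> z <> edg g h -> bead g1 z = bead g z /\ bead g2 z = bead g z) ->
  bead g h = qc x * bead g1 h + qc y * bead g2 h ->
  okb g -> okb g1 -> okb g2 ->
  gen (dmk g) = x *: gen (dmk g1) + y *: gen (dmk g2).
Proof.
move=> ev1 ev2 ee1 ee2 eb ebh ok0 ok1 ok2; pose o := ori g.
have oE z : o (edg g z) = ~~ o z by apply: ok_ori ok0.1 z.
have oE1 z : o (edg g1 z) = ~~ o z by rewrite ee1.
have oE2 z : o (edg g2 z) = ~~ o z by rewrite ee2.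
rewrite (gen_reorient ok0 oE) (gen_reorient ok1 oE1) (gen_reorient ok2 oE2).
have /lsum_relgen_eq0 : drel delta [:: (1, dmk (reorient g o));
    (- x, dmk (reorient g1 o)); (- y, dmk (reorient g2 o))].
  apply: (@RelLE _ _ _ _ _ _ _ _ (enum_rank h)); do ?by apply/okb_okd/okb_reorient.
  - by move=> z /=; rewrite ev1.
  - by move=> z /=; rewrite ev2.
  - by move=> z /=; rewrite ee1.
  - by move=> z /=; rewrite ee2.
  - by [].
  - by [].
  - move=> z; rewrite same_edge_pack /same_edge !inE negb_or.
    move=> /andP[/eqP z1 /eqP z2] /=.
    by have [-> ->] := eb _ z1 z2.
  - rewrite /= enum_rankK; case: (o h); rewrite // ebh rmorphD !rmorphM /=.
    by rewrite !bar_qc.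
rewrite !lsum_cons lsum_nil scale1r !scaleNr addr0 -opprD.
by move/eqP; rewrite subr_eq0 => /eqP.
Qed.

Lemma gen_AS g g' h :
  (forall x, vtx g' x = if same_vtx g h x then vtx g (vtx g x) else vtx g x) ->
  edg g' =1 edg g -> bead g' =1 bead g -> okb g -> okb g' ->
  gen (dmk g) + gen (dmk g') = 0.
Proof.
move=> ev ee eb g_ok g'_ok; pose o := ori g.
have oE z : o (edg g z) = ~~ o z by apply: ok_ori g_ok.1 z.
have oE' z : o (edg g' z) = ~~ o z by rewrite ee.
rewrite (gen_reorient g_ok oE) (gen_reorient g'_ok oE').
have /lsum_relgen_eq0 : drel delta [:: (1, dmk (reorient g o));
    (1, dmk (reorient g' o))].
  apply: (@RelAS _ _ _ _ _ _ _ (enum_rank h)); do ?by apply/okb_okd/okb_reorient.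
  - by rewrite univ_pack enum_rankK; apply: g_ok.2.
  - by split=> z //=; rewrite ?ee ?eb.
  - move=> z /=; rewrite same_vtx_pack ev enum_rankK.
    by rewrite -[same_vtx (reorient g o) h _]/(same_vtx g h _); case: ifP.
by rewrite !lsum_cons lsum_nil !scale1r addr0.
Qed.

Definition cycle3 g (a b c : H) : Prop :=
  [/\ vtx g a = b, vtx g b = c & vtx g c = a].

Lemma gen_IHX g1 g2 g3 h h' a b c d :
  uniq [:: h; h'; a; b; c; d] -> edg g1 h = h' -> bead g1 h = 1 ->
  edg g2 =1 edg g1 -> edg g3 =1 edg g1 -> bead g2 =1 bead g1 ->
  bead g3 =1 bead g1 ->
  (forall x, x \notin [:: h; h'; a; b; c; d] ->
     vtx g2 x = vtx g1 x /\ vtx g3 x = vtx g1 x) ->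
  cycle3 g1 h a b /\ cycle3 g1 h' c d ->
  cycle3 g2 h b c /\ cycle3 g2 h' a d ->
  cycle3 g3 h c a /\ cycle3 g3 h' b d ->
  okb g1 -> okb g2 -> okb g3 ->
  gen (dmk g1) + gen (dmk g2) + gen (dmk g3) = 0.
Proof.
move=> uq hh' bh ee2 ee3 eb2 eb3 ev [c11 c12] [c21 c22] [c31 c32] ok1 ok2 ok3.
pose o := ori g1.
have oE1 z : o (edg g1 z) = ~~ o z by apply: ok_ori ok1.1 z.
have oE2 z : o (edg g2 z) = ~~ o z by rewrite ee2.
have oE3 z : o (edg g3 z) = ~~ o z by rewrite ee3.
rewrite (gen_reorient ok1 oE1) (gen_reorient ok2 oE2) (gen_reorient ok3 oE3).
have cyc_pack g x y z : cycle3 g x y z ->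
    cyc3 (pack (reorient g o)) (enum_rank x) (enum_rank y) (enum_rank z).
  by move=> [ex ey ez]; split; rewrite /= enum_rankK ?ex ?ey ?ez.
have /lsum_relgen_eq0 : drel delta [:: (1, dmk (reorient g1 o));
    (1, dmk (reorient g2 o)); (1, dmk (reorient g3 o))].
  apply: (@RelIHX _ _ _ _ _ _ _ _ (enum_rank h) (enum_rank h') (enum_rank a)
    (enum_rank b) (enum_rank c) (enum_rank d)); do ?by apply/okb_okd/okb_reorient.
  - by rewrite -(map_inj_uniq (@enum_rank_inj H)) in uq.
  - by rewrite /= enum_rankK hh'.
  - by rewrite /= enum_rankK bh rmorph1; case: ifP.
  - by split=> z //=; rewrite ?ee2 ?eb2.
  - by split=> z //=; rewrite ?ee3 ?eb3.
  - move=> z z_notin; have := ev (enum_val z).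
    have -> : enum_val z \notin [:: h; h'; a; b; c; d].
      move: z_notin; rewrite -[X in X \notin _](enum_valK z).
      by rewrite -[X in _ \notin X]/(map enum_rank [:: h; h'; a; b; c; d])
                 (mem_map (@enum_rank_inj H)).
    by move=> [] // e2 e3; split; rewrite /= ?e2 ?e3.
  - by split; apply: cyc_pack.
  - by split; apply: cyc_pack.
  - by split; apply: cyc_pack.
by rewrite !lsum_cons lsum_nil !scale1r addr0 addrA.
Qed.

(** In terms of beads, an edge gains [t] at its tail and loses it at its head, so the two factors
    cancel on a loop at the vertex. *)
Lemma gen_Hol g g' h :
  vtx g' =1 vtx g -> edg g' =1 edg g ->
  (forall z, bead g' z = bead g z * (if same_vtx g h z then tt_ else 1)
                        * (if same_vtx g h (edg g z) then tt_^-1 else 1)) ->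
  okb g -> okb g' -> gen (dmk g) = gen (dmk g').
Proof.
move=> ev ee eb g_ok g'_ok; pose o := ori g.
have oE z : o (edg g z) = ~~ o z by apply: ok_ori g_ok.1 z.
have oE' z : o (edg g' z) = ~~ o z by rewrite ee.
rewrite (gen_reorient g_ok oE) (gen_reorient g'_ok oE').
apply/relgen_eq/(@RelHol _ _ _ _ _ _ _ (enum_rank h));
  do ?by apply/okb_okd/okb_reorient.
- by rewrite univ_pack enum_rankK; apply: g_ok.2.
- by move=> z /=; rewrite ev.
- by move=> z /=; rewrite ee.
- by [].
- by move=> z /= oz; rewrite !same_vtx_pack /= oz eb enum_rankK.
Qed.

End OneSet.

(** The first clause joins isomorphism and OR, the second is LE. With both coefficients 0, LE kills
    a diagram with a zero bead; with coefficients -1 and 0 it extracts a sign. *)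
Definition bead_invariant (V : lmodType rat) (phi : ddiag -> V) : Prop :=
  (forall (H H' : finType) (g : graph H) (g' : graph H') (f : H -> H'),
     bijective f -> (forall h, vtx g' (f h) = f (vtx g h)) ->
     (forall h, edg g' (f h) = f (edg g h)) ->
     (forall h, bead g' (f h) = bead g h) -> okb g -> okb g' ->
     phi (dmk g) = phi (dmk g')) /\
  (forall (H : finType) (g g1 g2 : graph H) h (x y : rat),
     vtx g1 =1 vtx g -> vtx g2 =1 vtx g -> edg g1 =1 edg g -> edg g2 =1 edg g ->
     (forall z, z <> h -> z <> edg g h ->
        bead g1 z = bead g z /\ bead g2 z = bead g z) ->
     bead g h = qc x * bead g1 h + qc y * bead g2 h ->
     okb g -> okb g1 -> okb g2 ->
     phi (dmk g) = x *: phi (dmk g1) + y *: phi (dmk g2)).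

Lemma bead_invariant_gen : bead_invariant gen.
Proof. by split=> *; [apply: gen_iso; eassumption | apply: gen_LE; eassumption]. Qed.

End BeadRelations.

(** * Gluing *)

Lemma inj_surj_bij (T T' : Type) (k : T -> T') :
  injective k -> (forall y, exists x, k x = y) -> bijective k.
Proof.
move=> k_inj k_surj; pose k' y := projT1 (cid (k_surj y)).
have k'K y : k (k' y) = y by rewrite /k'; case: cid.
by exists k' => // x; apply: k_inj; rewrite k'K.
Qed.

Lemma sig_bij (T T' : Type) (P : pred T) (P' : pred T') (f : T -> T') :
  injective f -> (forall h, P' (f h) = P h) ->
  (forall h', P' h' -> exists h, f h = h') ->
  exists k : {h | P h} -> {h | P' h}, bijective k /\ forall x, val (k x) = f (val x).
Proof.
move=> f_inj fP f_surj.
have kP (x : {h | P h}) : P' (f (val x)) by rewrite fP; apply: valP.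
exists (fun x => exist _ (f (val x)) (kP x)); split=> //.
apply: inj_surj_bij => [x y /(congr1 val) /= /f_inj|[h' h'P]]; first exact: val_inj.
have [h e] := f_surj _ h'P; have hP : P h by rewrite -fP e.
by exists (exist _ h hP); apply: val_inj.
Qed.

Section Glue.
Variables (H : finType) (g : graph H) (pi : H -> H) (G : pred H) (F : H -> H -> Qt).

(** The glued path that leaves [h] ends at [e h] and has the label [b h]. *)
Record glue_spec (e : H -> H) (b : H -> Qt) : Prop := GlueSpec {
  gs_ok : exists S, ok_graph S g;
  gs_vtx : forall h, G h -> vtx g h = h;
  gs_path : forall h, ~~ G h -> gpath g pi G F #|H| h 1 = (e h, b h);
  gs_G : forall h, ~~ G h -> ~~ G (e h);
  gs_eK : forall h, ~~ G h -> e (e h) = h;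
  gs_neq : forall h, ~~ G h -> e h <> h;
  gs_bar : forall h, ~~ G h -> b (e h) = bar (b h);
  gs_edge : forall h, ~~ G h -> ~~ G (edg g h) -> e h = edg g h }.

Section GlueSpec.
Variables (e : H -> H) (b : H -> Qt).
Hypothesis gs : glue_spec e b.

(** A glued point is fixed by [vtx], hence alone in its orbit. *)
Lemma gs_vtx_notin h : ~~ G h -> ~~ G (vtx g h).
Proof.
have [S g_ok] := gs_ok gs.
apply: contra => Gvh; have := gs_vtx gs Gvh; have := ok_vtxK g_ok h.
by move=> + e1; rewrite !e1 => e2; rewrite -e2.
Qed.

Lemma val_vtx_glue x : val (vtx (glue g pi G F) x) = vtx g (val x).
Proof. by rewrite /= insubdK // unfold_in gs_vtx_notin // (valP x). Qed.

Lemma val_edg_glue x : val (edg (glue g pi G F) x) = e (val x).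
Proof.
have xG := valP x; rewrite /= insubdK (gs_path gs) //=.
by rewrite unfold_in (gs_G gs).
Qed.

Let o h := if G (edg g h)
  then (enum_rank h < enum_rank (gpath g pi G F #|H| h 1).1)%N else ori g h.

(** The ends of a new edge are distinct, so comparing their ranks orients it coherently; an edge
    that meets no glued point keeps its orientation. *)
Let o_edg h : ~~ G h -> o (e h) = ~~ o h.
Proof.
move=> hG; have ehG := gs_G gs hG; have [S g_ok] := gs_ok gs.
rewrite /o !(gs_path gs) //= (gs_eK gs) //.
have [hE|hE] := boolP (G (edg g h)).
  have -> : G (edg g (e h)).
    apply: contraLR hE => ehE; have := gs_edge gs ehG ehE.
    by rewrite (gs_eK gs) // => ->; rewrite (ok_edgK g_ok).
  rewrite -leqNgt [RHS]leq_eqVlt.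
  by case: eqP => // /ord_inj rank_eq; case: (gs_neq gs hG); apply: enum_rank_inj.
by rewrite (gs_edge gs hG hE) (ok_edgK g_ok) (negbTE hG) (ok_ori g_ok).
Qed.

(** [glue] stores the label read from the tail. By [gs_bar], reading it from the other end applies
    [bar], so the arbitrary orientation disappears from the bead. *)
Lemma bead_glue x : bead (glue g pi G F) x = b (val x).
Proof.
rewrite /bead /= -/(o (val x)); have xG := valP x.
rewrite !(gs_path gs) ?(gs_G gs) //=; case: (o (val x)) => //.
by rewrite (gs_bar gs) // barK.
Qed.

Lemma ok_glue (S : Qt -> Prop) :
  (forall h, ~~ G h -> S (b h)) -> ok_graph S (glue g pi G F).
Proof.
have [S' g_ok] := gs_ok gs.
have lab_glue x : lab (glue g pi G F) x = if o (val x) then b (val x)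
                                         else b (e (val x)).
  by rewrite /= -/(o (val x)) !(gs_path gs) ?(gs_G gs) ?(valP x).
move=> bS; split=> x.
- by apply: val_inj; rewrite !val_vtx_glue (ok_vtxK g_ok).
- split; first by apply: val_inj; rewrite !val_edg_glue (gs_eK gs) ?(valP x).
  by move/(congr1 val); rewrite val_edg_glue; apply: (gs_neq gs) (valP x).
- by rewrite -[LHS]/(o (val (edg _ _))) val_edg_glue o_edg // (valP x).
- rewrite !lab_glue val_edg_glue o_edg ?(valP x) // (gs_eK gs) ?(valP x) //.
  by case: (o (val x)).
- by rewrite lab_glue; case: ifP => _; apply: bS; rewrite ?(gs_G gs) ?(valP x).
Qed.

Lemma univ_glue x : univ (glue g pi G F) x = univ g (val x).
Proof. by rewrite /univ -(inj_eq val_inj) val_vtx_glue. Qed.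

Lemma okb_glue delta : (forall h, ~~ G h -> deltasym delta (b h)) ->
  (forall h, ~~ G h -> ~~ univ g h) -> okb delta (glue g pi G F).
Proof.
move=> bS gU; split; first exact: ok_glue.
by move=> x; rewrite univ_glue gU // (valP x).
Qed.

End GlueSpec.

(* End and label of a path along which at most one gluing takes place. *)
Definition gedge (h : H) : H :=
  if G (edg g h) then edg g (pi (edg g h)) else edg g h.
Definition gbead (h : H) : Qt :=
  if G (edg g h)
  then bead g h * F (edg g h) (pi (edg g h)) * bead g (pi (edg g h))
  else bead g h.

Record one_step : Prop := OneStep {
  os_ok : exists S, ok_graph S g;
  os_vtx : forall h, G h -> vtx g h = h;
  os_edg : forall h, G h -> ~~ G (edg g h);
  os_G : forall h, G h -> G (pi h);
  os_K : forall h, G h -> pi (pi h) = h;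
  os_neq : forall h, G h -> pi h <> h;
  os_bar : forall h, G h -> F (pi h) h = bar (F h (pi h)) }.

(** By [os_edg], the edge met after one gluing has its other end outside [G], so the path stops
    there. *)
Lemma glue_spec1 : one_step -> glue_spec gedge gbead.
Proof.
case=> [[S g_ok]] gv ge piG piK pi_neq Fbar; split=> //; first by exists S.
(* The fuel bounds the number of gluings along the path; here one unit is enough. *)
- move=> h hG; rewrite /gedge /gbead; have : (0 < #|H|)%N by apply/card_gt0P; exists h.
  case: #|H| => // n _ /=; case: ifP => [eG|_]; last by rewrite mul1r.
  have eG' : G (edg g (pi (edg g h))) = false by apply/negbTE/ge/piG.
  by case: n => [|n] /=; rewrite ?eG' mul1r.
- move=> h hG; rewrite /gedge; case: ifP => [eG|/negbT //]; exact/ge/piG.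
- move=> h hG; rewrite /gedge; case: (ifP (G (edg g h))) => eG; rewrite (ok_edgK g_ok).
    by rewrite piG // piK // (ok_edgK g_ok).
  by rewrite (negbTE hG).
- move=> h hG; rewrite /gedge; case: ifP => [eG|_]; last exact: ok_edg_neq g_ok h.
  by move/(congr1 (edg g)); rewrite (ok_edgK g_ok); apply: pi_neq.
- move=> h hG; rewrite /gbead /gedge; case: (ifP (G (edg g h))) => eG.
    rewrite (ok_edgK g_ok) piG // piK // Fbar // !rmorphM /= (bead_edg g_ok).
    by rewrite (bead_edg g_ok) mulrC mulrA mulrAC.
  by rewrite (ok_edgK g_ok) (negbTE hG) (bead_edg g_ok).
- by move=> h hG; rewrite /gedge => /negbTE ->.
Qed.

End Glue.

(** The map [f] has to reach the half-edges that survive, and may miss glued ones. This permits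
    comparing a gluing with one where further points are glued, such as the ends of struts. *)
Lemma glue_iso delta (V : lmodType rat) (phi : ddiag -> V)
    (H H' : finType) (g : graph H) (g' : graph H') pi pi' G G' F F' e e' b b'
    (f : H -> H') :
  bead_invariant delta phi ->
  glue_spec g pi G F e b -> glue_spec g' pi' G' F' e' b' ->
  okb delta (glue g pi G F) -> okb delta (glue g' pi' G' F') ->
  injective f -> (forall h, G' (f h) = G h) ->
  (forall h', ~~ G' h' -> exists h, f h = h') ->
  (forall h, ~~ G h -> vtx g' (f h) = f (vtx g h)) ->
  (forall h, ~~ G h -> e' (f h) = f (e h)) ->
  (forall h, ~~ G h -> b' (f h) = b h) ->
  phi (dmk (glue g pi G F)) = phi (dmk (glue g' pi' G' F')).
Proof.
move=> [phi_iso _] gs gs' ok ok' f_inj fG f_surj fv fe fb.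
have fnG h : ~~ G' (f h) = ~~ G h by rewrite fG.
have [k [k_bij kE]] := sig_bij f_inj fnG f_surj.
apply: (phi_iso _ _ _ _ k) => // x.
- by apply: val_inj; rewrite (val_vtx_glue gs') !kE (val_vtx_glue gs) fv ?(valP x).
- by apply: val_inj; rewrite (val_edg_glue gs') !kE (val_edg_glue gs) fe ?(valP x).
- by rewrite (bead_glue gs') kE (bead_glue gs) fb ?(valP x).
Qed.

(** * Gluing along a perfect pairing *)

Section Pairings.
Variable H : finType.

Definition pairing (U : pred H) (pi : {ffun H -> H}) : bool :=
  [forall h, (pi (pi h) == h) &&
     (if U h then (pi h != h) && U (pi h) else pi h == h)].

Lemma pairingP (U : pred H) (pi : {ffun H -> H}) :
  reflect (forall h, pi (pi h) = h /\
             if U h then pi h <> h /\ U (pi h) else pi h = h) (pairing U pi).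
Proof.
apply: (iffP forallP) => piP h; have := piP h.
  case/andP => /eqP piK; case: (U h) => [/andP[/eqP ? ?]|/eqP ?] //.
by case=> -> ; rewrite eqxx /=; case: (U h) => [[/eqP -> ->]|->].
Qed.

Lemma sum_pairings (V : nmodType) (U : pred H) (phi : {ffun H -> H} -> V) :
  \sum_(pi <- pairings U) phi pi = \sum_(pi | pairing U pi) phi pi.
Proof. by rewrite big_filter big_enum_cond; apply: eq_bigl => pi. Qed.

Variable delta : Qt.

(** What the closing map reads in a colored diagram: the graph and the linkings. *)
Definition gluable (g : graph H) (F : H -> H -> Qt) : Prop :=
  [/\ ok_graph (fun x => x \in laurent) g, no_strut g &
      forall v v', univ g v -> univ g v' -> v <> v' ->
        deltalab delta (F v v') /\ F v' v = bar (F v v')].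

Definition psi_sum (V : nmodType) (phi : ddiag -> V) (g : graph H)
    (F : H -> H -> Qt) : V :=
  \sum_(pi | pairing (univ g) pi) phi (dmk (glue g pi (univ g) F)).

Section Gluable.
Variables (g : graph H) (F : H -> H -> Qt) (pi : {ffun H -> H}) (G : pred H).
Hypotheses (gG : univ g =1 G) (gF : gluable g F) (piP : pairing G pi).

(** [G] is a parameter equal to [univ g] pointwise, so that the gluings of several graphs with the
    same univalent vertices live on one and the same subtype. *)
Lemma gluable_one_step : one_step g pi G F.
Proof.
have [g_ok gs FP] := gF; have piE := pairingP _ _ piP.
split; first by eexists; exact: g_ok.
- by move=> h; rewrite -gG => /eqP.
- by move=> h; rewrite -!gG; apply: gs.
- by move=> h hG; have := piE h; rewrite hG => -[_ []].
- by move=> h _; have [] := piE h.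
- by move=> h hG; have := piE h; rewrite hG => -[_ []].
- move=> h hG; have := piE h; rewrite hG => -[_ [ne piG]].
  by have [] := FP h (pi h) _ _ (nesym ne); rewrite ?gG.
Qed.

Lemma gluable_spec : glue_spec g pi G F (gedge g pi G) (gbead g pi G F).
Proof. exact/glue_spec1/gluable_one_step. Qed.

(** A glued edge crosses a single linking, so its label has a single denominator [delta]; the
    linking read backwards is its image by [bar], which is also allowed. *)
Lemma gluable_okb : delta \in laurent -> okb delta (glue g pi G F).
Proof.
move=> dl; have [g_ok gs FP] := gF; apply: (okb_glue gluable_spec) => h hG.
  have g_bead x : bead g x \in laurent by exact: (ok_bead g_ok bar_laurent x).
  rewrite /gbead; case: ifP => eG.
    have := (pairingP _ _ piP) (edg g h); rewrite eG => -[_ [ne piG]].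
    rewrite mulrC mulrA; apply: deltasymM; first by rewrite rpredM.
    have [d1 e1] := FP (edg g h) (pi (edg g h)) (etrans (gG _) eG)
                      (etrans (gG _) piG) (nesym ne).
    have [d2 _] := FP (pi (edg g h)) (edg g h) (etrans (gG _) piG)
                      (etrans (gG _) eG) ne.
    by split; rewrite // -e1.
  by split; rewrite /deltalab rpredM // bar_laurent.
by rewrite gG.
Qed.

End Gluable.
End Pairings.

(** * Compatibility of the closing map with the relations *)

Lemma glue_LE delta (V : lmodType rat) (phi : ddiag -> V) (H : finType)
    (g g1 g2 : graph H) pi pi1 pi2 G F F1 F2 e b b1 b2 h (x y : rat) :
  bead_invariant delta phi ->
  glue_spec g pi G F e b -> glue_spec g1 pi1 G F1 e b1 ->
  glue_spec g2 pi2 G F2 e b2 ->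
  vtx g1 =1 vtx g -> vtx g2 =1 vtx g ->
  okb delta (glue g pi G F) -> okb delta (glue g1 pi1 G F1) ->
  okb delta (glue g2 pi2 G F2) -> ~~ G h ->
  (forall z, ~~ G z -> z <> h -> z <> e h -> b1 z = b z /\ b2 z = b z) ->
  b h = qc x * b1 h + qc y * b2 h ->
  phi (dmk (glue g pi G F))
  = x *: phi (dmk (glue g1 pi1 G F1)) + y *: phi (dmk (glue g2 pi2 G F2)).
Proof.
move=> [_ phi_LE] gs gs1 gs2 ev1 ev2 ok ok1 ok2 hG eb ebh.
apply: (phi_LE _ _ _ _ (exist (fun z => ~~ G z) h hG)) => // [z|z|z|z|z z1 z2|].
- by apply: val_inj; rewrite (val_vtx_glue gs1) (val_vtx_glue gs).
- by apply: val_inj; rewrite (val_vtx_glue gs2) (val_vtx_glue gs).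
- by apply: val_inj; rewrite (val_edg_glue gs1) (val_edg_glue gs).
- by apply: val_inj; rewrite (val_edg_glue gs2) (val_edg_glue gs).
- rewrite (bead_glue gs) (bead_glue gs1) (bead_glue gs2).
  apply: eb; first exact: (valP z).
    by move=> e1; case: z1; apply/val_inj.
  by move=> e1; case: z2; apply/val_inj; rewrite (val_edg_glue gs).
- by rewrite (bead_glue gs) (bead_glue gs1) (bead_glue gs2).
Qed.

Section PsiSum.
Variables (delta : Qt) (V : lmodType rat) (phi : ddiag -> V).
Hypotheses (delta_laurent : delta \in laurent) (phi_inv : bead_invariant delta phi).

(** Conjugation by [f] is a bijection between the pairings, under which the glued graphs
    correspond. *)
Lemma psi_sum_iso (H H' : finType) (g : graph H) (g' : graph H') F F'
    (f : H -> H') :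
  bijective f -> (forall h, vtx g' (f h) = f (vtx g h)) ->
  (forall h, edg g' (f h) = f (edg g h)) ->
  (forall h, bead g' (f h) = bead g h) ->
  (forall v v', univ g v -> univ g v' -> v <> v' -> F' (f v) (f v') = F v v') ->
  gluable delta g F -> gluable delta g' F' ->
  psi_sum phi g F = psi_sum phi g' F'.
Proof.
move=> [f' fK f'K] ev ee eb eF gF g'F'.
have f_inj := can_inj fK.
have eU h : univ g' (f h) = univ g h by rewrite /univ ev (inj_eq f_inj).
pose tr (pi : {ffun H -> H}) := [ffun h => f (pi (f' h))].
pose tr' (pi : {ffun H' -> H'}) := [ffun h => f' (pi (f h))].
rewrite /psi_sum (reindex tr) /=; last first.
  by exists tr' => pi _; apply/ffunP => h; rewrite !ffunE ?fK ?f'K // ?fK ?f'K.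
have trE pi h : tr pi (f h) = f (pi h) by rewrite ffunE fK.
have pairing_tr pi : pairing (univ g') (tr pi) = pairing (univ g) pi.
  apply/pairingP/pairingP => piP h.
    have := piP (f h); rewrite !trE !eU => -[/f_inj piK].
    case: (univ g h) => [[ne U']|/f_inj //].
    by do 2!split=> //; move=> e; apply: ne; rewrite e.
  rewrite -(f'K h) !trE !eU; have [-> ] := piP (f' h).
  case: (univ g (f' h)) => [[ne U']|-> //].
  by do 2!split=> //; move/f_inj.
apply: eq_big => [pi|pi piP]; first by rewrite pairing_tr.
have trP : pairing (univ g') (tr pi) by rewrite pairing_tr.
apply: (glue_iso phi_inv (gluable_spec (frefl _) gF piP)
          (gluable_spec (frefl _) g'F' trP)
          (gluable_okb (frefl _) gF piP delta_laurent)
          (gluable_okb (frefl _) g'F' trP delta_laurent) f_inj eU).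
- by move=> h _; exists (f' h).
- by move=> h _; apply: ev.
- by move=> h _; rewrite /gedge !ee eU trE; case: ifP.
- move=> h _; rewrite /gbead !ee eU trE; case: ifP => // eU'; rewrite !eb.
  have [_] := pairingP _ _ piP (edg g h); rewrite eU' => -[ne U'].
  by rewrite eF //; apply: nesym.
Qed.

Lemma psi_sum_gbead (H : finType) (g g' : graph H) F F' :
  vtx g' =1 vtx g -> edg g' =1 edg g ->
  (forall pi : {ffun H -> H}, pairing (univ g) pi -> forall h, ~~ univ g h ->
     gbead g' pi (univ g) F' h = gbead g pi (univ g) F h) ->
  gluable delta g F -> gluable delta g' F' ->
  psi_sum phi g F = psi_sum phi g' F'.
Proof.
move=> ev ee eb gF g'F'.
have eU : univ g' = univ g by apply/funext => h; rewrite /univ ev.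
rewrite /psi_sum eU; apply: eq_bigr => pi piP.
apply: (glue_iso (f := id) phi_inv (gluable_spec (frefl _) gF piP)
          (gluable_spec (fun h => congr1 (@^~ h) eU) g'F' piP)
          (gluable_okb (frefl _) gF piP delta_laurent)
          (gluable_okb (fun h => congr1 (@^~ h) eU) g'F' piP delta_laurent)
          (fun _ _ => id)) => //.
- by move=> h _; exists h.
- by move=> h _; rewrite /gedge !ee.
- by move=> h hU; apply: eb.
Qed.

(** The other end of the edge whose label is combined depends on the pairing, so linearity is asked
    for one pairing at a time. *)
Lemma psi_sum_LE (H : finType) (g g1 g2 : graph H) F F1 F2 (x y : rat) :
  vtx g1 =1 vtx g -> vtx g2 =1 vtx g -> edg g1 =1 edg g -> edg g2 =1 edg g ->
  gluable delta g F -> gluable delta g1 F1 -> gluable delta g2 F2 ->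
  (forall pi : {ffun H -> H}, pairing (univ g) pi -> exists2 h, ~~ univ g h &
     gbead g pi (univ g) F h = qc x * gbead g1 pi (univ g) F1 h
                               + qc y * gbead g2 pi (univ g) F2 h /\
     forall z, ~~ univ g z -> z <> h -> z <> gedge g pi (univ g) h ->
       gbead g1 pi (univ g) F1 z = gbead g pi (univ g) F z /\
       gbead g2 pi (univ g) F2 z = gbead g pi (univ g) F z) ->
  psi_sum phi g F = x *: psi_sum phi g1 F1 + y *: psi_sum phi g2 F2.
Proof.
move=> /funext ev1 /funext ev2 /funext ee1 /funext ee2 gF gF1 gF2 hP.
have eU1 : univ g1 = univ g by rewrite /univ ev1.
have eU2 : univ g2 = univ g by rewrite /univ ev2.
have eU1' h : univ g1 h = univ g h by rewrite eU1.
have eU2' h : univ g2 h = univ g h by rewrite eU2.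
rewrite /psi_sum eU1 eU2 !scaler_sumr -big_split /=; apply: eq_bigr => pi piP.
have [h hU [eh ez]] := hP _ piP.
have ee1' : gedge g1 pi (univ g) = gedge g pi (univ g) by rewrite /gedge ee1.
have ee2' : gedge g2 pi (univ g) = gedge g pi (univ g) by rewrite /gedge ee2.
have gs1 := gluable_spec eU1' gF1 piP; rewrite ee1' in gs1.
have gs2 := gluable_spec eU2' gF2 piP; rewrite ee2' in gs2.
apply: (glue_LE phi_inv (gluable_spec (frefl _) gF piP) gs1 gs2 _ _
  (gluable_okb (frefl _) gF piP delta_laurent)
  (gluable_okb eU1' gF1 piP delta_laurent)
  (gluable_okb eU2' gF2 piP delta_laurent) hU) => // z; by rewrite ?ev1 ?ev2.
Qed.

End PsiSum.

Lemma same_vtx_glue (H : finType) (g : graph H) pi G F e b x y :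
  glue_spec g pi G F e b ->
  same_vtx (glue g pi G F) x y = same_vtx g (val x) (val y).
Proof.
move=> gs; rewrite /same_vtx !inE -!(inj_eq val_inj) !(val_vtx_glue gs).
by [].
Qed.

(** * Relation LD: closing one pair of vertices *)

Section ClosingPair.
Variables (delta : Qt) (V : lmodType rat) (phi : ddiag -> V).
Hypotheses (delta_laurent : delta \in laurent) (phi_inv : bead_invariant delta phi).
Variables (H : finType) (g : graph H) (F : H -> H -> Qt) (v1 v2 : H) (P : Qt).
Hypotheses (gF : gluable delta g F) (v1U : univ g v1) (v2U : univ g v2).
Hypotheses (v12 : v1 <> v2) (P_laurent : P \in laurent).

(* The linkings of the diagram glued along [v1] and [v2] in relation LD, seen
as linkings of [g] for the pairings that exchange [v1] and [v2]. *)
Definition pair_lnk (u u' : H) : Qt :=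
  if (u == v1) && (u' == v2) then P
  else if (u == v2) && (u' == v1) then bar P else F u u'.

Local Notation swap := (fun u => if u == v1 then v2 else if u == v2 then v1 else u).
Local Notation v12s := (fun u => u \in [:: v1; v2]).

Definition close_pair : graph {h : H | ~~ v12s h} :=
  glue g swap v12s (fun u _ => if u == v1 then P else bar P).

Lemma gluable_pair_lnk : gluable delta g pair_lnk.
Proof.
case: gF => g_ok gs FP; split=> // v v' vU v'U vv'.
have lab_l x : x \in laurent -> deltalab delta x by move=> xl; rewrite /deltalab rpredM.
move: (FP v v' vU v'U vv'); rewrite /pair_lnk.
have v21 : (v2 == v1) = false by apply/eqP => /esym.
have v12' : (v1 == v2) = false by apply/eqP.
have [-> | n1] := eqVneq v v1.
  have [-> | n2] := eqVneq v' v2; rewrite ?v21 ?v12' ?eqxx ?andbF //=.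
  by move=> _; split=> //; apply: lab_l.
have [-> | n2] := eqVneq v v2; last by rewrite /= !andbF.
have [_ | n1'] := eqVneq v' v1; rewrite ?v21 ?v12' ?eqxx ?andbF ?barK //=.
by move=> _; split=> //; apply/lab_l/bar_laurent.
Qed.

Let G_univ h : v12s h -> univ g h.
Proof. by rewrite /= !inE => /orP[] /eqP ->. Qed.

Let gs : no_strut g. Proof. by case: gF. Qed.

Let close_one_step : one_step g swap v12s (fun u _ => if u == v1 then P else bar P).
Proof.
have [g_ok _ _] := gF; have v21 : (v2 == v1) = false by apply/eqP => /esym.
split; first by eexists; exact: g_ok.
- by move=> h /G_univ/eqP.
- by move=> h /G_univ/gs; apply: contra => /G_univ.
- by move=> h; rewrite /= !inE => /orP[] /eqP ->; rewrite ?eqxx ?v21 ?orbT // eqxx.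
- by move=> h; rewrite /= !inE => /orP[] /eqP ->; rewrite ?v21 ?eqxx ?v21 ?eqxx.
- by move=> h; rewrite /= !inE => /orP[] /eqP ->; rewrite ?v21 ?eqxx // => /esym.
- by move=> h; rewrite /= !inE => /orP[] /eqP ->; rewrite ?v21 ?eqxx ?v21 ?eqxx ?barK.
Qed.

Let close_spec := glue_spec1 close_one_step.

Lemma gluable_close_pair :
  gluable delta close_pair (fun x y => F (val x) (val y)).
Proof.
have [g_ok _ FP] := gF.
have bl h : bead g h \in laurent by apply: (ok_bead g_ok bar_laurent).
split.
- apply: (ok_glue close_spec) => h hG; rewrite /gbead; case: ifP => // _.
  by rewrite rpredM // rpredM //; case: ifP => _ //; apply: bar_laurent.
- move=> x; rewrite !(univ_glue close_spec) (val_edg_glue close_spec) /gedge.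
  move=> xU; have nU := gs xU; case: ifP => // /G_univ.
  by rewrite (negbTE nU).
- move=> x y; rewrite !(univ_glue close_spec) => xU yU xy; apply: FP => //.
  by move/val_inj.
Qed.

Local Notation K := {h : H | ~~ v12s h}.
(** [ext] and [res] identify the pairings of the closed graph with those of [g] that exchange [v1]
    and [v2]. *)
Let ext (p : {ffun K -> K}) : {ffun H -> H} :=
  [ffun h => if insub h is Some x then val (p x) else swap h].
Let res (pi : {ffun H -> H}) : {ffun K -> K} :=
  [ffun x => insubd x (pi (val x))].

Let ext_val p x : ext p (val x) = val (p x).
Proof. by rewrite ffunE valK. Qed.

Let ext_v p h : v12s h -> ext p h = swap h.
Proof. by move=> hG; rewrite ffunE insubF // hG. Qed.

Let swapK h : v12s h -> swap (swap h) = h /\ v12s (swap h) /\ swap h <> h.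
Proof.
move=> hG; split; first exact: (os_K close_one_step hG).
by split; [apply: (os_G close_one_step hG) | apply: (os_neq close_one_step hG)].
Qed.

Let extP p : pairing (univ g) (ext p) = pairing (univ close_pair) p.
Proof.
apply/pairingP/pairingP => pP.
  move=> x; have := pP (val x); rewrite !ext_val !(univ_glue close_spec).
  case=> /val_inj -> h; split=> //; move: h; case: (univ g _) => [[ne U']|/val_inj //].
  by split=> // e; apply: ne; rewrite e.
move=> h; have [hG|hG] := boolP (v12s h).
  have [sK [sG sn]] := swapK hG.
  by rewrite !ext_v // (G_univ hG); split=> //; split=> //; apply: G_univ.
pose x : K := exist (fun h => ~~ v12s h) h hG.
have [] := pP x; rewrite -[h]/(val x) !ext_val !(univ_glue close_spec) => -> hx.
split=> //; move: hx; case: (univ g _) => [[ne U']|-> //].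
by split=> // /val_inj.
Qed.

Let resK pi : pairing (univ g) pi -> pi v1 = v2 -> ext (res pi) = pi.
Proof.
move=> /pairingP piP pi12; have pi21 : pi v2 = v1 by rewrite -pi12; case: (piP v1).
have v21 : (v2 == v1) = false by apply/eqP => /esym.
apply/ffunP => h; have [hG|hG] := boolP (v12s h).
  rewrite ext_v //; move: hG; rewrite /= !inE => /orP[] /eqP ->; first by rewrite eqxx.
  by rewrite v21 eqxx.
rewrite -[h]/(val (exist (fun h => ~~ v12s h) h hG : K)) ext_val ffunE insubdK //.
rewrite unfold_in /=; apply: contra hG; rewrite /= !inE => /orP[] /eqP e.
  by have [] := piP h; rewrite e pi12 => <-; rewrite eqxx orbT.
by have [] := piP h; rewrite e pi21 => <-; rewrite eqxx.
Qed.

Let close_edge x : v12s (edg g (val x)) ->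
  val (edg close_pair x) = edg g (swap (edg g (val x))).
Proof. by move=> eG; rewrite (val_edg_glue close_spec) /gedge eG. Qed.

Let close_edge0 x : ~~ v12s (edg g (val x)) ->
  val (edg close_pair x) = edg g (val x).
Proof. by move=> eG; rewrite (val_edg_glue close_spec) /gedge (negbTE eG). Qed.

Let close_bead0 x : ~~ v12s (edg g (val x)) -> bead close_pair x = bead g (val x).
Proof. by move=> eG; rewrite (bead_glue close_spec) /gbead (negbTE eG). Qed.

Let close_univ (x : K) : univ close_pair x = univ g (val x).
Proof. exact: univ_glue close_spec x. Qed.

Let close_pairing p y : pairing (univ close_pair) p -> univ g (val y) ->
  univ g (val (p y)) /\ ~~ v12s (edg g (val (p y))).
Proof.
move=> /pairingP/(_ y)[_]; rewrite !close_univ => + yU; rewrite yU => -[_ pU].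
by split=> //; apply: contra (gs pU); apply: G_univ.
Qed.

(** Gluing [v1] to [v2] before the other pairs, or all the pairs at once, yields the same graph: the
    edge created by the first gluing has no univalent end, as there is no strut. *)
Lemma psi_sum_close_pair :
  \sum_(pi : {ffun H -> H} | pairing (univ g) pi && (pi v1 == v2))
     phi (dmk (glue g pi (univ g) pair_lnk))
  = psi_sum phi close_pair (fun x y => F (val x) (val y)).
Proof.
rewrite (reindex_onto ext res) /=; last by move=> pi /andP[piP /eqP]; apply: resK.
have v1G : v12s v1 by rewrite /= mem_head.
have v2G : v12s v2 by rewrite /= !inE eqxx orbT.
have v21 : (v2 == v1) = false by apply/eqP => /esym.
apply: eq_big => [p|p].
  rewrite extP ext_v // eqxx eqxx andbT.
  suff -> : res (ext p) = p by rewrite eqxx andbT.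
  by apply/ffunP => x; rewrite ffunE ext_val valKd.
rewrite extP ext_v // eqxx => /andP[/andP[pP _] _].
have epP : pairing (univ g) (ext p) by rewrite extP.
apply/esym; apply: (glue_iso (f := val) phi_inv
  (gluable_spec (frefl _) gluable_close_pair pP)
  (gluable_spec (frefl _) gluable_pair_lnk epP)
  (gluable_okb (frefl _) gluable_close_pair pP delta_laurent)
  (gluable_okb (frefl _) gluable_pair_lnk epP delta_laurent) val_inj).
- by move=> x; rewrite (univ_glue close_spec).
- move=> h hU; have hG : ~~ v12s h by apply: contra hU; apply: G_univ.
  by exists (exist (fun h => ~~ v12s h) h hG).
- by move=> x _; rewrite (val_vtx_glue close_spec).
- move=> x _; have [eG|eG] := boolP (v12s (edg g (val x))).
    (* The path meets [v1] or [v2] first and ends right after the passage to the other one. *)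
    have [_ [sG _]] := swapK eG; have nU := negbTE (gs (G_univ sG)).
    by rewrite /gedge close_univ close_edge // nU (G_univ eG) ext_v // close_edge.
  have yE := close_edge0 eG; rewrite /gedge close_univ yE.
  case: ifP => [eU|]; last by rewrite yE.
  rewrite -yE in eU *; have [_ pG] := close_pairing pP eU.
  by rewrite ext_val close_edge0.
- move=> x _; have [eG|eG] := boolP (v12s (edg g (val x))).
    have [_ [sG _]] := swapK eG; have nU := negbTE (gs (G_univ sG)).
    rewrite /gbead close_univ close_edge // nU (G_univ eG) ext_v //.
    rewrite (bead_glue close_spec) /gbead eG; congr (_ * _ * _); rewrite /pair_lnk.
    by move: eG; rewrite /= !inE => /orP[] /eqP ->; rewrite ?v21 ?eqxx.
  have yE := close_edge0 eG; rewrite /gbead close_univ yE close_bead0 //.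
  case: ifP => [eU|//]; have yG := eG.
  rewrite -yE in eU yG *; have [_ pG] := close_pairing pP eU.
  rewrite ext_val close_bead0 //; congr (_ * _ * _); rewrite /pair_lnk.
  move: yG; rewrite /= !inE negb_or => /andP[/negbTE -> /negbTE ->].
  by [].
Qed.

Lemma psi_sum_LD F' :
  gluable delta g F' -> F v1 v2 = F' v1 v2 + P ->
  (forall u u', ~ (u = v1 /\ u' = v2) -> ~ (u = v2 /\ u' = v1) -> F u u' = F' u u') ->
  psi_sum phi g F = psi_sum phi g F'
                    + psi_sum phi close_pair (fun x y => F (val x) (val y)).
Proof.
move=> gF' FE FF'; rewrite -psi_sum_close_pair big_mkcondr /= -big_split /=.
have gF1 := gluable_pair_lnk; have v1U' := gs v1U.
apply: eq_bigr => pi piP; have piE := pairingP _ _ piP.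
case: eqP => [pi12|npi12].
  (* When [v1] and [v2] are paired, the linking is the sum of that of [F'] and of [P], and LE
     applies with coefficients 1. *)
  have -> : forall D E : V, D + E = 1 *: D + 1 *: E by move=> *; rewrite !scale1r.
  apply: (glue_LE (h := edg g v1) phi_inv
    (gluable_spec (frefl _) gF piP) (gluable_spec (frefl _) gF' piP)
    (gluable_spec (frefl _) gF1 piP) (frefl _) (frefl _)
    (gluable_okb (frefl _) gF piP delta_laurent)
    (gluable_okb (frefl _) gF' piP delta_laurent)
    (gluable_okb (frefl _) gF1 piP delta_laurent) v1U') => [z zU z1 z2|].
    have [g_ok _ _] := gF.
    have n1 : edg g z <> v1 by move=> e; apply: z1; rewrite -e (ok_edgK g_ok).
    have n2 : edg g z <> v2.
      move=> e; apply: z2; rewrite /gedge (ok_edgK g_ok) v1U pi12 -e.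
      by rewrite (ok_edgK g_ok).
    have Fz : F (edg g z) (pi (edg g z)) = F' (edg g z) (pi (edg g z)).
      by apply: FF' => -[].
    rewrite /gbead /pair_lnk; move/eqP/negbTE: n1 => ->; move/eqP/negbTE: n2 => -> /=.
    by rewrite Fz.
  have [g_ok _ _] := gF.
  rewrite /gbead (ok_edgK g_ok) v1U pi12 FE /pair_lnk !eqxx /= /qc /tofracQ.
  by rewrite !rmorph1 !mul1r mulrDr mulrDl.
rewrite addr0.
(* For any other pairing, the linkings where [F] and [F'] may differ are not crossed. *)
apply: (glue_iso (f := id) phi_inv
  (gluable_spec (frefl _) gF piP) (gluable_spec (frefl _) gF' piP)
  (gluable_okb (frefl _) gF piP delta_laurent)
  (gluable_okb (frefl _) gF' piP delta_laurent) (fun _ _ => id)) => //.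
  by move=> h _; exists h.
move=> h hU; rewrite /gbead; case: ifP => // eU; rewrite FF' //.
  by case=> e1 e2; apply: npi12; rewrite -e2 -e1.
by case=> e1 e2; apply: npi12; rewrite -e2 -e1; case: (piE (edg g h)).
Qed.

End ClosingPair.

Lemma eq_bead H H' (g : graph H) (g' : graph H') h h' :
  ori g' h' = ori g h -> lab g' h' = lab g h -> bead g' h' = bead g h.
Proof. by rewrite /bead => -> ->. Qed.

(** [vtx] is injective, so it has no fixed point in an orbit where one element is moved. *)
Lemma same_vtx_nuniv (H : finType) S (g : graph H) h u :
  ok_graph S g -> ~~ univ g h -> same_vtx g h u -> ~~ univ g u.
Proof.
move=> g_ok hU; rewrite /same_vtx !inE /univ.
have vI := can_inj (fun x => ok_vtxK g_ok x : (vtx g \o vtx g) (vtx g x) = x).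
by case/or3P => /eqP ->; rewrite ?(inj_eq vI).
Qed.

(** * Relations AS, IHX, LE and Hol *)

Section PsiRelations.
Variable delta : Qt.
Hypothesis delta_laurent : delta \in laurent.
Local Notation gen := (relgen (drel delta)).

Let gen_inv := bead_invariant_gen delta.

Lemma psi_AS n (g g' : graph 'I_n) F h :
  ~~ univ g h -> edg g' =1 edg g -> bead g' =1 bead g ->
  (forall x, vtx g' x = if same_vtx g h x then vtx g (vtx g x) else vtx g x) ->
  gluable delta g F -> gluable delta g' F ->
  psi_sum gen g F + psi_sum gen g' F = 0.
Proof.
move=> hU /funext ee eb ev gF g'F; have [g_ok _ _] := gF.
have eU : univ g' = univ g.
  (* [vtx] has order dividing 3, so [vtx] and its square have the same fixed points. *)
  apply/funext => x; rewrite /univ ev; case: ifP => // _.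
  by apply/eqP/eqP => [e|e]; [rewrite -{2}(ok_vtxK g_ok x) e|rewrite !e].
have eU' x : univ g' x = univ g x by rewrite eU.
rewrite /psi_sum eU -big_split /= big1 // => pi piP.
have gs := gluable_spec (frefl _) gF piP; have gs' := gluable_spec eU' g'F piP.
apply: (@gen_AS _ _ _ _ (exist (fun h => ~~ univ g h) h hU)).
- move=> x; apply: val_inj; rewrite (same_vtx_glue _ _ gs) (val_vtx_glue gs') ev /=.
  by case: ifP => _; rewrite !(val_vtx_glue gs).
- by move=> x; apply: val_inj; rewrite (val_edg_glue gs') (val_edg_glue gs) /gedge ee.
- by move=> x; rewrite (bead_glue gs') (bead_glue gs) /gbead ee !eb.
- exact: gluable_okb gF piP delta_laurent.
- exact: gluable_okb eU' g'F piP delta_laurent.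
Qed.

Lemma psi_IHX n (g1 g2 g3 : graph 'I_n) F h h' u v w z :
  uniq [:: h; h'; u; v; w; z] -> edg g1 h = h' -> lab g1 h = 1 ->
  edg g2 =1 edg g1 -> edg g3 =1 edg g1 -> bead g2 =1 bead g1 ->
  bead g3 =1 bead g1 ->
  (forall x, x \notin [:: h; h'; u; v; w; z] ->
     vtx g2 x = vtx g1 x /\ vtx g3 x = vtx g1 x) ->
  cyc3 g1 h u v /\ cyc3 g1 h' w z -> cyc3 g2 h v w /\ cyc3 g2 h' u z ->
  cyc3 g3 h w u /\ cyc3 g3 h' v z ->
  gluable delta g1 F -> gluable delta g2 F -> gluable delta g3 F ->
  psi_sum gen g1 F + psi_sum gen g2 F + psi_sum gen g3 F = 0.
Proof.
move=> uq hh' lh /funext ee2 /funext ee3 /funext eb2 /funext eb3 ev.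
move=> c1 c2 c3 gF1 gF2 gF3.
pose s := [:: h; h'; u; v; w; z].
(* The six half-edges around the inner edge lie at trivalent vertices, hence survive every
   gluing. *)
have nuniv3 (g : graph 'I_n) (x y t : 'I_n) : cyc3 g x y t -> uniq [:: x; y; t] ->
    [/\ ~~ univ g x, ~~ univ g y & ~~ univ g t].
  move=> [e1 e2 e3] /=; rewrite !inE negb_or !andbT /univ e1 e2 e3.
  move=> /andP[/andP[n1 n2] n3].
  by rewrite eq_sym n1 eq_sym n3 eq_sym eq_sym n2.
have nuniv6 (g : graph 'I_n) (x1 x2 x3 x4 x5 x6 : 'I_n) :
    cyc3 g x1 x2 x3 /\ cyc3 g x4 x5 x6 ->
    perm_eq [:: x1; x2; x3; x4; x5; x6] s -> forall x, x \in s -> ~~ univ g x.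
  move=> [d1 d2] ps x; rewrite -(perm_mem ps); move: uq; rewrite -/s -(perm_uniq ps).
  rewrite -[[:: x1; x2; x3; x4; x5; x6]]/([:: x1; x2; x3] ++ [:: x4; x5; x6]).
  rewrite cat_uniq mem_cat => /and3P[uq1 _ uq2].
  have [? ? ?] := nuniv3 _ _ _ _ d1 uq1; have [? ? ?] := nuniv3 _ _ _ _ d2 uq2.
  by rewrite !inE => /orP[] /or3P[] /eqP ->.
have nU1 : forall x, x \in s -> ~~ univ g1 x.
  (* Two lists are permutations of each other when every predicate has the same count on both; on
     explicit lists this is an identity of sums. *)
  by apply: nuniv6 c1 _; apply/permP => a /=; ring.
have nU2 : forall x, x \in s -> ~~ univ g2 x.
  by apply: nuniv6 c2 _; apply/permP => a /=; ring.
have nU3 : forall x, x \in s -> ~~ univ g3 x.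
  by apply: nuniv6 c3 _; apply/permP => a /=; ring.
have eU2 : univ g2 = univ g1.
  apply/funext => x; have [xs|xs] := boolP (x \in s).
    by rewrite (negbTE (nU1 _ xs)) (negbTE (nU2 _ xs)).
  by rewrite /univ; have [-> _] := ev _ xs.
have eU3 : univ g3 = univ g1.
  apply/funext => x; have [xs|xs] := boolP (x \in s).
    by rewrite (negbTE (nU1 _ xs)) (negbTE (nU3 _ xs)).
  by rewrite /univ; have [_ ->] := ev _ xs.
have eU2' x : univ g2 x = univ g1 x by rewrite eU2.
have eU3' x : univ g3 x = univ g1 x by rewrite eU3.
rewrite /psi_sum eU2 eU3 -!big_split /= big1 // => pi piP.
have gs1 := gluable_spec (frefl _) gF1 piP.
have gs2 := gluable_spec eU2' gF2 piP; have gs3 := gluable_spec eU3' gF3 piP.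
have [hU [h'U [uU [vU [wU zU]]]]] : ~~ univ g1 h /\ ~~ univ g1 h' /\ ~~ univ g1 u /\
    ~~ univ g1 v /\ ~~ univ g1 w /\ ~~ univ g1 z.
  by do ![split]; apply: nU1; rewrite !inE eqxx ?orbT.
pose i x (xU : ~~ univ g1 x) : {h | ~~ univ g1 h} := exist _ x xU.
have cyc g F0 e0 b0 x y t (xU : ~~ univ g1 x) (yU : ~~ univ g1 y) (tU : ~~ univ g1 t) :
    glue_spec g pi (univ g1) F0 e0 b0 -> cyc3 g x y t ->
    cycle3 (glue g pi (univ g1) F0) (i x xU) (i y yU) (i t tU).
  by move=> gs [e1 e2 e3]; split; apply: val_inj; rewrite (val_vtx_glue gs).
have edgh : edg (glue g1 pi (univ g1) F) (i h hU) = i h' h'U.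
  by apply: val_inj; rewrite (val_edg_glue gs1) /gedge /= hh' (negbTE h'U).
apply: (gen_IHX (h := i h hU) (h' := i h' h'U) (a := i u uU) (b := i v vU)
                (c := i w wU) (d := i z zU)) => //.
- rewrite (bead_glue gs1) /gbead /= hh' (negbTE h'U) /bead lh rmorph1.
  by case: ori.
- by move=> x; apply: val_inj; rewrite (val_edg_glue gs1) (val_edg_glue gs2) /gedge ee2.
- by move=> x; apply: val_inj; rewrite (val_edg_glue gs1) (val_edg_glue gs3) /gedge ee3.
- by move=> x; rewrite (bead_glue gs1) (bead_glue gs2) /gbead ee2 eb2.
- by move=> x; rewrite (bead_glue gs1) (bead_glue gs3) /gbead ee3 eb3.
- move=> x; rewrite -(mem_map val_inj) /= => /ev[e2 e3].
  by split; apply: val_inj; rewrite (val_vtx_glue gs1);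
     rewrite ?(val_vtx_glue gs2) ?(val_vtx_glue gs3).
- by split; [apply: cyc gs1 c1.1 | apply: cyc gs1 c1.2].
- by split; [apply: cyc gs2 c2.1 | apply: cyc gs2 c2.2].
- by split; [apply: cyc gs3 c3.1 | apply: cyc gs3 c3.2].
- exact: gluable_okb gF1 piP delta_laurent.
- exact: gluable_okb eU2' gF2 piP delta_laurent.
- exact: gluable_okb eU3' gF3 piP delta_laurent.
Qed.

Lemma psi_LE n (g g1 g2 : graph 'I_n) F h (x y : rat) :
  vtx g1 =1 vtx g -> vtx g2 =1 vtx g -> edg g1 =1 edg g -> edg g2 =1 edg g ->
  (forall z, z <> h -> z <> edg g h -> bead g1 z = bead g z /\ bead g2 z = bead g z) ->
  bead g h = qc x * bead g1 h + qc y * bead g2 h ->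
  gluable delta g F -> gluable delta g1 F -> gluable delta g2 F ->
  psi_sum gen g F = x *: psi_sum gen g1 F + y *: psi_sum gen g2 F.
Proof.
move=> ev1 ev2 ee1 ee2 ez eh gF gF1 gF2.
have [g_ok gs _] := gF; have [g1_ok _ _] := gF1; have [g2_ok _ _] := gF2.
(* A glued path is read from a surviving end. If [h] is univalent, the other half of its edge is
   not, and the combination is transported there by [bar]. *)
wlog hU : h eh ez / ~~ univ g h.
  move=> IH; have [hU|] := boolP (univ g h); last exact: IH eh ez.
  apply: (IH (edg g h)) (gs _ hU) => [|z z1 z2].
    rewrite (bead_edg g_ok) eh -{1}ee1 -{1}ee2 (bead_edg g1_ok) (bead_edg g2_ok).
    by rewrite rmorphD !rmorphM /= !bar_qc.
  by apply: ez => // e; apply: z2; rewrite (ok_edgK g_ok).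
apply: (psi_sum_LE delta_laurent gen_inv) => // pi piP.
have piE := pairingP _ _ piP.
(* A glued path consists of two edges. Its second edge is that of [h] exactly when the path leads to
   [h], that is, when [z] is the other end of the path of [h]. *)
have edgU z : univ g (edg g z) ->
    [/\ pi (edg g z) <> h, bead g1 (pi (edg g z)) = bead g (pi (edg g z))
      & bead g2 (pi (edg g z)) = bead g (pi (edg g z))] \/ z = gedge g pi (univ g) h.
  move=> zU; have [piK] := piE (edg g z); rewrite zU => -[ne pU].
  have ph : pi (edg g z) <> h by move=> e; case/negP: hU; rewrite -e.
  have [e|ne'] := pselect (pi (edg g z) = edg g h); [right|left].
    by rewrite /gedge -e pU piK (ok_edgK g_ok).
  by have [] := ez _ ph ne'; split.
have ee1' : edg g1 = edg g by apply/funext.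
have ee2' : edg g2 = edg g by apply/funext.
exists h => //; split=> [|z zU zh ze]; rewrite /gbead ee1' ee2'.
  case: ifP => hE //.
  have [[ph -> ->]|e] := edgU _ hE; first by rewrite eh; ring.
  case: (gluable_spec (frefl _) gF piP) => _ _ _ _ _ nq _ _.
  by case: (nq h hU).
have zE : z <> edg g h \/ univ g z.
  have [e|] := pselect (z = edg g h); last by left.
  by case: ze; rewrite e /gedge -e (negbTE zU).
case: zE => [zE|]; last by rewrite (negbTE zU).
have [-> ->] := ez _ zh zE; case: ifP => // eU.
by have [[_ -> ->]|//] := edgU _ eU.
Qed.

Lemma psi_Hol n (g g' : graph 'I_n) F h :
  ~~ univ g h -> vtx g' =1 vtx g -> edg g' =1 edg g -> ori g' =1 ori g ->
  (forall z, ori g z ->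
     lab g' z = lab g z * (if same_vtx g h z then tt_ else 1)
                        * (if same_vtx g h (edg g z) then tt_^-1 else 1)) ->
  gluable delta g F -> gluable delta g' F ->
  psi_sum gen g F = psi_sum gen g' F.
Proof.
move=> hU ev ee eo el gF g'F; have [g_ok gs _] := gF; have [g'_ok _ _] := g'F.
have eb z : bead g' z = bead g z * (if same_vtx g h z then tt_ else 1)
                        * (if same_vtx g h (edg g z) then tt_^-1 else 1).
  rewrite {1 2}/bead eo; case: ifP => oz; first exact: el.
  rewrite -(ok_lab_edg g'_ok) -(ok_lab_edg g_ok) ee el; last first.
    by rewrite (ok_ori g_ok) oz.
  rewrite (ok_edgK g_ok) !rmorphM /= !(fun_if bar) fmorphV /= bar_tt rmorph1 invrK.
  by rewrite mulrAC.
have nsame u : univ g u -> same_vtx g h u = false.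
  by move=> uU; apply: contraTF uU; apply: same_vtx_nuniv g_ok hU.
have eU : univ g' = univ g by apply/funext => x; rewrite /univ ev.
have eU' x : univ g' x = univ g x by rewrite eU.
rewrite /psi_sum eU; apply: eq_bigr => pi piP; have piE := pairingP _ _ piP.
have gs1 := gluable_spec (frefl _) gF piP; have gs' := gluable_spec eU' g'F piP.
have ee' : edg g' = edg g by apply/funext.
apply: (gen_Hol (h := exist (fun h => ~~ univ g h) h hU)).
- by move=> x; apply: val_inj; rewrite (val_vtx_glue gs') (val_vtx_glue gs1) ev.
- by move=> x; apply: val_inj; rewrite (val_edg_glue gs') (val_edg_glue gs1) /gedge ee'.
- move=> x; rewrite !(same_vtx_glue _ _ gs1) (val_edg_glue gs1) (bead_glue gs1).
  rewrite (bead_glue gs') /gbead /gedge ee' !eb /=; case: ifP => // xE.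
  have [_] := piE (edg g (val x)); rewrite xE => -[_ pU].
  (* The glued points do not belong to the vertex of [h], so the powers of [t] come from the two
     ends of the path alone. *)
  by rewrite (nsame _ xE) (nsame _ pU) !mulr1 -!mulrA; congr (_ * _); ring.
- exact: gluable_okb gF piP delta_laurent.
- exact: gluable_okb eU' g'F piP delta_laurent.
Qed.

End PsiRelations.

Lemma lsum_eq2 D (V : lmodType rat) (phi : D -> V) d d' :
  phi d = phi d' -> lsum phi [:: (1, d); (-1, d')] = 0.
Proof.
by move=> e; rewrite !lsum_cons lsum_nil e scale1r scaleN1r addr0 subrr.
Qed.

Lemma lsum_eq3 D (V : lmodType rat) (phi : D -> V) d d1 d2 (x y : rat) :
  phi d = x *: phi d1 + y *: phi d2 ->
  lsum phi [:: (1, d); (- x, d1); (- y, d2)] = 0.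
Proof.
by move=> e; rewrite !lsum_cons lsum_nil e scale1r !scaleNr addr0 -opprD subrr.
Qed.

(** * Relations specific to colored diagrams *)

Section PsiColored.
Variables (A : lmodType LP) (b : A -> A -> Qt) (delta : Qt).
Hypothesis delta_laurent : delta \in laurent.
Local Notation gen := (relgen (drel delta)).
Local Notation okc := (okc b delta).

Definition psi_gen (D : cdiag A) : relquot (drel delta) :=
  psi_sum gen (dgr D) (@lnk A D).

Let gen_inv := bead_invariant_gen delta.

Lemma okc_gluable D : okc D -> gluable delta (dgr D) (@lnk A D).
Proof.
by case=> g_ok gs FP; split=> // v v' vU v'U vv'; have [] := FP _ _ vU v'U vv'.
Qed.

Lemma psi_common r : common_rel (@cdeq A) okc r -> lsum psi_gen r = 0.
Proof.
case=> {r}.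
- move=> m n f g g' d d' f_bij ev ee eo el [_ eF] /okc_gluable gF /okc_gluable g'F.
  apply: lsum_eq2; apply: (psi_sum_iso (f := f) delta_laurent gen_inv) => // h.
  exact: eq_bead.
- move=> n g g' d h hU [ee eo el] ev /okc_gluable gF /okc_gluable g'F.
  rewrite !lsum_cons lsum_nil !scale1r addr0; apply: (psi_AS delta_laurent hU) => //.
  by move=> z; apply: eq_bead.
- move=> n g1 g2 g3 d h h' u v w z uq hh' lh [ee2 eo2 el2] [ee3 eo3 el3] ev c1 c2 c3
    /okc_gluable gF1 /okc_gluable gF2 /okc_gluable gF3.
  rewrite !lsum_cons lsum_nil !scale1r addr0 addrA.
  apply: (psi_IHX delta_laurent uq hh' lh _ _ _ _ ev c1 c2 c3) => // x;
    exact: eq_bead.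
- move=> n g g1 g2 d h x y ev1 ev2 ee1 ee2 eo1 eo2 ez eh
    /okc_gluable gF /okc_gluable gF1 /okc_gluable gF2.
  apply: lsum_eq3; apply: (psi_LE (h := h) delta_laurent) => //.
    move=> z z1 z2; have [] := ez z.
      by rewrite /same_edge !inE negb_or; apply/andP; split; apply/eqP.
    by move=> l1 l2; split; apply: eq_bead.
  rewrite /bead -eo1 -eo2 eh; case: ifP => // _.
  by rewrite rmorphD !rmorphM /= !bar_qc.
- move=> n g g' d h ev ee eo el /okc_gluable gF /okc_gluable g'F.
  apply: lsum_eq2; apply: (psi_sum_iso (f := id) delta_laurent gen_inv) => //.
    by exists id.
  move=> z; rewrite /bead eo el; case: (same_edge g h z) => //.
  by case: (ori g z); rewrite //= barK.
- move=> n g g' d h hU ev ee eo el /okc_gluable gF /okc_gluable g'F.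
  by apply: lsum_eq2; apply: (psi_Hol delta_laurent hU).
Qed.

(** In each pairing exactly one glued edge passes through [v], and its label is linear in the
    linking of [v] with its partner. *)
Lemma psi_LV n (g : graph 'I_n) (F F1 F2 : 'I_n -> 'I_n -> Qt) v (x y : rat) :
  univ g v ->
  (forall u, univ g u -> u <> v -> F v u = qc x * F1 v u + qc y * F2 v u) ->
  (forall u u', u <> v -> u' <> v -> F1 u u' = F u u' /\ F2 u u' = F u u') ->
  gluable delta g F -> gluable delta g F1 -> gluable delta g F2 ->
  psi_sum gen g F = x *: psi_sum gen g F1 + y *: psi_sum gen g F2.
Proof.
move=> vU Fv Fu gF gF1 gF2; have [g_ok gs _] := gF.
apply: (psi_sum_LE delta_laurent gen_inv) => // pi piP; have piE := pairingP _ _ piP.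
exists (edg g v); first exact: gs.
have [piK] := piE v; rewrite vU => -[pv pvU].
rewrite /gbead !(ok_edgK g_ok) vU; split=> [|z zU z1 z2].
  by rewrite Fv //; ring.
case: ifP => // eU; have [] := Fu (edg g z) (pi (edg g z)); last by move=> -> ->.
  by move=> e; apply: z1; rewrite -e (ok_edgK g_ok).
move=> e; apply: z2; rewrite /gedge (ok_edgK g_ok) vU -e.
by have [-> _] := piE (edg g z); rewrite (ok_edgK g_ok).
Qed.

(** [Q] moves from the edge at [v] to the linking, two successive factors of the label of one glued
    path. *)
Lemma psi_EV n (g g' : graph 'I_n) (F F' : 'I_n -> 'I_n -> Qt) v (P Q : Qt) :
  univ g v -> vtx g =1 vtx g' -> edg g =1 edg g' -> ori g =1 ori g' ->
  ori g v = false -> lab g v = P * Q -> lab g' v = P ->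
  (forall z, ~~ same_edge g v z -> lab g' z = lab g z) ->
  (forall u, univ g u -> u <> v -> F' v u = Q * F v u) ->
  (forall u u', u <> v -> u' <> v -> F' u u' = F u u') ->
  gluable delta g F -> gluable delta g' F' ->
  psi_sum gen g F = psi_sum gen g' F'.
Proof.
move=> vU ev ee eo ov lv lv' lz Fv Fu gF g'F'.
have [g_ok gs FP] := gF; have [g'_ok gs' FP'] := g'F'.
have bv' : bead g' v = bar P by rewrite /bead -eo ov lv'.
have bv : bead g v = bar P * bar Q by rewrite /bead ov lv rmorphM.
have bev : bead g (edg g v) = P * Q by rewrite (bead_edg g_ok) bv -rmorphM barK.
have bev' : bead g' (edg g v) = P by rewrite ee (bead_edg g'_ok) bv' barK.
have bz z : z <> v -> z <> edg g v -> bead g' z = bead g z.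
  move=> z1 z2; apply: eq_bead => //; apply: lz.
  by rewrite /same_edge !inE negb_or; apply/andP; split; apply/eqP.
have ee' : edg g' = edg g by apply/funext => z; rewrite ee.
have U'E z : univ g' z = univ g z by rewrite /univ ev.
apply: (psi_sum_gbead delta_laurent gen_inv) => // pi piP h hU.
have piE := pairingP _ _ piP; rewrite /gbead ee'; case: ifP => eU; last first.
  apply: bz => e; last by move: eU; rewrite e (ok_edgK g_ok) vU.
  by move: hU; rewrite e vU.
have hv : h <> v by move=> e; move: hU; rewrite e vU.
have [piK] := piE (edg g h); rewrite eU => -[pn pU].
have pev : pi (edg g h) <> edg g v.
  by move=> e; move: pU; rewrite e (negbTE (gs _ vU)).
have [e|n1] := pselect (edg g h = v).
  rewrite e in pn pU pev *; have -> : h = edg g v by rewrite -e (ok_edgK g_ok).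
  by rewrite bev bev' Fv // bz //; ring.
have hev : h <> edg g v by move=> e; apply: n1; rewrite e (ok_edgK g_ok).
rewrite (bz h) //; have [e|n2] := pselect (pi (edg g h) = v); last first.
  by rewrite Fu // bz.
(* This path enters the pair at the partner of [v]. Read in this direction the linkings are
   conjugate, and the factor exchanged is [bar Q]. *)
rewrite e bv bv'; have [_ ->] := FP' v (edg g h) (etrans (U'E _) vU)
  (etrans (U'E _) eU) (nesym n1).
have [_ ->] := FP v (edg g h) vU eU (nesym n1).
by rewrite Fv // rmorphM /=; ring.
Qed.

Lemma psi_crel r : crel b delta r -> lsum psi_gen r = 0.
Proof.
case=> {r}.
- exact: psi_common.
- move=> n g c c1 c2 f f1 f2 v x y vU cv cu Fv Fu.
  move=> /okc_gluable gF /okc_gluable gF1 /okc_gluable gF2.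
  by apply: lsum_eq3; apply: (psi_LV vU).
- move=> n g g' c c' f f' v P Q vU ev ee eo ov lv lv' lz _ _ Fv Fu.
  move=> /okc_gluable gF /okc_gluable gF'.
  by apply: lsum_eq2; apply: (psi_EV vU ev ee eo ov lv lv' lz Fv Fu).
- move=> n g c f f' v1 v2 P v1U v2U v12 _ _ F12 Fu /okc_gluable gF /okc_gluable gF'.
  rewrite !lsum_cons lsum_nil scale1r !scaleN1r addr0 -opprD.
  apply/eqP; rewrite subr_eq0; apply/eqP.
  have Pl := lpvalP P.
  rewrite /psi_gen (psi_sum_LD delta_laurent gen_inv gF v1U v2U v12 Pl gF' F12 Fu).
  congr (_ + _); have gC := gluable_close_pair gF v1U v2U v12 Pl.
  (* The relator contains the closed diagram renumbered on ordinals. *)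
  apply: (psi_sum_iso (f := enum_rank) delta_laurent gen_inv) => //.
  - by move=> h /=; rewrite enum_rankK.
  - by move=> h /=; rewrite enum_rankK.
  - by move=> h; rewrite /bead /= enum_rankK.
  - by move=> x y *; rewrite /lnk /= !enum_rankK.
  case: gC => C_ok Cs CF; split; first exact: ok_pack.
  - by move=> h; rewrite !univ_pack /= enum_rankK; apply: Cs.
  - move=> x y; rewrite !univ_pack => xU yU xy; apply: CF => // /enum_val_inj.
    exact: xy.
(* An automorphism acts on the labels in [A] and keeps the linkings, so both diagrams have the same
   closing. *)
- by move=> n g c f s _ _ _; apply: lsum_eq2.
Qed.

End PsiColored.

(** * Disjoint unions *)

Lemma ok_gunion (H1 H2 : Type) S (g1 : graph H1) (g2 : graph H2) :
  ok_graph S g1 -> ok_graph S g2 -> ok_graph S (gunion g1 g2).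
Proof.
move=> [v1 e1 o1 l1 s1] [v2 e2 o2 l2 s2]; split=> -[x|x] /=; rewrite ?v1 ?v2 //.
  by have [-> n] := e1 x; split=> // -[].
by have [-> n] := e2 x; split=> // -[].
Qed.

Section Union.
Variables (delta : Qt).
Hypothesis delta_laurent : delta \in laurent.

Lemma okb_gunion (H1 H2 : finType) (g1 : graph H1) (g2 : graph H2) :
  okb delta g1 -> okb delta g2 -> okb delta (gunion g1 g2).
Proof.
by case=> ok1 U1 [ok2 U2]; split; [apply: ok_gunion|case=> x; [apply: U1|apply: U2]].
Qed.

Lemma okb_dunion D E : okb delta (dgr D) -> okb delta (dgr E) ->
  okb delta (dgr (dunion D E)).
Proof. by move=> okD okE; apply/okb_pack/okb_gunion. Qed.

Lemma bead_invariant_unionl (V : lmodType rat) (phi : ddiag -> V) E :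
  okb delta (dgr E) -> bead_invariant delta phi ->
  bead_invariant delta (fun D => phi (dunion D E)).
Proof.
move=> okE [phi_iso phi_LE]; split.
  move=> H H' g g' f [f' fK f'K] ev ee eb okg okg'.
  apply: (phi_iso _ _ _ _ (fun h => match h with
    | inl i => inl (enum_rank (f (enum_val i))) | inr j => inr j end)).
  - exists (fun h => match h with
      | inl i => inl (enum_rank (f' (enum_val i))) | inr j => inr j end) => -[i|j] //;
      by rewrite enum_rankK ?fK ?f'K enum_valK.
  - by move=> [i|j] //=; rewrite !enum_rankK ev.
  - by move=> [i|j] //=; rewrite !enum_rankK ee.
  - move=> [i|j] //; rewrite -[RHS]/(bead g (enum_val i)) -eb.
    by rewrite -{2}[f _]enum_rankK.
  - by apply: okb_gunion => //; apply: okb_pack.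
  - by apply: okb_gunion => //; apply: okb_pack.
move=> H g g1 g2 h x y ev1 ev2 ee1 ee2 ez eh ok0 ok1 ok2.
apply: (phi_LE _ _ _ _ (inl (enum_rank h)));
  do ?by apply: okb_gunion => //; apply: okb_pack.
- by move=> [i|j] //=; rewrite ev1.
- by move=> [i|j] //=; rewrite ev2.
- by move=> [i|j] //=; rewrite ee1.
- by move=> [i|j] //=; rewrite ee2.
- move=> [i|j] //= n1 n2; apply: (ez (enum_val i)) => e.
    by apply: n1; rewrite -e enum_valK.
  by apply: n2; rewrite enum_rankK -e enum_valK.
- have bE (k : graph H) : bead (gunion (pack k) (dgr E)) (inl (enum_rank h)) = bead k h.
    by rewrite -{2}[h]enum_rankK.
  by rewrite !bE.
Qed.

(** The two orders of a union are isomorphic, which reduces the statement to the other side. *)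
Lemma bead_invariant_unionr (V : lmodType rat) (phi : ddiag -> V) D :
  okb delta (dgr D) -> bead_invariant delta phi ->
  bead_invariant delta (fun E => phi (dunion D E)).
Proof.
move=> okD phi_inv; have [phi_iso _] := phi_inv.
have dunionC E : okb delta (dgr E) -> phi (dunion D E) = phi (dunion E D).
  move=> okE; apply: (phi_iso _ _ _ _ (fun h => match h with
    | inl i => inr i | inr j => inl j end)).
  - by exists (fun h => match h with inl i => inr i | inr j => inl j end) => -[].
  - by case.
  - by case.
  - by case.
  - exact: okb_gunion.
  - exact: okb_gunion.
have [inv_iso inv_LE] := bead_invariant_unionl okD phi_inv.
split.
  move=> H H' g g' f f_bij ev ee eb okg okg'.
  by rewrite !dunionC; [exact: inv_iso ev ee eb okg okg'|exact: okb_pack..].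
move=> H g g1 g2 h x y ev1 ev2 ee1 ee2 ez eh ok0 ok1 ok2.
rewrite !dunionC; do ?exact: okb_pack.
exact: inv_LE ev1 ev2 ee1 ee2 ez eh ok0 ok1 ok2.
Qed.

(** Equality modulo relations that only involve beads; unlike equality modulo
[drel], it is readily compatible with disjoint unions. *)
Definition bead_eq (x y : gs ddiag) : Prop :=
  forall n (V : lmodType rat) (phi : ddiag -> V),
    bead_invariant delta phi -> lsum phi (x n) = lsum phi (y n).

Definition okgs (x : gs ddiag) : Prop :=
  forall n, lall (fun D => okb delta (dgr D)) (x n).

Local Notation mul := (gmul (fun _ _ => dunion)).
Local Notation pow := (gpow (fun _ _ => dunion) dempty).
Local Notation inv := (ginv (fun _ _ => dunion) dempty).

Lemma lsum_gmul D (V : lmodType rat) (phi : D -> V) op x y n :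
  lsum phi (gmul (fun _ _ => op) x y n) = \sum_(k <- iota 0 n.+1)
    lsum (fun d => lsum (fun e => phi (op d e)) (y (n - k)%N)) (x k).
Proof.
by rewrite lsum_flatten big_map; apply: eq_bigr => k _; rewrite lsum_mul.
Qed.

(** One factor is replaced at a time, through the product of [x'] and [y]: the factor kept fixed
    must be admissible for the functional to remain invariant. *)
Lemma bead_eq_mul x x' y y' : okgs x' -> okgs y ->
  bead_eq x x' -> bead_eq y y' -> bead_eq (mul x y) (mul x' y').
Proof.
move=> okx' oky exx' eyy' n V phi phi_inv; rewrite !lsum_gmul.
apply: eq_bigr => k _.
transitivity (lsum (fun d => lsum (fun e => phi (dunion d e)) (y (n - k)%N)) (x' k)).
  rewrite lsumC [RHS]lsumC; apply: eq_lsum => p /oky okp.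
  by apply: exx'; apply: bead_invariant_unionl.
apply: eq_lsum => p /okx' okp.
by apply: eyy'; apply: bead_invariant_unionr.
Qed.

Lemma okgs_mul x y : okgs x -> okgs y -> okgs (mul x y).
Proof.
move=> okx oky n; apply: lall_flatten => k _.
exact: (lall_mul okb_dunion (okx k) (oky _)).
Qed.

Lemma okb_dempty : okb delta (dgr dempty).
Proof. by apply: okb_pack; split=> [|[]]; split=> -[]. Qed.

Lemma okgs_pow x k : okgs x -> okgs (pow x k).
Proof.
move=> okx; elim: k => [|k ih]; last exact: okgs_mul.
by move=> [|n] p //= [<-|//]; apply: okb_dempty.
Qed.

(** Minus the part of positive degree: the ratio of the geometric series in [ginv]. *)
Let cut (x : gs ddiag) : gs ddiag :=
  fun n => if n == 0%N then [::] else lscale (-1) (x n).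

Lemma okgs_inv x : okgs x -> okgs (inv x).
Proof.
move=> okx n; apply: lall_flatten => k _.
have okc : okgs (cut x) by move=> [|m] //; apply: (lall_scale (a := -1)) (okx m.+1).
exact: okgs_pow okc n.
Qed.

Lemma bead_eq_pow x y k : okgs x -> okgs y -> bead_eq x y ->
  bead_eq (pow x k) (pow y k).
Proof.
by move=> okx oky exy; elim: k => [//|k ih]; apply: bead_eq_mul => //; apply: okgs_pow.
Qed.

Lemma bead_eq_inv x y : okgs x -> okgs y -> bead_eq x y -> bead_eq (inv x) (inv y).
Proof.
move=> okx oky exy n V phi phi_inv; rewrite !lsum_flatten !big_map.
apply: eq_bigr => k _; apply: bead_eq_pow phi_inv.
- by move=> [|m] //; apply: (lall_scale (a := -1)) (okx m.+1).
- by move=> [|m] //; apply: (lall_scale (a := -1)) (oky m.+1).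
- by move=> [|m] // V' phi' inv'; rewrite /= !lsum_scale exy.
Qed.

End Union.

Lemma In_mem (T : eqType) (x : T) s : List.In x s -> x \in s.
Proof.
by elim: s => //= y s ih [->|/ih xs]; rewrite in_cons ?eqxx // xs orbT.
Qed.

Definition lnk_union (H1 H2 : Type) (F1 : H1 -> H1 -> Qt) (F2 : H2 -> H2 -> Qt)
    (h h' : H1 + H2) : Qt :=
  match h, h' with
  | inl x, inl y => F1 x y | inr x, inr y => F2 x y | _, _ => 0
  end.

(** * Multiplicativity of the closing map *)

Section PsiUnion.
Variables (delta : Qt) (V : lmodType rat) (phi : ddiag -> V).
Hypotheses (delta_laurent : delta \in laurent) (phi_inv : bead_invariant delta phi).

Section OneUnion.
Variables (H1 H2 : finType) (g1 : graph H1) (g2 : graph H2).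
Variables (F1 : H1 -> H1 -> Qt) (F2 : H2 -> H2 -> Qt).
Hypotheses (gF1 : gluable delta g1 F1) (gF2 : gluable delta g2 F2).
Local Notation H := (H1 + H2)%type.
Local Notation g := (gunion g1 g2).
Local Notation F := (lnk_union F1 F2).

Lemma gluable_union : gluable delta g F.
Proof.
have [ok1 s1 FP1] := gF1; have [ok2 s2 FP2] := gF2.
have d0 : deltalab delta 0 by rewrite /deltalab mul0r rpred0.
split; first exact: ok_gunion.
  by case=> x; [apply: s1|apply: s2].
move=> [x|x] [y|y] xU yU xy; rewrite /= ?rmorph0 //.
  by apply: FP1 => // e; apply: xy; rewrite e.
by apply: FP2 => // e; apply: xy; rewrite e.
Qed.

Let side (h : H) : bool := if h is inl _ then true else false.
Let respects (pi : {ffun H -> H}) : bool := [forall h, side (pi h) == side h].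

Let join (p : {ffun H1 -> H1} * {ffun H2 -> H2}) : {ffun H -> H} :=
  [ffun h => match h with inl x => inl (p.1 x) | inr y => inr (p.2 y) end].
(** The default values serve on pairings that mix the two parts; on the others, [join] recovers the
    pairing. *)
Let split_ (pi : {ffun H -> H}) : {ffun H1 -> H1} * {ffun H2 -> H2} :=
  ([ffun x => if pi (inl x) is inl y then y else x],
   [ffun x => if pi (inr x) is inr y then y else x]).

Let join_split pi : respects pi -> join (split_ pi) = pi.
Proof.
move/forallP => pi_r; apply/ffunP => -[x|x]; rewrite ffunE /split_ /= ffunE.
  by have := pi_r (inl x); case: (pi (inl x)).
by have := pi_r (inr x); case: (pi (inr x)).
Qed.

Let pairing_join p : pairing (univ g) (join p)
  = pairing (univ g1) p.1 && pairing (univ g2) p.2.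
Proof.
apply/pairingP/andP => [pP|[/pairingP p1P /pairingP p2P] [x|x]].
- split; apply/pairingP => x; [have := pP (inl x)|have := pP (inr x)];
    rewrite !ffunE /= => -[[->]].
    rewrite -[univ g (inl x)]/(univ g1 x) -[univ g (inl (p.1 x))]/(univ g1 (p.1 x)).
    case: (univ g1 x) => [[ne U']|[e]]; split=> //; split=> // e.
    by apply: ne; rewrite e.
  rewrite -[univ g (inr x)]/(univ g2 x) -[univ g (inr (p.2 x))]/(univ g2 (p.2 x)).
  case: (univ g2 x) => [[ne U']|[e]]; split=> //; split=> // e.
  by apply: ne; rewrite e.
- rewrite !ffunE /=; have [-> h] := p1P x; split=> //; move: h.
  rewrite -[univ g (inl x)]/(univ g1 x) -[univ g (inl (p.1 x))]/(univ g1 (p.1 x)).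
  by case: (univ g1 x) => [[ne U']|->//]; split=> // -[].
rewrite !ffunE /=; have [-> h] := p2P x; split=> //; move: h.
rewrite -[univ g (inr x)]/(univ g2 x) -[univ g (inr (p.2 x))]/(univ g2 (p.2 x)).
by case: (univ g2 x) => [[ne U']|->//]; split=> // -[].
Qed.

(* A pair joining the two parts carries the linking [0]. *)
Let glue_mixed pi : pairing (univ g) pi -> ~~ respects pi ->
  phi (dmk (glue g pi (univ g) F)) = 0.
Proof.
move=> piP /forallPn[h hside]; have [piK piE] := pairingP _ _ piP h.
have gF := gluable_union; have [g_ok gs _] := gF.
have hU : univ g h.
  by move: piE; case: (univ g h) => // e; move: hside; rewrite e eqxx.
have F0 : F h (pi h) = 0 by case: (h) (pi h) hside => x [y|y].
have spec := gluable_spec (frefl _) gF piP.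
have ok := gluable_okb (frefl _) gF piP delta_laurent.
(* A zero label is the empty combination, expressed by LE with two zero coefficients and the same
   diagram three times. *)
rewrite (glue_LE (h := edg g h) (x := 0) (y := 0) phi_inv spec spec spec) //.
- by rewrite !scale0r addr0.
- exact: gs.
- by rewrite {1}/gbead (ok_edgK g_ok) hU F0 mulr0 mul0r /qc /tofracQ;
     rewrite !rmorph0 !mul0r addr0.
Qed.

Lemma psi_sum_union : psi_sum phi g F =
  \sum_(p1 | pairing (univ g1) p1) \sum_(p2 | pairing (univ g2) p2)
    phi (dmk (gunion (pack (glue g1 p1 (univ g1) F1))
                     (pack (glue g2 p2 (univ g2) F2)))).
Proof.
rewrite /psi_sum (bigID respects) /= [X in _ + X]big1 ?addr0; last first.
  by move=> pi /andP[piP pi_r]; apply: glue_mixed.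
rewrite (reindex_onto join split_) /=; last by move=> pi /andP[_]; apply: join_split.
rewrite pair_big /=; apply: eq_big => [p|p].
  rewrite pairing_join.
  have -> : respects (join p) by apply/forallP => -[x|x]; rewrite ffunE.
  have -> : split_ (join p) = p.
    by case: p => p1 p2; rewrite /split_; congr pair; apply/ffunP => x; rewrite !ffunE.
  by rewrite eqxx !andbT.
move=> /andP[/andP[joinP _] _]; have := joinP; rewrite pairing_join => /andP[p1P p2P].
have spec1 := gluable_spec (frefl _) gF1 p1P.
have spec2 := gluable_spec (frefl _) gF2 p2P.
have spec := gluable_spec (frefl _) gluable_union joinP.
have ok1 := gluable_okb (frefl _) gF1 p1P delta_laurent.
have ok2 := gluable_okb (frefl _) gF2 p2P delta_laurent.
have ok := gluable_okb (frefl _) gluable_union joinP delta_laurent.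
have [phi_iso _] := phi_inv.
pose f (h : 'I_#|{: {h | ~~ univ g1 h}}| + 'I_#|{: {h | ~~ univ g2 h}}|) :
    {h | ~~ univ g h} :=
  match h with
  | inl i => exist (fun h : H => ~~ univ g h) (inl (val (enum_val i)))
               (valP (enum_val i))
  | inr j => exist (fun h : H => ~~ univ g h) (inr (val (enum_val j)))
               (valP (enum_val j))
  end.
apply/esym; apply: (phi_iso _ _ _ _ f).
- apply: inj_surj_bij => [[i|i] [j|j] /(congr1 val) //= [/val_inj/enum_val_inj ->] //|].
  case=> -[x|x] xU.
    exists (inl (enum_rank (exist (fun h => ~~ univ g1 h) x xU))).
    by apply: val_inj; rewrite /= enum_rankK.
  exists (inr (enum_rank (exist (fun h => ~~ univ g2 h) x xU))).
  by apply: val_inj; rewrite /= enum_rankK.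
- move=> [i|i]; apply: val_inj; rewrite (val_vtx_glue spec).
    by rewrite [RHS]/= enum_rankK (val_vtx_glue spec1).
  by rewrite [RHS]/= enum_rankK (val_vtx_glue spec2).
- move=> [i|i]; apply: val_inj; rewrite (val_edg_glue spec).
    rewrite [RHS]/= enum_rankK (val_edg_glue spec1) /gedge [edg g _]/= ffunE.
    rewrite -[univ g (inl _)]/(univ g1 _).
    by case: ifP.
  rewrite [RHS]/= enum_rankK (val_edg_glue spec2) /gedge [edg g _]/= ffunE.
  rewrite -[univ g (inr _)]/(univ g2 _).
  by case: ifP.
- move=> [i|i]; rewrite (bead_glue spec).
    rewrite -[RHS]/(bead (glue g1 p.1 (univ g1) F1) (enum_val i)) (bead_glue spec1).
    rewrite /gbead [edg g _]/= ffunE -[univ g (inl _)]/(univ g1 _).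
    by case: ifP.
  rewrite -[RHS]/(bead (glue g2 p.2 (univ g2) F2) (enum_val i)) (bead_glue spec2).
  rewrite /gbead [edg g _]/= ffunE -[univ g (inr _)]/(univ g2 _).
  by case: ifP.
- by apply: okb_gunion; apply: okb_pack.
- exact: ok.
Qed.

End OneUnion.

Lemma gluable_cunion (A : lmodType LP) (D E : cdiag A) :
  gluable delta (dgr D) (@lnk A D) -> gluable delta (dgr E) (@lnk A E) ->
  gluable delta (dgr (cunion D E)) (@lnk A (cunion D E)).
Proof.
move=> gD gE; have [ok s FP] := gluable_union gD gE; split; first exact: ok_pack.
  by move=> h; rewrite !univ_pack /= enum_rankK; apply: s.
move=> x y; rewrite !univ_pack => xU yU xy; apply: FP => // /enum_val_inj.
exact: xy.
Qed.

Variable A : lmodType LP.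
Implicit Types D E : cdiag A.

Lemma lsum_psi1 D (W : lmodType rat) (chi : ddiag -> W) :
  lsum chi (psi1 D) = psi_sum chi (dgr D) (@lnk A D).
Proof.
rewrite /lsum /psi1 big_map sum_pairings.
by apply: eq_bigr => pi _; rewrite scale1r.
Qed.

Lemma lsum_psi1_union D E :
  gluable delta (dgr D) (@lnk A D) -> gluable delta (dgr E) (@lnk A E) ->
  lsum phi (psi1 (cunion D E))
  = lsum (fun d => lsum (fun e => phi (dunion d e)) (psi1 E)) (psi1 D).
Proof.
move=> gD gE; rewrite !lsum_psi1.
transitivity (psi_sum phi (gunion (dgr D) (dgr E)) (lnk_union (@lnk A D) (@lnk A E))).
  apply/esym; apply: (psi_sum_iso (f := enum_rank) delta_laurent phi_inv).
  - exact: enum_rank_bij.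
  - by move=> h /=; rewrite enum_rankK.
  - by move=> h /=; rewrite enum_rankK.
  - by move=> h; rewrite /bead /= enum_rankK.
  - by move=> x y _ _ _; rewrite /lnk /= !enum_rankK.
  - exact: gluable_union.
  - exact: gluable_cunion.
rewrite (psi_sum_union gD gE) /psi_sum; apply: eq_bigr => p1 _.
by rewrite lsum_psi1.
Qed.

End PsiUnion.

(** * Closing of products, powers and inverses of series *)

Section PsiSeries.
Variables (delta : Qt) (A : lmodType LP).
Hypothesis delta_laurent : delta \in laurent.
Local Notation gluablec := (fun D : cdiag A => gluable delta (dgr D) (@lnk A D)).

Definition cgs_ok (x : gs (cdiag A)) : Prop := forall n, lall gluablec (x n).

Local Notation mulc := (gmul (fun _ _ => @cunion A)).
Local Notation powc := (gpow (fun _ _ => @cunion A) (cempty A)).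
Local Notation invc := (ginv (fun _ _ => @cunion A) (cempty A)).
Local Notation muld := (gmul (fun _ _ => dunion)).
Local Notation powd := (gpow (fun _ _ => dunion) dempty).
Local Notation invd := (ginv (fun _ _ => dunion) dempty).

Lemma cgs_ok_mul x y : cgs_ok x -> cgs_ok y -> cgs_ok (mulc x y).
Proof.
move=> okx oky n; apply: lall_flatten => k _.
exact: (lall_mul (P := gluablec) (Q := gluablec) (S := gluablec)
          (@gluable_cunion delta A) (okx k) (oky _)).
Qed.

Lemma gluable_cempty : gluablec (cempty A).
Proof.
have no (i : 'I_#|{: void}|) : False by case: (enum_val i).
by split=> [|x|x]; [apply: ok_pack; split=> -[]|case: (no x)|case: (no x)].
Qed.

Lemma cgs_ok_pow x k : cgs_ok x -> cgs_ok (powc x k).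
Proof.
move=> okx; elim: k => [|k ih]; last exact: cgs_ok_mul.
by move=> [|n] p //= [<-|//]; apply: gluable_cempty.
Qed.

Lemma cgs_ok_inv x : cgs_ok x -> cgs_ok (invc x).
Proof.
move=> okx n; apply: lall_flatten => k _; apply: cgs_ok_pow => -[|m] //.
exact: (lall_scale (a := -1)) (okx m.+1).
Qed.

Lemma okgs_psi x : cgs_ok x -> okgs delta (psi x).
Proof.
move=> okx n; apply: lall_bind => p /okx gp q /List.in_map_iff[pi [<- pi_in]] /=.
apply: okb_pack; apply: (gluable_okb (frefl _) gp _ delta_laurent).
by have := In_mem pi_in; rewrite mem_filter => /andP[].
Qed.

Lemma psi_mul x y : cgs_ok x -> cgs_ok y ->
  bead_eq delta (psi (mulc x y)) (muld (psi x) (psi y)).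
Proof.
move=> okx oky n V phi phi_inv; rewrite lsum_bind !lsum_gmul.
apply: eq_bigr => k _; rewrite lsum_bind; apply: eq_lsum => p /okx gp.
rewrite [RHS]lsumC lsum_bind; apply: eq_lsum => q /oky gq.
by rewrite (lsum_psi1_union delta_laurent phi_inv gp gq) lsumC.
Qed.

(** The empty set has exactly one perfect pairing, the empty map. *)
Lemma psi_cempty : bead_eq delta (psi (gone (cempty A))) (gone dempty).
Proof.
case=> [|n] V phi phi_inv; last by rewrite /psi /= /lsum !big_nil.
rewrite lsum_bind !lsum_cons !lsum_nil !scale1r !addr0 lsum_psi1.
have g0 : gluable delta gvoid (fun _ _ => 0) by split=> [|[]|[]]; split=> -[].
rewrite -(psi_sum_iso (f := enum_rank) (F := fun _ _ => 0) (g := gvoid)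
  delta_laurent phi_inv);
  try by case.
- pose pi0 : {ffun void -> void} := [ffun x => x].
  have pi0P : pairing (univ gvoid) pi0 by apply/pairingP => -[].
  rewrite /psi_sum (big_pred1 pi0); last first.
    by move=> pi; have -> : pi = pi0 by [apply/ffunP => -[]]; rewrite pi0P /= eqxx.
  have [phi_iso _] := phi_inv.
  apply: (phi_iso _ _ _ _ (fun x : {h | ~~ univ gvoid h} => val x)); try by case=> -[].
  + by apply: inj_surj_bij => [[[]]|[]].
  + exact: gluable_okb g0 pi0P delta_laurent.
  + by split=> [|[]]; split=> -[].
- exact: enum_rank_bij.
- exact: g0.
- exact: gluable_cempty.
Qed.

Lemma psi_pow x k : cgs_ok x ->
  bead_eq delta (psi (powc x k)) (powd (psi x) k).
Proof.
move=> okx; elim: k => [|k ih] n V phi phi_inv; first exact: psi_cempty.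
rewrite (psi_mul okx (@cgs_ok_pow x k okx)) //.
apply: (bead_eq_mul (okgs_psi okx) (okgs_psi (@cgs_ok_pow x k okx)) _ ih) => //.
Qed.

Lemma psi_inv x : cgs_ok x -> bead_eq delta (psi (invc x)) (invd (psi x)).
Proof.
move=> okx n V phi phi_inv; rewrite lsum_bind !lsum_flatten !big_map.
apply: eq_bigr => k _; rewrite -lsum_bind.
(* The ratio of the geometric series; the closing map commutes with dropping the constant term and
   changing the sign. *)
set xc : gs (cdiag A) := fun n => if n == 0%N then [::] else lscale (-1) (x n).
have okxc : cgs_ok xc by move=> [|m] //; apply: (lall_scale (a := -1)) (okx m.+1).
have okp : okgs delta (psi x) := okgs_psi okx.
rewrite -[lbind _ _]/(psi (powc xc k) n) psi_pow //.
apply: bead_eq_pow phi_inv.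
- exact: okgs_psi.
- by move=> [|m] //; apply: (lall_scale (a := -1)) (okp m.+1).
- by move=> [|m] // W chi chi_inv; rewrite /psi /= lsum_bind !lsum_scale lsum_bind.
Qed.

End PsiSeries.

(** * Gaussian integration *)

Section Matchings.
Variables (H : finType) (s : nat) (c : H -> 'I_s) (pi : H -> H).
Implicit Types A : {set H}.

Definition pi_stable A : Prop :=
  forall u, u \in A -> [/\ pi u \in A, pi (pi u) = u & pi u <> u].

Lemma pi_stableD A u : pi_stable A -> u \in A -> pi_stable (A :\: [set u; pi u]).
Proof.
move=> As uA; have [puA puK pun] := As u uA.
move=> v; rewrite !inE negb_or => /andP[/andP[vu vpu] vA].
have [pvA pvK pvn] := As v vA; split=> //; rewrite pvA andbT negb_or.
apply/andP; split; apply/eqP => e.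
  by move: vpu; rewrite -e pvK eqxx.
by move: vu; rewrite -pvK e puK eqxx.
Qed.

Lemma card_pi_stableD A u : pi_stable A -> u \in A ->
  #|A| = #|A :\: [set u; pi u]|.+2.
Proof.
move=> As uA; have [puA puK pun] := As u uA.
rewrite -(cardsID [set u; pi u] A) (finset.setIidPr _) ?cards2.
  by move/eqP/negbTE: pun; rewrite eq_sym => ->.
by apply/fintype.subsetP => v; rewrite !inE => /orP[] /eqP ->.
Qed.

(** The ways of gluing the ends of a set [K] of struts, exchanged by [e], to
points of [A], so that every strut joins a point [u] to [pi u]. *)
Definition matchings (K : finType) (e : K -> K) (col : K -> 'I_s) A :
    {set {ffun K -> H}} :=
  [set tau : {ffun K -> H} | injectiveb tau &&
    [forall k, [&& tau k \in A, c (tau k) == col k & tau (e k) == pi (tau k)]]].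

Lemma matchingsP (K : finType) (e : K -> K) col A (tau : {ffun K -> H}) :
  reflect (injective tau /\ forall k,
             [/\ tau k \in A, c (tau k) = col k & tau (e k) = pi (tau k)])
          (tau \in matchings e col A).
Proof.
rewrite inE; apply: (iffP andP) => -[ti tP]; split; try exact/injectiveP.
  by move=> k; have /and3P[-> /eqP -> /eqP ->] := forallP tP k.
by apply/forallP => k; have [-> -> ->] := tP k; rewrite !eqxx.
Qed.

Lemma card_matchings_iso (K K' : finType) (e : K -> K) (e' : K' -> K') col col'
    (f : K -> K') A :
  bijective f -> (forall k, e' (f k) = f (e k)) -> (forall k, col' (f k) = col k) ->
  #|matchings e' col' A| = #|matchings e col A|.
Proof.
move=> [f' fK f'K] fe fc.
pose tr (tau : {ffun K' -> H}) := [ffun k => tau (f k)].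
have tr_inj : injective tr.
  by move=> t t' /ffunP tt'; apply/ffunP => k; have := tt' (f' k); rewrite !ffunE f'K.
rewrite -(card_imset _ tr_inj); congr #|pred_of_set _|; apply/finset.setP => t.
apply/imsetP/matchingsP => [[t' /matchingsP[t'i t'P] ->]|[ti tP]].
  split=> [x y|k]; rewrite !ffunE; first by move/t'i/(can_inj fK).
  by have [] := t'P (f k); rewrite fe fc.
exists [ffun k => t (f' k)]; last by apply/ffunP => k; rewrite !ffunE fK.
apply/matchingsP; split=> [x y|k]; rewrite !ffunE; first by move/ti/(can_inj f'K).
have [-> -> te] := tP (f' k); split; rewrite -?fc ?f'K // -te; congr (t _).
by apply: (can_inj fK); rewrite -fe !f'K.
Qed.

Lemma card_matchings0 A (e : void -> void) col : #|matchings e col A| = 1%N.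
Proof.
apply/eqP/cards1P; exists [ffun x : void => match x with end].
apply/finset.setP => t; have -> : t = [ffun x : void => match x with end].
  by apply/ffunP => -[].
by rewrite !inE eqxx; apply/andP; split; [apply/injectiveP => -[]|apply/forallP => -[]].
Qed.

Definition strut_edg (K : Type) (e : K -> K) (h : bool + K) : bool + K :=
  match h with inl x => inl (~~ x) | inr k => inr (e k) end.
Definition strut_col (K : Type) (i j : 'I_s) (col : K -> 'I_s) (h : bool + K) :=
  match h with inl x => if x then j else i | inr k => col k end.

(** Once the tail [inl false] of the additional strut is placed at [u], its head must go to [pi u],
    and the other struts match the remaining points. *)
Lemma card_matchings_strut (K : finType) (e : K -> K) col i j A : pi_stable A ->
  #|matchings (strut_edg e) (strut_col i j col) A|
  = (\sum_(u in A | (c u == i) && (c (pi u) == j))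
       #|matchings e col (A :\: [set u; pi u])|)%N.
Proof.
move=> As; rewrite -sum1_card.
rewrite (partition_big (fun tau : {ffun bool + K -> H} => tau (inl false))
  (fun u => (u \in A) && ((c u == i) && (c (pi u) == j)))) /=; last first.
  move=> t /matchingsP[ti tP]; have [-> -> tE] := tP (inl false).
  by have [_ + _] := tP (inl true); rewrite tE => ->; rewrite !eqxx.
apply: eq_bigr => u /and3P[uA /eqP cu /eqP cpu]; have [puA puK pun] := As u uA.
pose ex (t : {ffun K -> H}) : {ffun bool + K -> H} :=
  [ffun h => match h with inl x => if x then pi u else u | inr k => t k end].
have ex_inj : injective ex.
  by move=> t t' /ffunP tt'; apply/ffunP => k; have := tt' (inr k); rewrite !ffunE.
rewrite sum1_card -(card_imset _ ex_inj); apply: eq_card => t.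
apply/andP/imsetP => [[/matchingsP[ti tP] /eqP tu]|[t' /matchingsP[ti tP] ->]].
  have [_ _ /=] := tP (inl false); rewrite tu => tpu.
  exists [ffun k => t (inr k)]; last first.
    by apply/ffunP => -[[]|k]; rewrite !ffunE.
  apply/matchingsP; split=> [x y|k]; rewrite !ffunE; first by move/ti => [].
  have [kA kc ke] := tP (inr k); split; rewrite // !inE kA andbT negb_or.
  by rewrite -tpu -tu !(inj_eq ti).
split; last by rewrite ffunE.
apply/matchingsP; split=> [[x|x] [y|y]|[x|k]]; rewrite !ffunE.
- by case: x y => -[] // e1; case: pun; rewrite -?e1 // e1.
- move=> e1; have [] := tP y; rewrite !inE -e1 negb_or.
  by case: (x); rewrite eqxx ?andbF.
- move=> e1; have [] := tP x; rewrite !inE e1 negb_or.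
  by case: (y); rewrite eqxx ?andbF.
- by move/ti => ->.
- by case: x.
- by have [] := tP k; rewrite !inE => /andP[_ ->].
Qed.

End Matchings.

Section Struts.
Variables (s : nat) (a : rat) (M : 'M[Qt]_s).

(** The only nonzero homogeneous part of the [k]-th power, as [struts] is concentrated in degree
    2. *)
Definition strut_pow (k : nat) : lc rat (sdiag s) :=
  iter k (lmul (@sunion s) (struts a M 2)) [:: (1, sempty s)].

Lemma lsum_gpow_struts (V : lmodType rat) (f : sdiag s -> V) k n :
  lsum f (gpow (fun _ _ => @sunion s) (sempty s) (struts a M) k n)
  = if n == k.*2 then lsum f (strut_pow k) else 0.
Proof.
elim: k n f => [|k ih] n f; first by case: n => [|n] //; rewrite /gpow /= lsum_nil.
rewrite lsum_gmul.
have struts0 (F : sdiag s -> V) m : m != 2%N -> lsum F (struts a M m) = 0.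
  by move=> /negbTE m2; rewrite /struts m2 lsum_nil.
case: n => [|[|n]].
- by rewrite big_seq1 struts0.
- by rewrite /= !big_cons big_nil !struts0 // !addr0.
rewrite (bigD1_seq 2%N) ?iota_uniq ?mem_iota //= big1 ?addr0; last first.
  by move=> m m2; rewrite struts0.
rewrite doubleS !eqSS subSS subSS subn0; case: (eqVneq n k.*2) => [->|nk].
  by rewrite lsum_mul; apply: eq_lsum => p _; rewrite ih eqxx.
rewrite (eq_lsum (psi := fun=> 0)); last by move=> p _; rewrite ih (negbTE nk).
by rewrite /lsum big1 // => p _; rewrite scaler0.
Qed.

(** In degree [n], the exponential retains the power [n./2], and nothing when [n] is odd. *)
Lemma lsum_exp_struts (V : lmodType rat) (f : sdiag s -> V) n :
  lsum f (exp_struts a M n)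
  = if odd n then 0 else (n./2`!%:R)^-1 *: lsum f (strut_pow n./2).
Proof.
rewrite lsum_flatten big_map.
under eq_bigr do rewrite lsum_scale lsum_gpow_struts.
case: ifPn => [n_odd|n_even].
  rewrite big1 // => k _; case: eqP => [nk|]; last by rewrite scaler0.
  by move: n_odd; rewrite nk odd_double.
have nE : n = n./2.*2 by rewrite even_halfK.
have n_in : n./2 \in iota 0 n.+1.
  rewrite mem_iota /= add0n ltnS; apply: leq_trans (leq_addr n./2 _) _.
  by rewrite addnn -nE.
rewrite (bigD1_seq _ n_in (iota_uniq _ _)) /=.
rewrite -nE eqxx big1 ?addr0 // => k kn; case: eqP => [nk|]; last by rewrite scaler0.
by move: kn; rewrite nk doubleK eqxx.
Qed.

Variables (H : finType) (c : H -> 'I_s) (pi : H -> H).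

Definition card_matchings (A : {set H}) (E : sdiag s) : nat :=
  #|matchings c pi (edg (dgr E)) (@scol s E) A|.

Lemma card_matchings_sunion A i j P E : pi_stable pi A ->
  card_matchings A (sunion (strut i j P) E)
  = (\sum_(u in A | (c u == i) && (c (pi u) == j))
       card_matchings (A :\: [set u; pi u]) E)%N.
Proof.
move=> As; rewrite -(card_matchings_strut c _ _ _ _ As).
apply: (card_matchings_iso c pi (f := fun h : bool + 'I_(dsz E) => enum_rank
  (match h with inl x => inl (enum_rank x) | inr k => inr k end
     : 'I_(dsz (strut i j P)) + 'I_(dsz E)))).
- apply: inj_surj_bij => [[x|x] [y|y] /enum_rank_inj //|h].
  + by move=> [/enum_rank_inj ->].
  + by move=> [->].
  case Eh : (enum_val h) => [x|x].
    by exists (inl (enum_val x)); rewrite enum_valK -Eh enum_valK.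
  by exists (inr x); rewrite -Eh enum_valK.
- by case=> [x|x] /=; rewrite !enum_rankK /= ?enum_rankK.
- by case=> [x|x]; rewrite /scol /= !enum_rankK //= /scol /= enum_rankK.
Qed.

(* There are [#|A| = 2k] choices for the tail of the first strut, and they
determine its head. *)
Lemma sum_card_matchings k A : pi_stable pi A -> #|A| = k.*2 ->
  lsum (fun E => (card_matchings A E)%:R : rat^o) (strut_pow k)
  = (2 * a) ^+ k * k`!%:R.
Proof.
elim: k A => [|k ih] A As Ak.
  rewrite lsum_cons lsum_nil addr0 expr0 mul1r scale1r.
  have -> : card_matchings A (sempty s) = 1%N; last by [].
  rewrite -(@card_matchings0 H s c pi A id (fun x : void => match x with end)).
  apply: (card_matchings_iso c pi (f := @enum_rank void)) => [|[]|[]].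
  exact: enum_rank_bij.
rewrite [strut_pow _]/= lsum_mul /struts /=.
have lsumE (f : sdiag s -> rat^o) :
    lsum f [seq (a, strut i j (M i j)) | i <- enum 'I_s, j <- enum 'I_s]
    = \sum_i \sum_j a * f (strut i j (M i j)).
  rewrite /lsum big_allpairs_dep big_enum; apply: eq_bigr => i _ /=.
  by rewrite big_enum.
rewrite lsumE.
transitivity (\sum_i \sum_j \sum_(u in A | (c u == i) && (c (pi u) == j))
    a * ((2 * a) ^+ k * k`!%:R)).
  apply: eq_bigr => i _; apply: eq_bigr => j _; rewrite -mulr_sumr; congr (_ * _).
  transitivity (lsum (fun E => \sum_(u in A | (c u == i) && (c (pi u) == j))
      ((card_matchings (A :\: [set u; pi u]) E)%:R : rat^o)) (strut_pow k)).
    by apply: eq_lsum => p _; rewrite card_matchings_sunion // natr_sum.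
  rewrite /lsum; under eq_bigr do rewrite scaler_sumr.
  rewrite exchange_big /=; apply: eq_bigr => u /andP[uA _].
  apply: ih; first exact: pi_stableD.
  by have := card_pi_stableD As uA; rewrite Ak doubleS => -[].
(* The tail placed at [u] is compatible with a single term of [struts], the one whose ends have the
   colors of [u] and [pi u]. *)
have sum_delta (u : H) (x : rat) : \sum_i \sum_j
    (if (c u == i) && (c (pi u) == j) then x else 0) = x.
  rewrite (bigD1 (c u)) //= [X in _ + X]big1 ?addr0 => [|i ui].
    rewrite (bigD1 (c (pi u))) //= !eqxx big1 ?addr0 // => j uj.
    by rewrite eq_sym (negbTE uj) andbF.
  by rewrite big1 // => j _; rewrite eq_sym (negbTE ui).
under eq_bigr do under eq_bigr do rewrite big_mkcondr /=.
under eq_bigr do rewrite exchange_big /=.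
rewrite exchange_big /=; under eq_bigr do rewrite sum_delta.
(* The [2 (k + 1)] positions of the tail, times the coefficient [a], supply the new factors [2 a]
   and [k + 1]. *)
rewrite sumr_const Ak factS -muln2 -mulr_natr !natrM exprS.
by ring.
Qed.

End Struts.

(** * Gluing through struts *)

Section StrutGluing.
Variables (delta : Qt) (V : lmodType rat) (phi : ddiag -> V).
Hypotheses (delta_laurent : delta \in laurent) (phi_inv : bead_invariant delta phi).
Variables (s : nat) (M : 'M[Qt]_s).

Section OneGluing.
Variables (H K : finType) (g : graph H) (k : graph K) (c : H -> 'I_s) (cK : K -> 'I_s).
Hypothesis gF : gluable delta g (fun u v => M (c u) (c v)).
Hypotheses (k_ok : ok_graph (fun=> True) k) (kU : forall t, univ k t)
  (k_bead : forall t, bead k t = M (cK t) (cK (edg k t))).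
Local Notation HK := (K + H)%type.
Local Notation kg := (gunion k g).
Local Notation F := (fun u v => M (c u) (c v)).

Definition in_left (h : HK) : bool := if h is inl _ then true else false.
Definition sum_col (h : HK) : 'I_s :=
  match h with inl x => cK x | inr x => c x end.
Definition crossing (sigma : {ffun HK -> HK}) : bool :=
  [forall h, univ kg h ==>
     (in_left (sigma h) != in_left h) && (sum_col (sigma h) == sum_col h)].
Definition strut_gluing (sigma : {ffun HK -> HK}) : bool :=
  pairing (univ kg) sigma && crossing sigma.

(** The pairing of the points of [g] obtained by running through the struts. *)
Definition through (sigma : {ffun HK -> HK}) : {ffun H -> H} :=
  [ffun u => if sigma (inr u) is inl t then
               if sigma (inl (edg k t)) is inr v then v else u
             else u].

Lemma strut_gluingP sigma : strut_gluing sigma ->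
  [/\ forall h, sigma (sigma h) = h,
      forall u, ~~ univ g u -> sigma (inr u) = inr u,
      forall u, univ g u -> exists2 t, sigma (inr u) = inl t & cK t = c u
    & forall t, exists u, [/\ sigma (inl t) = inr u, univ g u & cK t = c u]].
Proof.
move=> /andP[/pairingP sP /forallP sC]; split.
- by move=> h; case: (sP h).
- move=> u /negbTE uU; have [_] := sP (inr u).
  by rewrite -[univ kg (inr u)]/(univ g u) uU.
- move=> u uU; have := sC (inr u); rewrite -[univ kg (inr u)]/(univ g u) uU /=.
  by case: (sigma (inr u)) => [t|v] //= /eqP e; exists t.
move=> t; have := sC (inl t); rewrite -[univ kg (inl t)]/(univ k t) kU /=.
have [_] := sP (inl t); rewrite -[univ kg (inl t)]/(univ k t) kU => -[_].
by case: (sigma (inl t)) => [t'|u] //= uU /eqP e; exists u.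
Qed.

Lemma throughP sigma u : strut_gluing sigma -> univ g u -> exists t,
  [/\ sigma (inr u) = inl t, sigma (inl (edg k t)) = inr (through sigma u),
      univ g (through sigma u), cK t = c u & cK (edg k t) = c (through sigma u)].
Proof.
move=> sg uU; have [_ _ sU sK] := strut_gluingP sg.
have [t ut tc] := sU u uU; have [v [tv vU vc]] := sK (edg k t).
by exists t; rewrite ffunE ut tv.
Qed.

(** Running back along the same strut gives an involution, without fixed points because the ends of
    a strut are distinct. *)
Lemma pairing_through sigma : strut_gluing sigma -> pairing (univ g) (through sigma).
Proof.
move=> sg; have [sK sn sU st] := strut_gluingP sg; apply/pairingP => u.
have [uU|uU] := boolP (univ g u); last by rewrite !ffunE !sn.
have [t [ut tv vU _ _]] := throughP sg uU.
have vt : sigma (inr (through sigma u)) = inl (edg k t) by rewrite -tv sK.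
have tu : sigma (inl t) = inr u by rewrite -ut sK.
split; first by rewrite [LHS]ffunE vt (ok_edgK k_ok) tu.
split=> // e; move: vt; rewrite e ut => -[] /esym; exact: (ok_edg_neq k_ok).
Qed.

(** A path that meets a strut follows an edge of [g], the strut and another edge of [g]; the label
    of the strut plays the part of the linking. No end of a strut survives, so the label 0 there is
    a dummy value. *)
Lemma strut_glue_spec sigma : strut_gluing sigma ->
  glue_spec kg sigma (univ kg) (fun _ _ => 1)
    (fun h => match h with inl t => inl t
              | inr u => inr (gedge g (through sigma) (univ g) u) end)
    (fun h => match h with inl t => 0
              | inr u => gbead g (through sigma) (univ g) F u end).
Proof.
move=> sg; have [g_ok gs FP] := gF; have piP := pairing_through sg.
have spec := gluable_spec (frefl _) gF piP.
have nl t (P : Prop) : ~~ univ kg (inl t) -> P.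
  by rewrite -[univ kg (inl t)]/(univ k t) kU.
split.
- exists (fun=> True); apply: ok_gunion => //.
  exact: ok_graphW g_ok.
- by move=> h /eqP.
- move=> [t|u] uU; first exact: nl uU.
  have H_gt0 : (0 < #|H|)%N by apply/card_gt0P; exists u.
  rewrite /gedge /gbead; case: ifPn => eU; last first.
    rewrite card_sum; case: (#|K| + #|H|)%N (ltn_addl #|K| H_gt0) => // n _ /=.
    by rewrite -[univ kg (inr _)]/(univ g _) (negbTE eU) mul1r.
  have [t [ut tv vU tc vc]] := throughP sg eU.
  have K_gt0 : (0 < #|K|)%N by apply/card_gt0P; exists t.
  (* The path undergoes two gluings, at the two ends of the strut, so the fuel has to be at least
     2. *)
  have : (1 < #|{: HK}|)%N by rewrite card_sum -(addn1 1) leq_add.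
  case: #|{: HK}| => [|[|n]] // _ /=.
  rewrite -[univ kg (inr _)]/(univ g _) eU ut /= -[univ kg (inl _)]/(univ k _) kU.
  rewrite tv /= !mul1r !mulr1 -[bead kg (inl t)]/(bead k t) k_bead tc vc.
  rewrite -[bead kg (inr _)]/(bead g _).
  have vU' : univ g (edg g (through sigma (edg g u))) = false by apply/negbTE/gs.
  case: n => [|n] /=; rewrite ?mul1r //.
  by rewrite -[univ kg (inr _)]/(univ g _) vU'.
- move=> [t|u] uU; first exact: nl uU.
  by apply: (gs_G spec).
- move=> [t|u] uU; first exact: nl uU.
  by rewrite (gs_eK spec).
- move=> [t|u] uU; first exact: nl uU.
  by move=> [] /(gs_neq spec uU).
- move=> [t|u] uU; first exact: nl uU.
  exact: (gs_bar spec).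
move=> [t|u] uU; first exact: nl uU.
by move=> eU; congr inr; apply: (gs_edge spec).
Qed.

Lemma strut_glue_okb sigma : strut_gluing sigma ->
  okb delta (glue kg sigma (univ kg) (fun _ _ => 1)).
Proof.
move=> sg; have piP := pairing_through sg.
apply: (okb_glue (strut_glue_spec sg)) => // -[t|u] uU.
  by move: uU; rewrite -[univ kg (inl t)]/(univ k t) kU.
have uU' : ~~ univ g u := uU.
pose x : {h | ~~ univ g h} := exist (fun h => ~~ univ g h) u uU'.
have := okb_bead x (gluable_okb (frefl _) gF piP delta_laurent).
by rewrite (bead_glue (gluable_spec (frefl _) gF piP)).
Qed.

Lemma strut_glue_eq sigma : strut_gluing sigma ->
  phi (dmk (glue kg sigma (univ kg) (fun _ _ => 1)))
  = phi (dmk (glue g (through sigma) (univ g) F)).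
Proof.
move=> sg; have piP := pairing_through sg.
apply/esym; apply: (glue_iso (f := inr) phi_inv (gluable_spec (frefl _) gF piP)
  (strut_glue_spec sg) (gluable_okb (frefl _) gF piP delta_laurent)
  (strut_glue_okb sg)) => //; first by move=> x y [].
move=> [t|u]; last by exists u.
by rewrite -[univ kg (inl t)]/(univ k t) kU.
Qed.

(** A gluing is determined by the points to which it sends the ends of the struts, and these form a
    matching along the induced pairing. Equal cardinalities guarantee, conversely, that a matching
    uses up all the univalent vertices. *)
Lemma card_strut_gluing (pi : {ffun H -> H}) :
  pairing (univ g) pi -> #|K| = #|[pred h | univ g h]| ->
  #|[pred sigma | strut_gluing sigma & through sigma == pi]|
  = #|matchings c pi (edg k) cK [set u | univ g u]|.
Proof.
move=> piP cardK; have piE := pairingP _ _ piP.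
pose ex (tau : {ffun K -> H}) : {ffun HK -> HK} :=
  [ffun h => match h with
             | inl t => inr (tau t)
             | inr u => if [pick t | tau t == u] is Some t then inl t else inr u
             end].
have ex_inj : injective ex.
  by move=> t t' /ffunP tt'; apply/ffunP => x; have := tt' (inl x);
     rewrite !ffunE => -[].
rewrite -(card_imset _ ex_inj); apply: eq_card => sigma; rewrite [LHS]inE.
apply/andP/imsetP => [[sg /eqP spi]|[tau /matchingsP[ti tP] ->]].
  have [sK sn sU st] := strut_gluingP sg.
  pose tau : {ffun K -> H} := [ffun t => projT1 (cid (st t))].
  have tauE t : sigma (inl t) = inr (tau t) /\ univ g (tau t) /\ cK t = c (tau t).
    by rewrite ffunE; case: cid => u /= [].
  have tau_inj : injective tau.
    move=> x y e; have [sx _] := tauE x; have [sy _] := tauE y.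
    by move: (sK (inl x)); rewrite sx e -sy sK => -[].
  exists tau.
    apply/matchingsP; split=> // t; have [ts [tU tc]] := tauE t; split=> //.
      by rewrite inE.
    have [t' [ut' tv _ _ _]] := throughP sg tU.
    move: ut'; rewrite -ts sK => -[et]; rewrite -et in tv.
    by move: tv; have [-> _] := tauE (edg k t); rewrite spi => -[].
  apply/ffunP => -[t|u]; rewrite ffunE; first by have [] := tauE t.
  case: pickP => [t /eqP tu|no].
    by rewrite -tu; have [<- _] := tauE t; rewrite sK.
  have [uU|uU] := boolP (univ g u); last exact: sn.
  have [t ut _] := sU u uU; have := no t; rewrite /= => /eqP[].
  by have [+ _] := tauE t; rewrite -ut sK => -[].
have exl t : ex tau (inl t) = inr (tau t) by rewrite ffunE.
have exr t : ex tau (inr (tau t)) = inl t.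
  by rewrite ffunE; case: pickP => [t' /eqP/ti ->|/(_ t)] //; rewrite /= eqxx.
have tauU t : univ g (tau t) by have [+ _ _] := tP t; rewrite inE.
(* An injection between finite sets of the same cardinality is onto. *)
have tau_onto u : univ g u -> exists t, tau t = u.
  have : tau @: [set: K] = [set u | univ g u].
    apply/eqP; rewrite eqEcard; apply/andP; split.
      by apply/fintype.subsetP => v /imsetP[t _ ->]; rewrite inE.
    rewrite (card_imset _ ti) cardsT cardK; apply: eq_leq.
    by apply: eq_card => v; rewrite !inE.
  by move=> /finset.setP/(_ u) e uU; move: e;
     rewrite inE uU => /imsetP[t _ ->]; exists t.
have exn u : ~~ univ g u -> ex tau (inr u) = inr u.
  by move=> uU; rewrite ffunE; case: pickP => // t /eqP e; case/negP: uU; rewrite -e.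
have sg : strut_gluing (ex tau).
  apply/andP; split.
    apply/pairingP => -[t|u].
      rewrite -[univ kg (inl t)]/(univ k t) kU exl exr; split=> //; split=> //.
      exact: tauU.
    rewrite -[univ kg (inr u)]/(univ g u); have [uU|uU] := boolP (univ g u).
      have [t <-] := tau_onto u uU; rewrite exr exl; split=> //; split=> //.
      exact: kU.
    by rewrite exn // exn.
  apply/forallP => -[t|u]; apply/implyP => uU.
    by rewrite exl /=; have [_ -> _] := tP t.
  have [t <-] := tau_onto u uU; rewrite exr /=.
  by have [_ -> _] := tP t.
split=> //; apply/eqP/ffunP => u; have [uU|uU] := boolP (univ g u).
  have [t <-] := tau_onto u uU; rewrite ffunE exr exl.
  by have [_ _ ->] := tP t.
rewrite ffunE exn //; have [_] := piE u.
by rewrite (negbTE uU) => ->.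
Qed.

Lemma sum_strut_gluings : #|K| = #|[pred h | univ g h]| ->
  \sum_(sigma | strut_gluing sigma)
     phi (dmk (glue kg sigma (univ kg) (fun _ _ => 1)))
  = \sum_(pi : {ffun H -> H} | pairing (univ g) pi)
      #|matchings c pi (edg k) cK [set u | univ g u]|%:R
        *: phi (dmk (glue g pi (univ g) F)).
Proof.
move=> cardK; rewrite (partition_big through (pairing (univ g))) /=; last first.
  by move=> sigma; apply: pairing_through.
apply: eq_bigr => pi piP; rewrite -(card_strut_gluing piP cardK).
rewrite (eq_bigr (fun=> phi (dmk (glue g pi (univ g) F)))).
  by rewrite sumr_const scaler_nat.
by move=> sigma /andP[sg /eqP <-]; apply: strut_glue_eq.
Qed.

End OneGluing.
End StrutGluing.

(** * Change of sign of the linkings *)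

Section Sign.
Variables (delta : Qt) (V : lmodType rat) (phi : ddiag -> V).
Hypotheses (delta_laurent : delta \in laurent) (phi_inv : bead_invariant delta phi).
Variables (H : finType) (g : graph H) (F : H -> H -> Qt).
Hypothesis gF : gluable delta g F.

Lemma gluableN : gluable delta g (fun u v => - F u v).
Proof.
have [g_ok gs FP] := gF; split=> // v v' vU v'U vv'.
have [d ->] := FP v v' vU v'U vv'; rewrite rmorphN; split=> //.
by rewrite /deltalab mulNr rpredN.
Qed.

Section OnePairing.
Variable pi : {ffun H -> H}.
Hypothesis piP : pairing (univ g) pi.

(** Interpolates between [F] and its opposite, since LE extracts the sign of one edge at a time. For
    a set stable under [pi], both members of a pair change sign, which preserves the Hermitian
    condition along [pi]. *)
Let negate (A : {set H}) (u v : H) : Qt := if u \in A then - F u v else F u v.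

Let piK u : pi (pi u) = u. Proof. by have [] := pairingP _ _ piP u. Qed.

Let stable_in A u : pi_stable pi A -> (pi u \in A) = (u \in A).
Proof. by move=> As; apply/idP/idP => /As[]; rewrite ?piK. Qed.

Let negate_spec A : pi_stable pi A -> glue_spec g pi (univ g) (negate A)
  (gedge g pi (univ g)) (gbead g pi (univ g) (negate A)).
Proof.
move=> As; have [? ? ? ? ? ? Fbar] := gluable_one_step (frefl _) gF piP.
apply: glue_spec1; split=> // h hU; rewrite /negate stable_in // Fbar //.
by case: ifP; rewrite ?rmorphN.
Qed.

Let negate_okb A : pi_stable pi A -> okb delta (glue g pi (univ g) (negate A)).
Proof.
move=> As; apply: (okb_glue (negate_spec As)) => // h hU.
have := okb_bead (exist (fun h => ~~ univ g h) h hU)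
                 (gluable_okb (frefl _) gF piP delta_laurent).
rewrite (bead_glue (gluable_spec (frefl _) gF piP)) /gbead /negate /=.
case: ifP => // _; case: ifP => // _ dF; rewrite mulrN mulNr -mulN1r.
by apply: deltasymM => //; rewrite rpredN rpred1.
Qed.

Let glue_negate (A : {set H}) : A \subset [set u | univ g u] -> pi_stable pi A ->
  ~~ odd #|A| /\ phi (dmk (glue g pi (univ g) (negate A)))
                = (-1) ^+ #|A|./2 *: phi (dmk (glue g pi (univ g) F)).
Proof.
have [n] := ubnP #|A|; elim: n A => // n ih A An AU As.
have [A0|[u uA]] := set_0Vmem A.
  rewrite A0 cards0 /= expr0 scale1r; split=> //; congr (phi (dmk (glue _ _ _ _))).
  by apply/funext => v; apply/funext => v'; rewrite /negate inE.
pose A' := A :\: [set u; pi u]; have cardA := card_pi_stableD As uA.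
have A's : pi_stable pi A' by apply: pi_stableD.
have [|||ev ih'] := ih A' => //.
- by move: An; rewrite cardA ltnS => /ltnW.
- exact: fintype.subset_trans (finset.subsetDl _ _) AU.
rewrite cardA /= negbK; split=> //.
have uU : univ g u by have := fintype.subsetP AU u uA; rewrite inE.
have [g_ok gs _] := gF.
rewrite exprS -scalerA -ih'.
rewrite (glue_LE (h := edg g u) (x := -1) (y := 0) phi_inv (negate_spec As)
  (negate_spec A's) (negate_spec A's) (frefl _) (frefl _) (negate_okb As)
  (negate_okb A's) (negate_okb A's)) ?scale0r ?addr0 //.
- exact: gs.
(* Any other path enters its pair at a point different from [u] and [pi u], where [A] and [A']
   agree. *)
- move=> z zU z1 z2; suff e : negate A' (edg g z) = negate A (edg g z).
    by rewrite /gbead e.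
  apply/funext => v; rewrite /negate !inE.
  have -> : (edg g z == u) = false.
    by apply/eqP => e; apply: z1; rewrite -e (ok_edgK g_ok).
  have -> // : (edg g z == pi u) = false.
  apply/eqP => e; apply: z2.
  by rewrite /gedge (ok_edgK g_ok) uU -e (ok_edgK g_ok).
rewrite /gbead (ok_edgK g_ok) uU /negate uA !inE eqxx /= /qc /tofracQ !rmorphN !rmorph1.
by rewrite !rmorph0 mul0r addr0 mulN1r mulrN mulNr.
Qed.

Lemma glue_opp : ~~ odd (nuni g) /\
  phi (dmk (glue g pi (univ g) (fun u v => - F u v)))
  = (-1) ^+ (nuni g)./2 *: phi (dmk (glue g pi (univ g) F)).
Proof.
have Us : pi_stable pi [set u | univ g u].
  move=> u; rewrite !inE => uU; have [_] := pairingP _ _ piP u.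
  by rewrite uU => -[? ?]; split.
have [ev e] := glue_negate (subxx _) Us.
have cE : #|[set u | univ g u]| = nuni g by rewrite cardsE.
rewrite -cE; split=> //; rewrite -e.
apply: (glue_iso (f := id) phi_inv (gluable_spec (frefl _) gluableN piP)
  (negate_spec Us) (gluable_okb (frefl _) gluableN piP delta_laurent)
  (negate_okb Us) (fun _ _ => id)) => //; first by move=> h _; exists h.
by move=> h hU; rewrite /gbead; case: ifP => // eU; rewrite /negate inE eU.
Qed.

End OnePairing.

(** Each pairing has half as many pairs as there are univalent vertices, and each pair contributes a
    sign; for an odd number there is no pairing. *)
Lemma psi_sum_opp : psi_sum phi g (fun u v => - F u v)
  = if odd (nuni g) then 0 else (-1) ^+ (nuni g)./2 *: psi_sum phi g F.
Proof.
case: ifPn => [odd_n|_].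
  by rewrite /psi_sum big1 // => pi piP; have [] := glue_opp piP; rewrite odd_n.
rewrite /psi_sum scaler_sumr; apply: eq_bigr => pi piP.
by have [] := glue_opp piP.
Qed.

End Sign.

(** * Gaussian integral of one diagram *)

Section Gauss.
Variables (delta : Qt) (s : nat) (M : 'M[Qt]_s).
Hypotheses (delta_laurent : delta \in laurent)
  (M_herm : forall i j, M j i = bar (M i j))
  (M_delta : forall i j, deltalab delta (M i j)).

(** The property of unions of struts used for gluing. It holds for a strut read from either end
    because [M] is Hermitian. *)
Definition strutty (E : sdiag s) : Prop :=
  [/\ ok_graph (fun=> True) (dgr E), forall h, univ (dgr E) h
    & forall h, bead (dgr E) h = M (scol h) (scol (edg (dgr E) h))].

Lemma strutty_empty : strutty (sempty s).
Proof.
have no (i : 'I_#|{: void}|) : False by case: (enum_val i).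
by split=> [|h|h]; [apply: ok_pack; split=> -[]|case: (no h)|case: (no h)].
Qed.

Lemma strutty_strut i j : strutty (strut i j (M i j)).
Proof.
split.
- by apply: ok_pack; split=> -[].
- by move=> h; rewrite univ_pack /univ /=.
by move=> h; rewrite /bead /scol /= enum_rankK; case: (enum_val h) => /=.
Qed.

Lemma strutty_union E E' : strutty E -> strutty E' -> strutty (sunion E E').
Proof.
move=> [ok1 U1 b1] [ok2 U2 b2]; split.
- by apply/ok_pack/ok_gunion.
- by move=> h; rewrite univ_pack; case: (enum_val h) => x; [apply: U1|apply: U2].
move=> h; rewrite /scol /= enum_rankK.
rewrite -[LHS]/(bead (gunion (dgr E) (dgr E')) (enum_val h)).
by case: (enum_val h) => x; [apply: b1|apply: b2].
Qed.

Lemma strutty_struts a : lall strutty (struts a M 2).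
Proof.
apply: (lall_flatten (P := strutty)) => i _ p /List.in_map_iff[j [<- _]].
exact: strutty_strut.
Qed.

Lemma lall_strut_pow a k :
  lall (fun E => strutty E /\ dsz E = k.*2) (strut_pow a M k).
Proof.
elim: k => [|k ih].
  by move=> p [<-|[]] /=; split; [exact: strutty_empty|exact: card_void].
apply: (lall_mul (P := fun E => strutty E /\ dsz E = 2) _ _ ih).
  move=> E E' [sE dE] [sE' dE']; split; first exact: strutty_union.
  by rewrite /= card_sum !card_ord dE dE' doubleS.
apply: (lall_flatten (P := fun E => strutty E /\ dsz E = 2)) => i _ p.
move=> /List.in_map_iff[j [<- _]]; split; first exact: strutty_strut.
exact: card_bool.
Qed.

Lemma lall_exp_struts a n : lall strutty (exp_struts a M n).
Proof.
apply: (lall_flatten (P := strutty)) => k _; apply: (lall_scale (P := strutty)).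
elim: k n => [|k ih] n; first by case: n => [|n] p //= [<-|//]; apply: strutty_empty.
apply: (lall_flatten (P := strutty)) => m _.
apply: (lall_mul (P := strutty) strutty_union _ (ih _)).
have [->|m2] := eqVneq m 2%N; first exact (@strutty_struts a).
by rewrite /struts (negbTE m2).
Qed.

Variable D : sdiag s.
Hypotheses (D_ok : oks D) (D_subst : no_strut (dgr D)).

Lemma gluable_sdiag : gluable delta (dgr D) (fun v v' => M (scol v) (scol v')).
Proof. by split. Qed.

Lemma lsum_bracket (V : lmodType rat) (phi : ddiag -> V) E :
  lsum phi (bracket E D)
  = \sum_(sigma | strut_gluing (dgr D) (dgr E) (@scol s D) (@scol s E) sigma)
    phi (dmk (glue (gunion (dgr E) (dgr D)) sigma (univ (gunion (dgr E) (dgr D)))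
                   (fun _ _ => 1))).
Proof.
rewrite /lsum /bracket big_map !big_filter big_filter_cond big_enum_cond.
by apply: eq_big => [sigma|sigma _]; rewrite ?scale1r.
Qed.

Lemma okb_bracket E : strutty E -> lall (fun d => okb delta (dgr d)) (bracket E D).
Proof.
move=> [E_ok EU E_bead] p /List.in_map_iff[sigma [<- sigma_in]].
apply: okb_pack.
apply: (strut_glue_okb delta_laurent gluable_sdiag E_ok EU E_bead).
have := In_mem sigma_in; rewrite mem_filter => /andP[sC].
by rewrite mem_filter => /andP[sP _]; apply/andP.
Qed.

Lemma psi_gauss (V : lmodType rat) (phi : ddiag -> V) : bead_invariant delta phi ->
  psi_sum phi (dgr D) (fun v v' => - M (scol v) (scol v'))
  = lsum (fun E => lsum phi (bracket E D)) (exp_struts (- 2^-1) M (nuni (dgr D))).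
Proof.
move=> phi_inv; rewrite (psi_sum_opp delta_laurent phi_inv gluable_sdiag).
rewrite lsum_exp_struts; case: ifPn => // n_even.
set n := nuni (dgr D); set k := n./2; have nE : n = k.*2 by rewrite /k even_halfK.
pose Y pi := phi (dmk (glue (dgr D) pi (univ (dgr D))
  (fun v v' => M (scol v) (scol v')))).
pose A : {set 'I_(dsz D)} := [set u | univ (dgr D) u].
(* The gluings of [E] to [D] are grouped by the pairing of [D] that they induce; the glued diagram
   [Y pi] depends on this pairing alone. *)
have -> : lsum (fun E => lsum phi (bracket E D)) (strut_pow (- 2^-1) M k)
  = lsum (fun E => \sum_(pi : {ffun 'I_(dsz D) -> 'I_(dsz D)}
                            | pairing (univ (dgr D)) pi)
                     (card_matchings (@scol s D) pi A E)%:R *: Y pi)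
      (strut_pow (- 2^-1) M k).
  apply: eq_lsum => p /lall_strut_pow[[E_ok EU E_bead] Ek].
  rewrite lsum_bracket.
  apply: (sum_strut_gluings delta_laurent phi_inv gluable_sdiag E_ok EU E_bead).
  by rewrite card_ord Ek -nE.
rewrite {1}/lsum; under [in RHS]eq_bigr do rewrite scaler_sumr.
rewrite exchange_big /= scaler_sumr /psi_sum scaler_sumr; apply: eq_bigr => pi piP.
transitivity ((k`!%:R^-1
  * lsum (fun E => (card_matchings (@scol s D) pi A E)%:R : rat^o)
      (strut_pow (- 2^-1) M k)) *: Y pi); last first.
  rewrite -scalerA; congr (_ *: _); rewrite /lsum scaler_suml.
  by apply: eq_bigr => p _; rewrite scalerA.
rewrite sum_card_matchings; last first.
- by rewrite cardsE -nE.
- move=> u; rewrite !inE => uU; have [piK] := pairingP _ _ piP u.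
  by rewrite uU => -[? ?]; split.
(* The weighted count of matchings is thus the sign (-1)^k times [k!], and the factorial cancels the
   one in the exponential. *)
have -> : 2 * - 2^-1 = -1 :> rat by [].
by rewrite mulrCA mulVf ?mulr1 // pnatr_eq0 -lt0n fact_gt0.
Qed.

End Gauss.

(** * The two invariants *)

(** Since [q] kills the generator [x i], the row with entry [q] at [i] is a relation, hence [v W]
    with [v] Laurent. Multiplying by the inverse of [W] shows that row [i] of [q] times this inverse
    is [v]. *)
Lemma presents_laurent s (W : 'M[Qt]_s) (A : lmodType LP) (b : A -> A -> Qt)
    (x : 'I_s -> A) (q : LP) :
  presents W b x -> (forall a : A, q *: a = 0) ->
  forall i j, lpval q * invmx W i j \in laurent.
Proof.
move=> [W_unit _ x_rel _] qA i j.
pose u k : LP := if k == i then q else 0.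
have [v vE] : exists v : 'I_s -> LP, forall j,
    lpval (u j) = \sum_i lpval (v i) * W i j.
  apply/x_rel; rewrite (bigD1 i) //= /u eqxx qA add0r big1 // => k /negbTE ->.
  exact: scale0r.
have : \row_k lpval (u k) = \row_k lpval (v k) *m W.
  by apply/rowP => k; rewrite !mxE vE; apply: eq_bigr => l _; rewrite mxE.
move/(congr1 (mulmx^~ (invmx W))); rewrite mulmxK // => /rowP/(_ j).
rewrite !mxE (bigD1 i) //= big1 ?addr0 => [|k ki].
  by rewrite mxE /u eqxx => ->; apply: lpvalP.
by rewrite mxE /u (negbTE ki) mul0r.
Qed.

(** The conjugate transpose of the inverse is a right inverse of [W], and the inverse is unique. *)
Lemma invmx_hermitian s (W : 'M[Qt]_s) : W \in unitmx -> hermitian W ->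
  forall i j, invmx W j i = bar (invmx W i j).
Proof.
move=> W_unit W_herm; pose N : 'M[Qt]_s := \matrix_(i, j) bar (invmx W j i).
have WN : W *m N = 1%:M.
  apply/matrixP => i j; rewrite !mxE.
  transitivity (bar ((invmx W *m W) j i)).
    rewrite mxE rmorph_sum; apply: eq_bigr => k _; rewrite mxE rmorphM /= mulrC.
    by have [_ ->] := W_herm k i.
  by rewrite mulVmx // mxE rmorph_nat eq_sym.
have e : invmx W = N by rewrite -[N](mulKmx W_unit) WN mulmx1.
by move=> i j; rewrite {1}e mxE.
Qed.

Lemma lall_filter D (P : D -> Prop) (a : rat * D -> bool) (x : lc rat D) :
  lall P x -> lall P [seq p <- x | a p].
Proof.
elim: x => [|p x ih] //= Px; case: (a p); last by apply: ih => q qx; apply: Px; right.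
move=> q [<-|]; first exact: (Px p (or_introl erefl)).
by apply: ih => r rx; apply: Px; right.
Qed.

(** * Closing of the diagrams of [omega] *)

Section Omega.
Variables (delta : Qt) (A : lmodType LP) (s : nat) (x : 'I_s -> A) (W : 'M[Qt]_s).
Variable h : gs (sdiag s).
Hypotheses (delta_laurent : delta \in laurent) (W_unit : W \in unitmx)
  (W_herm : hermitian W) (W_delta : forall i j, deltalab delta (invmx W i j))
  (h_wf : swf h) (h_subst : substantial h).

Let W_inv_herm := invmx_hermitian W_unit W_herm.

Let h_ok n m : lall (fun D => oks D /\ no_strut (dgr D))
  [seq p <- h m | ntri (dgr p.2) == n].
Proof.
apply: lall_filter => p ph; split; first by have [] := h_wf ph.
exact: h_subst ph.
Qed.

Lemma cgs_ok_omega : cgs_ok delta (omega x W h).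
Proof.
move=> n; apply: lall_flatten => m _; apply: lall_map => p /h_ok[D_ok D_s].
exact: (gluableN (gluable_sdiag W_inv_herm W_delta D_ok D_s)).
Qed.

Lemma okgs_gauss : okgs delta (gauss W h).
Proof.
move=> n; apply: lall_flatten => m _; apply: lall_bind => p /h_ok[D_ok D_s].
apply: lall_bind => q /(lall_exp_struts W_inv_herm) q_strutty.
exact: (okb_bracket delta_laurent W_inv_herm W_delta D_ok D_s q_strutty).
Qed.

Lemma psi_omega : bead_eq delta (psi (omega x W h)) (gauss W h).
Proof.
move=> n V phi phi_inv; rewrite lsum_bind !lsum_flatten !big_map.
apply: eq_bigr => m _; rewrite lsum_map lsum_bind; apply: eq_lsum => p /h_ok[D_ok D_s].
rewrite /= lsum_psi1 lsum_bind.
exact: (psi_gauss delta_laurent W_inv_herm W_delta D_ok D_s phi_inv).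
Qed.

End Omega.

(** * Normalization factors *)

Section Normalization.
Variables (delta : Qt) (A : lmodType LP).
Hypothesis delta_laurent : delta \in laurent.
Local Notation mulc := (gmul (fun _ _ => @cunion A)).
Local Notation powc := (gpow (fun _ _ => @cunion A) (cempty A)).
Local Notation invc := (ginv (fun _ _ => @cunion A) (cempty A)).
Local Notation muld := (gmul (fun _ _ => dunion)).
Local Notation powd := (gpow (fun _ _ => dunion) dempty).
Local Notation invd := (ginv (fun _ _ => dunion) dempty).

(** Couples the comparison with the admissibility of both series, which products and inverses demand
    at every stage. *)
Definition closes_to (x : gs (cdiag A)) (y : gs ddiag) : Prop :=
  [/\ cgs_ok delta x, okgs delta y & bead_eq delta (psi x) y].

Lemma closes_to_mul x x' y y' :
  closes_to x y -> closes_to x' y' -> closes_to (mulc x x') (muld y y').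
Proof.
move=> [okx oky exy] [okx' oky' exy']; split.
- exact: cgs_ok_mul.
- exact: okgs_mul.
move=> n V phi phi_inv; rewrite (psi_mul delta_laurent okx okx') //.
by apply: bead_eq_mul phi_inv => //; apply: okgs_psi.
Qed.

Lemma closes_to_pow x y k : closes_to x y -> closes_to (powc x k) (powd y k).
Proof.
move=> [okx oky exy]; split; [exact: cgs_ok_pow|exact: okgs_pow|].
move=> n V phi phi_inv; rewrite (psi_pow delta_laurent k okx) //.
by apply: bead_eq_pow phi_inv => //; apply: okgs_psi.
Qed.

Lemma closes_to_inv x y : closes_to x y -> closes_to (invc x) (invd y).
Proof.
move=> [okx oky exy]; split; [exact: cgs_ok_inv|exact: okgs_inv|].
move=> n V phi phi_inv; rewrite (psi_inv delta_laurent okx) //.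
by apply: bead_eq_inv phi_inv => //; apply: okgs_psi.
Qed.

Lemma closes_to_omega (T : tangle) phi (S : symm T phi) (x : 'I_(ncomp T) -> A) :
  sW S \in unitmx -> (forall i j, deltalab delta (invmx (sW S) i j)) ->
  closes_to (omega x (sW S) (sH S)) (gauss (sW S) (sH S)).
Proof.
case: S => G W h _ _ W_herm h_wf h_subst _ _ /= W_unit W_delta; split.
- exact: cgs_ok_omega W_unit W_herm W_delta h_wf h_subst.
- exact: okgs_gauss delta_laurent W_unit W_herm W_delta h_wf h_subst.
exact: psi_omega delta_laurent W_unit W_herm W_delta h_wf h_subst.
Qed.

End Normalization.

Theorem proposition5p6 (R : realType) (phi : seq bool -> rat)
    (Hphi : associator phi) (P : qsk_pair R)
    (A : lmodType LP) (b : A -> A -> Qt) (delta : LP)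
    (HA : blanchfield P b delta)
    (C : computation phi P b) (z : gs (cdiag A)) :
  geqmod (crel b (lpval delta)) z (Ztilde C) ->
  geqmod (drel (lpval delta)) (psi z) (ZKri C).
Proof.
move=> zZ n; have dl := lpvalP delta; apply/eqmod_relgen.
have gen_inv := bead_invariant_gen (lpval delta).
have psiE x : lsum (relgen (drel (lpval delta))) (psi x n)
            = lsum (@psi_gen A (lpval delta)) (x n).
  by rewrite lsum_bind; apply: eq_lsum => p _; rewrite lsum_psi1.
(* [psi_gen] vanishes on the relators of [crel], so the representative [z] gives way to the explicit
   series [Ztilde C]. *)
rewrite psiE (lsum_eqmod (psi_crel dl) (zZ n)) -psiE.
have dA (a : A) : delta *: a = 0.
  by case: HA => annih _; apply: (annih delta).2; exists 1; rewrite mul1r.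
have [_ _ cL_eq] : closes_to delta (Ztilde C) (ZKri C).
  apply: (closes_to_mul dl); last first.
    apply: (closes_to_omega dl); first by case: (c_pres C).
    by move=> i j; rewrite /deltalab mulrC; apply: presents_laurent (c_pres C) dA i j.
  have U_closes e : closes_to delta (omega (fun=> 0 : A) (sW (cU C e)) (sH (cU C e)))
                                    (gauss (sW (cU C e)) (sH (cU C e))).
    apply: (closes_to_omega dl); first by case: (c_presU C e).
    (* The module of an unknot is trivial, hence killed by 1: the inverse of its matrix has Laurent
       entries, and multiplying by [delta] keeps them so. *)
    move=> i j; have := presents_laurent (q := 1) (c_presU C e) _ i j.
    rewrite mul1r => U_laurent; apply: rpredM dl; apply: U_laurent => a.
    by apply/rowP => -[].
  by apply: (closes_to_mul dl); apply/(closes_to_pow dl)/(closes_to_inv dl)/U_closes.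
(* The class map modulo [drel] is one of the functionals tested by [bead_eq]. *)
exact: cL_eq gen_inv.
Qed.
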